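(* Suppose $\eta(n)=o(\kappa(n))$ as $n\to\infty$. Then, as $t\to\infty$, $$\frac{u(t,Z^{(1)}_t)}{u(t,-Z^{(1)}_t)}\to 1\qquad\text{in probability.}$$
   Context: Fix $\alpha\ge 2$. Let $(\xi_0(z))_{z\in\mathbb Z}$ be i.i.d. Pareto random variables with parameter $\alpha$, i.e. $\mathrm{Prob}(\xi_0(z)>x)=x^{-\alpha}$ for $x\ge 1$. Let $p:\mathbb N\to[0,1]$ be eventually nondecreasing with $p(n)\to 1$, and $q=1-p$. Define the potential $\xi:\mathbb Z\to[1,\infty)$ by $\xi(n)=\xi_0(n)$ for $n\ge 0$ and, independently for each $n\ge1$ (and independently of $\xi_0$), $\xi(-n)=\xi_0(n)$ with probability $p(n)$ and $\xi(-n)=\xi_0(-n)$ with probability $q(n)$. Let $u$ be the solution of $\partial_t u=\Delta u+\xi u$ on $(0,\infty)\times\mathbb Z$, $u(0,\cdot)=\mathbf 1_{\{0\}}$, with $(\Delta f)(z)=\sum_{|y-z|=1}(f(y)-f(z))$, given by $u(t,z)=\mathbb E[\exp\{\int_0^t\xi(X_s)ds\}\mathbf 1\{X_t=z\}]$ with $(X_s)$ the continuous-time random walk with generator $\Delta$ started at $0$. Let $D=\{z\in\mathbb N_0:\xi(z)=\xi(-z)\}$, $\Psi_t(z)=\xi(z)-\frac{|z|}{t}\log\xi(z)$, and $Z^{(1)}_t$ a maximiser of $\Psi_t$ over $D$. Let $\eta(n)=\sum_{z=1}^n q(z)$ and $\kappa(n)=n^{2/\alpha}$ if $\alpha>2$,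 $\kappa(n)=n/\log n$ if $\alpha=2$. *)

(* Defs.v *)
From HB Require Import structures.
From mathcomp Require Import all_boot all_order all_algebra.
From mathcomp Require Import all_classical all_reals all_analysis.
Set Implicit Arguments. Unset Strict Implicit. Unset Printing Implicit Defensive.
Import Order.TTheory GRing.Theory Num.Theory.
Import numFieldNormedType.Exports.
Local Open Scope classical_set_scope.
Local Open Scope ring_scope.

Definition mutually_independent d (Omega : measurableType d) (R : realType)
  (P : probability Omega R) (I : eqType) (X : I -> Omega -> R) : Prop :=
  (forall i, measurable_fun setT (X i)) /\
  forall (J : seq I) (A : I -> set R), uniq J ->
    (forall i, i \in J -> measurable (A i)) ->
    P (\big[setI/setT]_(i <- J) (X i @^-1` A i)) =
    (\prod_(i <- J) P (X i @^-1` A i))%E.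

Definition potential (Omega : Type) (R : realType)
  (xi0 : int -> Omega -> R) (B : nat -> Omega -> R) (w : Omega) (z : int) : R :=
  match z with
  | Posz n => xi0 (Posz n) w
  | Negz k => if B k w == 1 then xi0 (Posz k.+1) w else xi0 (Negz k) w
  end.

Definition eta_fun (R : realType) (p : nat -> R) (n : nat) : R :=
  \sum_(1 <= z < n.+1) (1 - p z).

Definition kappa_fun (R : realType) (alpha : R) (n : nat) : R :=
  if 2 < alpha then (n%:R) `^ (2 / alpha) else n%:R / ln (n%:R).

(* Walk built from holding times E (Exp(2)) and steps D (+-1):
   jump times T_k = sum_{i<k} E_i, skeleton S_k = sum_{i<k} D_i. *)
Definition jump_time (Omega : Type) (R : realType) (E : nat -> Omega -> R)
  (k : nat) (w : Omega) : R := \sum_(i < k) E i w.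
Definition skeleton (Omega : Type) (R : realType) (D : nat -> Omega -> R)
  (k : nat) (w : Omega) : R := \sum_(i < k) D i w.

Definition is_walk (Omega : Type) (R : realType) (E D : nat -> Omega -> R)
  (X : R -> Omega -> int) : Prop :=
  forall (s : R) (w : Omega) (k : nat),
    (forall i, (i < k)%N -> D i w = 1 \/ D i w = -1) ->
    jump_time E k w <= s < jump_time E k.+1 w ->
    (X s w)%:~R = skeleton D k w.

(* Feynman-Kac: u(t,z) = E_Q[ exp(int_0^t xi(X_s) ds) 1{X_t = z} ] (in \bar R) *)
Definition fk_solution d (Omega : measurableType d) (R : realType)
  (Q : probability Omega R) (X : R -> Omega -> int) (xi : int -> R)
  (t : R) (z : int) : \bar R :=
  (\int[Q]_w (expeR (\int[lebesgue_measure]_(s in `[0%R, t]%classic) (xi (X s w))%:E)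
              * ((X t w == z)%:R)%:E))%E.

Definition Psi (R : realType) (xi : int -> R) (t : R) (z : nat) : R :=
  xi (Posz z) - z%:R / t * ln (xi (Posz z)).

Definition is_max_Psi (R : realType) (xi : int -> R) (t : R) (z : nat) : Prop :=
  xi (Posz z) = xi (- Posz z) /\
  forall y : nat, xi (Posz y) = xi (- Posz y) -> Psi xi t y <= Psi xi t z.

(* Main.v *)
(** The Feynman-Kac formula writes [u t z] as a sum over lattice paths from 0 to
    [z] of iterated convolutions of the exponentials [s |-> exp ((xi v - 2) s)],
    one for each visited vertex [v]; reflecting the paths to [- Z] replaces [xi]
    by its reflection. Let [lam = xi Z] and [a = (t / ln t)^(1/(alpha - 1))]. In a
    typical environment every other relevant site lies below [lam] by a multiple
    of [a]. Hence long paths are negligible, and so are the paths which do not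
    visit each exclusive site [v] in (0, Z) (one with [xi v <> xi (- v)]) exactly
    once, or which visit any other exclusive site. On the remaining paths each
    exclusive site contributes one convolution factor, equal to [1 / (lam - xi v)]
    up to [1 + o(1)], and the other factors are common to [xi] and its reflection.
    The ratio is thus [prod_v (lam - xi (- v)) / (lam - xi v)] up to [1 + o(1)],
    and its logarithm is [sum_v (xi v - xi (- v)) / lam] up to a sum of squares
    over [lam ^ 2]. As [eta = o(kappa)], the second moments of these sums,
    truncated at [a], are [o(a ^ 2)]. The site [Z] is one of boundedly many (in
    expectation) sites [z] with [xi z] of order [a], and the sum over [v < z] is
    independent of [xi z], so a union bound over these candidates suffices. *)

Require Import Defs.
From HB Require Import structures.
From mathcomp Require Import all_boot all_order all_algebra.
From mathcomp Require Import all_classical all_reals all_analysis.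
From mathcomp Require Import measurable_realfun.
From mathcomp Require Import ring lra zify.
Set Implicit Arguments. Unset Strict Implicit. Unset Printing Implicit Defensive.
Import Order.TTheory GRing.Theory Num.Theory.
Import numFieldNormedType.Exports.
Local Open Scope classical_set_scope.
Local Open Scope ring_scope.

(** * Iterated convolutions of exponentials *)

Local Open Scope ereal_scope.

(** The comparison rests on how fast the common factor [rest_sum] varies in time. The exclusive
    factors decay at rates [lam - xi v] of order [a], so they act on the time scale [1 / a]. A time
    shift [x] changes the common factor by a relative amount of about [8 x / k], with [k = g a / 2]:
    only holding at [Z] does not decay, and its effect is measured by deleting an excursion of
    length at least 2. So each exclusive site costs an error of order [1 / a ^ 2], and so does a
    loop at it. This is borderline, since the number of exclusive sites is only bounded by
    [(ep a) ^ 2]; hence [ep] must be small against the separation constant [g]. That bound is read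
    off from the sum of squares, because [xi > 1]. The function [kappa] is what second moments ask
    for at distance [a ^ alpha]: the second moment truncated at [a] is bounded if [alpha > 2] and of
    order [ln a] if [alpha = 2]. Integrands are nonnegative and extended real, so differences are
    written as sums on both sides until finiteness is known. *)

Definition hold (R : realType) (c s : R) : \bar R :=
  if (0 <= s)%R then (expR (c * s))%:E else 0.

(** The convolution runs over the whole line: [hold] cuts off negative [s], and an [f] that vanishes
    on negative times cuts off [s > t]. Constants and exponentials are then also admissible as [f];
    they serve as comparison functions. *)
Definition holdT (R : realType) (c : R) (f : R -> \bar R) (t : R) : \bar R :=
  \int[lebesgue_measure]_s (hold c s * f (t - s)%R).

Definition heaviside (R : realType) (t : R) : \bar R :=
  if (0 <= t)%R then 1 else 0.

Definition holds (R : realType) (l : seq R) (f : R -> \bar R) : R -> \bar R :=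
  foldr (@holdT R) f l.

Definition nnm (R : realType) (f : R -> \bar R) :=
  measurable_fun setT f /\ forall x, 0 <= f x.

Definition ndf (R : realType) (f : R -> \bar R) :=
  forall x y, (x <= y)%R -> f x <= f y.

Section hold_operators.
Context (R : realType).
Implicit Types (c t s x : R) (f g : R -> \bar R) (l : seq R).

Lemma hold_ge0 c s : 0 <= hold c s.
Proof. by rewrite /hold; case: ifP => // _; rewrite lee_fin expR_ge0. Qed.

Lemma measurable_hold c : measurable_fun setT (hold c).
Proof.
rewrite /hold; apply: measurable_fun_ifT => //.
  apply: (measurable_fun_bool true) => /=.
  rewrite [X in measurable X](_ : _ = `[0%R, +oo[%classic); last first.
    by rewrite setTI; apply/seteqP; split => x /=; rewrite in_itv/= andbT.
  exact: measurable_itv.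
apply/measurable_EFinP; apply: measurableT_comp; first exact: measurable_expR.
exact: measurable_funM.
Qed.

Lemma measurable_refl t : measurable_fun setT (fun s => t - s)%R.
Proof. exact: measurable_funB. Qed.

Lemma nnm_hold_mul c f t : nnm f ->
  measurable_fun setT (fun s => hold c s * f (t - s)%R) /\
  forall s, 0 <= hold c s * f (t - s)%R.
Proof.
move=> [mf f0]; split; last by move=> s; rewrite mule_ge0// hold_ge0.
apply: emeasurable_funM; first exact: measurable_hold.
by apply: (measurableT_comp mf); exact: measurable_refl.
Qed.

Lemma holdT_nnm c f : nnm f -> nnm (holdT c f).
Proof.
move=> [mf f0]; split; last first.
  by move=> t; apply: integral_ge0 => s _; rewrite mule_ge0// hold_ge0.
pose F (z : R * R) := hold c z.2 * f (z.1 - z.2)%R.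
apply: (@measurable_fun_fubini_tonelli_F _ _ _ _ _ lebesgue_measure F).
  rewrite /F; apply: emeasurable_funM.
    by apply: measurableT_comp => //; exact: measurable_hold.
  by apply: (measurableT_comp mf); exact: measurable_funB.
by move=> z; rewrite mule_ge0// hold_ge0.
Qed.

Lemma holds_nnm l f : nnm f -> nnm (holds l f).
Proof. by move=> nf; elim: l => //= c l IH; exact: holdT_nnm. Qed.

Lemma le_holdT c f g t : nnm f -> nnm g ->
  (forall x, (x <= t)%R -> f x <= g x) -> holdT c f t <= holdT c g t.
Proof.
move=> nf ng fg; have [mf f0] := nnm_hold_mul c t nf.
have [mg g0] := nnm_hold_mul c t ng.
apply: ge0_le_integral => //= s _; rewrite /hold.
case: ifP => [s0|_]; last by rewrite !mul0e.
by apply: lee_wpmul2l; [rewrite lee_fin expR_ge0|apply: fg; rewrite gerBl].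
Qed.

Lemma le_holds l f g t : nnm f -> nnm g ->
  (forall x, (x <= t)%R -> f x <= g x) -> holds l f t <= holds l g t.
Proof.
move=> nf ng; elim: l t => [|c l IH] t fg /=; first exact: fg.
apply: le_holdT; [exact: holds_nnm|exact: holds_nnm|].
by move=> x xt; apply: IH => y yx; apply: fg; exact: le_trans xt.
Qed.

Lemma holdT_ndf c f : nnm f -> ndf f -> ndf (holdT c f).
Proof.
move=> nf df x y xy; have [mf f0] := nnm_hold_mul c x nf.
have [mg g0] := nnm_hold_mul c y nf.
apply: ge0_le_integral => //= s _.
by apply: lee_wpmul2l; [exact: hold_ge0|apply: df; rewrite lerB].
Qed.

Lemma holds_ndf l f : nnm f -> ndf f -> ndf (holds l f).
Proof.
by move=> nf df; elim: l => //= c l IH; apply: holdT_ndf => //; exact: holds_nnm.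
Qed.

(** Tonelli. This commutativity lets a loop, or all the exclusive sites, be pulled out of a path. *)
Lemma holdTC c d f : nnm f -> holdT c (holdT d f) = holdT d (holdT c f).
Proof.
move=> nf; have [mf f0] := nf; apply/funext => t; rewrite /holdT.
pose F (z : R * R) := hold c z.1 * (hold d z.2 * f (t - z.1 - z.2)%R).
transitivity (\int[lebesgue_measure]_x \int[lebesgue_measure]_y F (x, y)).
  apply: eq_integral => s _; rewrite -ge0_integralZl//=; last 3 first.
  - by have [] := nnm_hold_mul d (t - s) nf.
  - by move=> x _; rewrite mule_ge0// hold_ge0.
  - exact: hold_ge0.
have mF : measurable_fun setT F.
  rewrite /F; apply: emeasurable_funM.
    by apply: measurableT_comp => //; exact: measurable_hold.
  apply: emeasurable_funM.
    by apply: measurableT_comp => //; exact: measurable_hold.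
  apply: (measurableT_comp mf); apply: measurable_funB => //.
  exact: measurable_funB.
have F0 : forall z, 0 <= F z by move=> z; rewrite !mule_ge0// hold_ge0.
rewrite fubini_tonelli//; apply: eq_integral => s _.
rewrite -ge0_integralZl//=; last 3 first.
- by have [] := nnm_hold_mul c (t - s) nf.
- by move=> x _; rewrite mule_ge0// hold_ge0.
- exact: hold_ge0.
by apply: eq_integral => u _; rewrite /F/= muleCA addrAC.
Qed.

Lemma holds_cat l1 l2 f : holds (l1 ++ l2) f = holds l1 (holds l2 f).
Proof. by rewrite /holds foldr_cat. Qed.

Lemma holdT_holds c l f : nnm f -> holdT c (holds l f) = holds l (holdT c f).
Proof.
by move=> nf; elim: l => //= d l <-; rewrite holdTC//; exact: holds_nnm.
Qed.

Lemma holdTD c f g t : nnm f -> nnm g ->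
  holdT c (fun x => f x + g x) t = holdT c f t + holdT c g t.
Proof.
move=> nf ng; have [mf f0] := nnm_hold_mul c t nf.
have [mg g0] := nnm_hold_mul c t ng.
rewrite /holdT -ge0_integralD//; apply: eq_integral => s _.
by rewrite ge0_muleDr//; [case: nf|case: ng].
Qed.

Lemma nnmD f g : nnm f -> nnm g -> nnm (fun x => f x + g x).
Proof.
move=> [mf f0] [mg g0]; split; first exact: emeasurable_funD.
by move=> x; rewrite adde_ge0.
Qed.

Lemma nnmZ (k : \bar R) f : 0 <= k -> nnm f -> nnm (fun x => k * f x).
Proof.
move=> k0 [mf f0]; split; last by move=> x; rewrite mule_ge0.
exact: emeasurable_funM.
Qed.

Lemma nnm_cst (k : \bar R) : 0 <= k -> nnm (cst k : R -> \bar R).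
Proof. by split. Qed.

Lemma nnm_heaviside : nnm (@heaviside R).
Proof.
split; last by move=> x; rewrite /heaviside; case: ifP.
rewrite [X in measurable_fun _ X](_ : _ = @hold R 0%R); last first.
  by apply/funext => x; rewrite /heaviside/hold mul0r expR0.
exact: measurable_hold.
Qed.

Lemma ndf_heaviside : ndf (@heaviside R).
Proof.
move=> x y xy; rewrite /heaviside; case: ifPn => x0; last by case: ifP.
by rewrite (le_trans x0 xy).
Qed.

Lemma holdsD l f g t : nnm f -> nnm g ->
  holds l (fun x => f x + g x) t = holds l f t + holds l g t.
Proof.
move=> nf ng; elim: l t => //= c l IH t.
rewrite -holdTD; [|exact: holds_nnm..].
by congr holdT; apply/funext => x.
Qed.

Lemma holdTZ c (k : \bar R) f t : 0 <= k -> nnm f ->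
  holdT c (fun x => k * f x) t = k * holdT c f t.
Proof.
move=> k0 nf; have [mf f0] := nnm_hold_mul c t nf.
by rewrite /holdT -ge0_integralZl//; apply: eq_integral => s _; rewrite muleCA.
Qed.

Lemma holdsZ l (k : \bar R) f t : 0 <= k -> nnm f ->
  holds l (fun x => k * f x) t = k * holds l f t.
Proof.
move=> k0 nf; elim: l t => //= c l IH t.
rewrite -holdTZ//; last exact: holds_nnm.
by congr holdT; apply/funext => x.
Qed.

Lemma nnm_sum (I : Type) (r : seq I) (f : I -> R -> \bar R) :
  (forall i, nnm (f i)) -> nnm (fun x => \sum_(i <- r) f i x).
Proof.
move=> nf; split; last by move=> x; apply: sume_ge0 => i _; have [] := nf i.
by apply: emeasurable_sum => i; have [] := nf i.
Qed.

Lemma holds_sum (I : Type) (r : seq I) l (f : I -> R -> \bar R) t :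
  (forall i, nnm (f i)) ->
  holds l (fun x => \sum_(i <- r) f i x) t = \sum_(i <- r) holds l (f i) t.
Proof.
move=> nf; elim: r => [|i r IH].
  rewrite big_nil; transitivity (holds l (fun x => 0 * (@heaviside R) x) t).
    by congr holds; apply/funext => x; rewrite big_nil mul0e.
  by rewrite holdsZ// ?mul0e//; exact: nnm_heaviside.
rewrite big_cons -IH -holdsD//; last exact: nnm_sum.
by congr holds; apply/funext => x; rewrite big_cons.
Qed.

Lemma holdT_shift c f t x : holdT c (fun y => f (y - x)%R) t = holdT c f (t - x).
Proof. by apply: eq_integral => s _; rewrite addrAC. Qed.

Lemma nnm_shift f x : nnm f -> nnm (fun y => f (y - x)%R).
Proof.
move=> [mf f0]; split => //; apply: (measurableT_comp mf).
exact: measurable_funB.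
Qed.

Lemma holds_shift l f t x : holds l (fun y => f (y - x)%R) t = holds l f (t - x).
Proof.
elim: l t => //= c l IH t; rewrite -holdT_shift.
by congr holdT; apply/funext => y; exact: IH.
Qed.

(** For [c < 0] the function [hold c] is [(- c)^-1] times the exponential density of rate [- c]. *)
Lemma holdT_cst c t : (c < 0)%R -> holdT c (cst 1) t = (- c)^-1%:E.
Proof.
move=> c0; have c0' : (0 < - c)%R by rewrite oppr_gt0.
rewrite /holdT; transitivity (\int[lebesgue_measure]_s
   ((- c)^-1%:E * (exponential_pdf (- c) s)%:E)).
  apply: eq_integral => s _; rewrite mule1 /hold -EFinM.
  case: ifPn => s0; last by rewrite lt0_exponential_pdf ?mulr0// ltNge.
  by rewrite exponential_pdfE// mulrA mulVf ?gt_eqF// mul1r opprK.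
rewrite ge0_integralZl//=.
- by rewrite integral_exponential_pdf// mule1.
- by apply/measurable_EFinP; exact: measurable_exponential_pdf.
- by move=> s _; rewrite lee_fin exponential_pdf_ge0// ltW.
- by rewrite lee_fin invr_ge0 ltW.
Qed.

Lemma nnm_exp (g : R) (t0 : R) : nnm (fun x => (expR (g * (x - t0)))%:E).
Proof.
split; last by move=> x; rewrite lee_fin expR_ge0.
apply/measurable_EFinP; apply: measurableT_comp; first exact: measurable_expR.
by apply: measurable_funM => //; exact: measurable_funB.
Qed.

(** Exponentials are eigenfunctions: moving one through the convolution tilts [c] into [c - g],
    which leaves a constant to be integrated. *)
Lemma holdT_exp c (g t0 : R) t : (c < g)%R ->
  holdT c (fun x => (expR (g * (x - t0)))%:E) t =
  (g - c)^-1%:E * (expR (g * (t - t0)))%:E.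
Proof.
move=> c0; transitivity ((expR (g * (t - t0)))%:E * holdT (c - g)%R (cst 1) t).
  rewrite -holdTZ ?lee_fin ?expR_ge0//.
  apply: eq_integral => s _; rewrite /= mule1 /hold.
  case: ifP => _; last by rewrite !mul0e.
  by rewrite -!EFinM -!expRD; congr (expR _)%:E; ring.
by rewrite holdT_cst ?subr_lt0// opprB muleC.
Qed.

Lemma holds_exp l (g t0 : R) t : all (fun c => c < g)%R l ->
  holds l (fun x => (expR (g * (x - t0)))%:E) t =
  (\prod_(c <- l) (g - c)^-1 * expR (g * (t - t0)))%:E.
Proof.
elim: l t => [|c l IH] t /=; first by rewrite big_nil mul1r.
move=> /andP[cg lg].
rewrite (_ : holds _ _ = fun x => (\prod_(c <- l) (g - c)^-1)%R%:E *
  (expR (g * (x - t0)))%:E); last first.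
  by apply/funext => x; rewrite IH.
rewrite holdTZ ?holdT_exp//; last 2 first.
- rewrite lee_fin; elim: l lg {IH} => [|d l IH] /=; first by rewrite big_nil.
  move=> /andP[dg lg]; rewrite big_cons mulr_ge0 ?IH//.
  by rewrite invr_ge0 subr_ge0 ltW.
- exact: nnm_exp.
by rewrite big_cons -!EFinM mulrCA mulrA.
Qed.

Lemma holds_cst l t : all (fun c => c < 0)%R l ->
  holds l (cst 1) t = (\prod_(c <- l) (- c)^-1)%R%:E.
Proof.
move=> lg; have := holds_exp 0 t lg; rewrite mul0r expR0 mulr1.
under [X in _ = X%:E]eq_bigr do rewrite add0r.
by move=> <-; congr holds; apply/funext => x; rewrite mul0r expR0.
Qed.

Lemma heaviside_le1 x : heaviside x <= 1.
Proof. by rewrite /heaviside; case: ifP. Qed.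

(** Monotonicity bounds [f (t - s)] by [f t], and [hold c] has mass [(- c)^-1]. This is the price of
    a visit to a site of depth [k]. *)
Lemma holdT_le_inv c k f t : (0 < k)%R -> (c <= - k)%R -> nnm f -> ndf f ->
  holdT c f t <= k^-1%:E * f t.
Proof.
move=> k0 ck nf df; have [mf f0] := nf.
have c0 : (c < 0)%R by rewrite (le_lt_trans ck)// oppr_lt0.
apply: (@le_trans _ _ ((- c)^-1%:E * f t)); last first.
  apply: lee_wpmul2r => //; rewrite lee_fin lef_pV2 ?posrE// ?oppr_gt0//.
  by rewrite lerNr.
rewrite -(holdT_cst t c0) muleC -holdTZ//.
apply: le_holdT => //; first by apply: nnmZ => //; exact: nnm_cst.
by move=> x xt; rewrite mule1; exact: df.
Qed.

Lemma holds_le_inv l k f t : (0 < k)%R -> all (fun c => c <= - k)%R l ->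
  nnm f -> ndf f -> holds l f t <= (k^-1 ^+ size l)%R%:E * f t.
Proof.
move=> k0 + nf df; elim: l t => [|c l IH] t /=; first by rewrite expr0 mul1e.
move=> /andP[ck lk]; apply: (le_trans (holdT_le_inv t k0 ck _ _)).
- exact: holds_nnm.
- exact: holds_ndf.
rewrite exprS EFinM -muleA lee_wpmul2l ?lee_fin ?invr_ge0 ?(ltW k0)//.
exact: IH.
Qed.

End hold_operators.

(** * Size of iterated convolutions and their growth in time *)

Section hold_bounds.
Context (R : realType).
Implicit Types (c t s x : R) (f g : R -> \bar R) (l : seq R).
Local Notation mu := (@lebesgue_measure R).
Local Notation h0 := (@heaviside R).

Definition ramp t : \bar R := if (0 <= t)%R then t%:E else 0.

Lemma holdT0_heaviside : holdT 0 h0 = ramp.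
Proof.
apply/funext => t; rewrite /holdT /ramp.
transitivity (\int[mu]_s (\1_(`[0%R, t]%classic : set R) s)%:E).
  apply: eq_integral => s _; rewrite /hold /heaviside mul0r expR0 indicE.
  rewrite subr_ge0 mem_setE in_itv/=.
  by case: (0 <= s)%R; case: (s <= t)%R; rewrite /= ?mul0e ?mule0 ?mule1.
rewrite integral_indic//= setIT lebesgue_measure_itv/= lte_fin.
case: ltgtP => [t0|t0|<-]//=; first by rewrite oppr0 adde0.
Qed.

Lemma ramp_shift t x : (0 <= x)%R -> ramp t <= ramp (t - x) + x%:E * h0 t.
Proof.
move=> x0; rewrite /ramp /heaviside; case: ifPn => t0.
  rewrite mule1; case: ifPn => tx; first by rewrite -EFinD subrK.
  by rewrite add0e lee_fin; rewrite -ltNge subr_lt0 in tx; exact: ltW.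
by rewrite mule0 adde0; case: ifP => // h; rewrite lee_fin.
Qed.

Lemma nnm_ramp : nnm ramp.
Proof. by rewrite -holdT0_heaviside; apply: holdT_nnm; exact: nnm_heaviside. Qed.

(** The coefficient 0 belongs to a visit to [Z]: holding there does not decay, so only the length
    [t] of the time interval bounds it. *)
Lemma holdT0_le f t : (0 <= t)%R -> nnm f -> ndf f ->
  (forall x, (x < 0)%R -> f x = 0) -> holdT 0 f t <= t%:E * f t.
Proof.
move=> t0 nf df fN; have [_ f0] := nf.
apply: (@le_trans _ _ (holdT 0 (fun x => f t * h0 x) t)).
  apply: le_holdT => //; first by apply: nnmZ => //; exact: nnm_heaviside.
  move=> x xt; rewrite /heaviside; case: ifPn => x0.
    by rewrite mule1; exact: df.
  by rewrite mule0 fN// ltNge.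
rewrite holdTZ//; last exact: nnm_heaviside.
by rewrite holdT0_heaviside /ramp t0 muleC.
Qed.

Lemma holds_neg l t : (t < 0)%R -> holds l h0 t = 0.
Proof.
elim: l t => [|c l IH] t t0 /=; first by rewrite /heaviside leNgt t0.
rewrite /holdT integral0_eq// => s _; rewrite /hold.
by case: ifP => [s0|]; rewrite ?mul0e// IH ?mule0//; lra.
Qed.

(** Holding for a time at most [lam^-1] loses no more than a factor [exp (-1)], and this window has
    length [lam^-1]. *)
Lemma holdT_ge c (lam : R) f t : (0 < lam)%R -> (- lam <= c)%R -> nnm f -> ndf f ->
  (expR (-1) / lam)%:E * f (t - lam^-1)%R <= holdT c f t.
Proof.
move=> l0 lc nf df; have [mf f0] := nf.
have [mg g0] := nnm_hold_mul c t nf.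
pose k := (expR (-1))%:E * f (t - lam^-1)%R.
have k0 : 0 <= k by rewrite mule_ge0// lee_fin expR_ge0.
apply: (@le_trans _ _ (\int[mu]_s
   (k * (\1_(`[0%R, lam^-1]%classic : set R) s)%:E))).
  rewrite ge0_integralZl//=.
  - rewrite integral_indic//= setIT lebesgue_measure_itv/= lte_fin invr_gt0 l0.
    by rewrite oppr0 adde0 /k muleAC EFinM.
  - by apply/measurable_EFinP; exact: measurable_indic.
apply: ge0_le_integral => //=.
- by move=> s _; rewrite mule_ge0// lee_fin.
- apply: emeasurable_funM => //.
  by apply/measurable_EFinP; exact: measurable_indic.
move=> s _; rewrite indicE mem_setE in_itv/=.
case: andP => [[s0 sl]|_]; last by rewrite mule0.
rewrite mule1 /k /hold s0.
apply: lee_pmul => //.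
  rewrite lee_fin ler_expR.
  have : (lam * s <= 1)%R by rewrite mulrC -ler_pdivlMr// div1r.
  nra.
by apply: df; rewrite lerB.
Qed.

Lemma holds_ge l (lam : R) t : (0 < lam)%R -> all (fun c => - lam <= c)%R l ->
  ((size l)%:R / lam <= t)%R -> ((expR (-1) / lam) ^+ size l)%:E <= holds l h0 t.
Proof.
move=> l0 al.
suff H : forall t, ((expR (-1) / lam) ^+ size l)%:E * h0 (t - (size l)%:R / lam)%R
    <= holds l h0 t.
  move=> lt; apply: le_trans (H t).
  by rewrite /heaviside subr_ge0 lt mule1.
move=> {}t; elim: l t al => [|c l IH] t /=.
  by rewrite mul0r subr0 expr0 mul1e.
move=> /andP[lc al].
apply: le_trans (holdT_ge t l0 lc _ _); last 2 first.
- by apply: holds_nnm; exact: nnm_heaviside.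
- by apply: holds_ndf; [exact: nnm_heaviside|exact: ndf_heaviside].
rewrite exprS EFinM -muleA; apply: lee_wpmul2l.
  by rewrite lee_fin divr_ge0// ?expR_ge0// ltW.
apply: le_trans (IH _ al); apply: lee_wpmul2l.
  by rewrite lee_fin exprn_ge0// divr_ge0// ?expR_ge0// ltW.
by apply: ndf_heaviside; rewrite -addn1 natrD; lra.
Qed.

Lemma prod_le_expn (I : Type) (r : seq I) (F : I -> R) (P : pred I) k :
  (0 <= k)%R -> (forall i, P i -> 0 <= F i <= k)%R -> all P r ->
  (0 <= \prod_(i <- r) F i <= k ^+ size r)%R.
Proof.
move=> k0 H; elim: r => [|i r IH] /=; first by rewrite big_nil expr0 ler01 lexx.
move=> /andP[/H/andP[i0 ik]] /IH/andP[r0 rk]; rewrite big_cons exprS.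
by rewrite mulr_ge0//= ler_pM.
Qed.

(** Exponential Markov inequality: [heaviside x] is at most [exp (theta x)], and exponentials are
    eigenfunctions. *)
Lemma holds_le_exp l (theta M : R) t : (0 <= theta)%R -> (M < theta)%R ->
  all (fun c => c <= M)%R l ->
  holds l h0 t <= (expR (theta * t) * (theta - M)^-1 ^+ size l)%:E.
Proof.
move=> th0 Mth al.
apply: (@le_trans _ _ (holds l (fun x => (expR (theta * (x - 0)))%:E) t)).
  apply: le_holds; [exact: nnm_heaviside|exact: nnm_exp|].
  move=> x _; rewrite /heaviside; case: ifPn => x0; rewrite lee_fin ?expR_ge0//.
  by rewrite -expR0 ler_expR subr0 mulr_ge0.
rewrite holds_exp; last first.
  by apply: sub_all al => c cM; exact: le_lt_trans Mth.
rewrite subr0 mulrC lee_fin ler_wpM2l ?expR_ge0//.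
have tM : (0 < theta - M)%R by rewrite subr_gt0.
have H0 : (0 <= (theta - M)^-1)%R by rewrite invr_ge0 ltW.
have /(_ _)/andP[|//] := @prod_le_expn _ l (fun c => (theta - c)^-1)%R (fun c => c <= M)%R
  _ H0 _ al.
move=> c /= cM; have tc : (0 < theta - c)%R by lra.
by rewrite invr_ge0 (ltW tc)/= lef_pV2// lerD2l lerN2.
Qed.

Lemma perm_holds l1 l2 f : nnm f -> perm_eq l1 l2 -> holds l1 f = holds l2 f.
Proof.
move=> nf; elim: l1 l2 => [|c l1 IH] l2.
  by move=> /perm_size/esym/size0nil->.
move=> p; have cl2 : c \in l2 by rewrite -(perm_mem p) mem_head.
have p2 : perm_eq l2 (c :: rem c l2) by exact: perm_to_rem.
have p1 : perm_eq l1 (rem c l2).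
  by rewrite -(perm_cons c) (perm_trans p).
rewrite /= (IH _ p1).
elim: l2 cl2 {p p2 p1 IH} => //= d l2 IH.
rewrite inE eq_sym; case: eqVneq => [->//|/= cd cl2].
by rewrite holdTC ?IH//; exact: holds_nnm.
Qed.

Lemma holds_extract_le (E : seq R) (G : R -> \bar R) t :
  all (fun c => c < 0)%R E -> nnm G -> ndf G ->
  holds E G t <= (\prod_(c <- E) (- c)^-1)%:E * G t.
Proof.
move=> aE nG dG; have [_ G0] := nG.
rewrite -(holds_cst t aE) muleC -holdsZ//; apply: le_holds => //.
  by apply: nnmZ => //; exact: nnm_cst.
by move=> x xt; rewrite mule1; exact: dG.
Qed.

(* [1 <= 1{tau} + e^{g (t - tau)} - 1 + eps] is the growth hypothesis in a form
   without subtraction; all three terms are eigenfunctions up to constants. *)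
Lemma holds_extract_ge (E : seq R) (G : R -> \bar R) (g eps t : R) :
  all (fun c => c < - g)%R E -> (0 <= g)%R -> (eps <= 1)%R -> nnm G ->
  (forall tau, (tau <= t)%R ->
     (2 - eps)%:E * G t <= G tau + G t * (expR (g * (t - tau)))%:E) ->
  ((2 - eps) * \prod_(c <- E) (- c)^-1)%:E * G t <=
    holds E G t + G t * (\prod_(c <- E) (- c - g)^-1)%:E.
Proof.
move=> aE g0 e1 nG HG; have [_ G0] := nG.
have aE0 : all (fun c => c < 0)%R E.
  by apply: sub_all aE => c /= cg; rewrite (lt_le_trans cg)// oppr_le0.
have -> : ((2 - eps) * \prod_(c <- E) (- c)^-1)%:E * G t =
   holds E (fun x => ((2 - eps)%:E * G t) * cst 1 x) t.
  rewrite holdsZ ?holds_cst//.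
    by rewrite EFinM -!muleA; congr (_ * _); rewrite muleC.
  by rewrite mule_ge0// lee_fin; lra.
have -> : G t * (\prod_(c <- E) (- c - g)^-1)%:E =
   holds E (fun x => G t * (expR (- g * (x - t)))%:E) t.
  rewrite holdsZ//; last exact: nnm_exp.
  rewrite holds_exp// subrr mulr0 expR0 mulr1; congr (_ * (_)%:E).
  by apply: eq_bigr => c _; rewrite addrC.
have nE : nnm (fun x => G t * (expR (- g * (x - t)))%:E).
  by apply: nnmZ => //; exact: nnm_exp.
rewrite -holdsD//; apply: le_holds => //.
- apply: nnmZ; last exact: nnm_cst.
  by rewrite mule_ge0// lee_fin; lra.
- exact: nnmD.
move=> x xt; rewrite mule1; apply: (le_trans (HG x xt)).
by rewrite -[(x - t)%R]opprB mulrNN.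
Qed.

(** Meant for paths that meet [Z] only at their end. All factors decay, so the convolution lies
    between [(1 - e) p] and its limit [p] at every time from [t / 2] on, in particular at [t - x]
    and at [t]. *)
Lemma holds_no_zero_growth l (k t x : R) : (0 < k)%R ->
  all (fun c => c <= - k)%R l -> (0 <= x)%R -> (x <= t / 2)%R ->
  (2 ^+ size l * expR (- (k * t / 4)) <= 2^-1)%R ->
  holds l h0 t <= holds l h0 (t - x) +
    (2 * (2 ^+ size l * expR (- (k * t / 4))))%:E * holds l h0 t.
Proof.
move=> k0 al x0 xt He; set e := (_ * expR _)%R in He *.
have al0 : all (fun c => c < 0)%R l.
  by apply: sub_all al => c /= ck; lra.
have alk : all (fun c => c < - (k / 2))%R l.
  by apply: sub_all al => c /= ck; lra.
pose p := (\prod_(c <- l) (- c)^-1)%R.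
have p0 : (0 <= p)%R.
  rewrite /p; elim: l al0 {al He alk e p} => [|c l IH] /=; first by rewrite big_nil.
  by move=> /andP[c0 /IH]; rewrite big_cons => ?; rewrite mulr_ge0// invr_ge0; lra.
have pk : (\prod_(c <- l) (- (k/2) - c)^-1 <= 2 ^+ size l * p)%R.
  rewrite /p; elim: l al {al0 He alk e p p0} => [|c l IH] /=.
    by rewrite !big_nil expr0 mulr1.
  move=> /andP[c0 al]; rewrite !big_cons exprS mulrACA.
  have c1 : (0 < - c)%R by lra.
  have c2 : (0 < - (k/2) - c)%R by lra.
  apply: ler_pM => //.
  - by rewrite invr_ge0 ltW.
  - elim: l al {IH} => [|d l IH] /=; first by rewrite big_nil.
    move=> /andP[d0 al]; rewrite big_cons mulr_ge0 ?IH// invr_ge0; lra.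
  - rewrite ler_pdivlMr// mulrC ler_pdivrMr//; lra.
  - exact: IH.
have nh := nnm_heaviside R.
have e0 : (0 <= e)%R by rewrite mulr_ge0// ?exprn_ge0// expR_ge0.
have key y : (t / 2 <= y)%R -> ((1 - e) * p)%:E <= holds l h0 y.
  move=> ty; have t0 : (0 <= t)%R by lra.
  have : p%:E <= holds l h0 y + (e * p)%:E.
    rewrite -(holds_cst y al0).
    (* The constant 1 is at most [h0 s + exp (- (k / 2) s)]. The tilt by [k / 2] at most doubles
       each factor, whence [2 ^+ size l]; with [y >= t / 2] the exponent is at least [k t / 4]. *)
    apply: (@le_trans _ _ (holds l (fun s => h0 s + (expR (- (k/2) * (s - 0)))%:E) y)).
      apply: le_holds => //.
        by apply: nnmD => //; exact: nnm_exp.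
      move=> s _; rewrite /heaviside /=; case: ifPn => s0.
        by rewrite leeDl// lee_fin expR_ge0.
      rewrite add0e lee_fin -[leLHS]expR0 ler_expR.
      rewrite -ltNge in s0; nra.
    rewrite holdsD//; last exact: nnm_exp.
    rewrite leeD2l// holds_exp// lee_fin subr0 /e -mulrA [(expR _ * p)%R]mulrC mulrA.
    apply: ler_pM => //.
    - elim: l alk {al al0 He e p pk p0 e0} => [|d l IH] /=; first by rewrite big_nil.
      move=> /andP[d0 al]; rewrite big_cons mulr_ge0 ?IH// invr_ge0; lra.
    - rewrite ler_expR; nra.
  rewrite mulrBl mul1r EFinB leeBlDr//.
have Hp y : holds l h0 y <= p%:E.
  rewrite -(holds_cst y al0); apply: le_holds => // s _; exact: heaviside_le1.
have t0 : (0 <= t)%R by lra.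
have k1 : ((1 - e) * p)%:E <= holds l h0 (t - x) by apply: key; lra.
have k2 : ((1 - e) * p)%:E <= holds l h0 t by apply: key; lra.
have H0 y : holds l h0 y \is a fin_num.
  rewrite ge0_fin_numE; first exact: le_lt_trans (Hp y) (ltry _).
  by have [] := holds_nnm l nh.
move: k1 k2 (Hp t) (H0 t) (H0 (t - x)%R).
case: (holds l h0 t) => // u; case: (holds l h0 (t - x)) => // v.
rewrite !lee_fin => k1 k2 up _ _.
nra.
Qed.

(** The 0 is the last visit to [Z] and [b] the remainder of the last excursion. Convolving the final
    step function with this 0 gives the Lipschitz function [ramp], so a shift by [x] costs [x] times
    the weight of the path with that excursion deleted. *)
Lemma holds_zero_growth (l b : seq R) (t x k : R) : (0 <= x)%R -> (0 < k)%R ->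
  all (fun c => c <= - k)%R b ->
  holds (l ++ 0%R :: b) h0 t <= holds (l ++ 0%R :: b) h0 (t - x) +
    (x * k^-1 ^+ size b)%:E * holds l h0 t.
Proof.
move=> x0 k0 ab; have nh := nnm_heaviside R.
have -> : holds (l ++ 0%R :: b) h0 = holds (l ++ b) ramp.
  rewrite -holdT0_heaviside -holdT_holds//.
  have -> // := @perm_holds (l ++ 0%R :: b) (0%R :: l ++ b) h0 nh.
  by rewrite (perm_catCA l [:: 0%R] b).
apply: (@le_trans _ _ (holds (l ++ b) (fun s => ramp (s - x) + x%:E * h0 s) t)).
  apply: le_holds => //; first exact: nnm_ramp.
    by apply: nnmD; [apply: nnm_shift; exact: nnm_ramp|exact: nnmZ].
  by move=> s _; exact: ramp_shift.
rewrite holdsD//; last 2 first.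
- by apply: nnm_shift; exact: nnm_ramp.
- exact: nnmZ.
rewrite holds_shift holdsZ// leeD2l// EFinM -muleA lee_wpmul2l//.
rewrite (@perm_holds _ (b ++ l))//; last by rewrite perm_catC.
rewrite holds_cat; apply: holds_le_inv => //; first exact: holds_nnm.
by apply: holds_ndf => //; exact: ndf_heaviside.
Qed.

End hold_bounds.

(** * Lattice paths *)

Local Open Scope ring_scope.

Definition step_of (b : bool) : int := if b then 1 else -1.

Fixpoint endp (x : int) (s : seq bool) : int :=
  if s is b :: s' then endp (x + step_of b) s' else x.

(** The endpoint is left out: once the potential is shifted to vanish at the endpoint [Z], the
    factor there is [heaviside], which is kept apart. *)
Fixpoint trail (x : int) (s : seq bool) : seq int :=
  if s is b :: s' then x :: trail (x + step_of b) s' else [::].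

Lemma endp_cat x s1 s2 : endp x (s1 ++ s2) = endp (endp x s1) s2.
Proof. by elim: s1 x => //= b s IH x. Qed.

Lemma trail_cat x s1 s2 : trail x (s1 ++ s2) = trail x s1 ++ trail (endp x s1) s2.
Proof. by elim: s1 x => //= b s IH x; rewrite IH. Qed.

Lemma size_trail x s : size (trail x s) = size s.
Proof. by elim: s x => //= b s IH x; rewrite IH. Qed.

Lemma endp_dist x s : `|endp x s - x| <= (size s)%:Z.
Proof.
elim: s x => [|b s IH] x /=; first by lia.
by have := IH (x + step_of b); rewrite /step_of; case: b; lia.
Qed.

Lemma endp_parity x s : exists k : int, endp x s = x + (size s)%:Z - 2 * k.
Proof.
elim: s x => [|b s IH] x /=; first by exists 0; lia.
have [k ->] := IH (x + step_of b); rewrite /step_of; case: b.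
  by exists k; lia.
by exists (k + 1); lia.
Qed.

Lemma loop_size x s : s != [::] -> endp x s = x -> (2 <= size s)%N.
Proof. by move=> s0; have [k ->] := endp_parity x s; case: s s0 => //= b s _; lia. Qed.

Lemma trail_dist x s v : v \in trail x s ->
  `|v - x| + `|endp x s - v| <= (size s)%:Z.
Proof.
elim: s x => //= b s IH x; rewrite inE => /orP[/eqP->|/IH].
  have := endp_dist (x + step_of b) s.
  by rewrite /step_of; case: b; lia.
by rewrite /step_of; case: b; lia.
Qed.

Lemma first_visit x s v : v \in trail x s -> exists p b q,
  [/\ s = p ++ b :: q, endp x p = v & v \notin trail x p].
Proof.
elim: s x => //= b s IH x; rewrite inE; case: eqVneq => [->|vx /= /IH].
  by exists [::], b, s.
move=> [p [b' [q [-> e n]]]]; exists (b :: p), b', q; split => //=.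
by rewrite inE negb_or vx.
Qed.

Lemma last_visit x s v : v \in trail x s -> exists p b q,
  [/\ s = p ++ b :: q, endp x p = v & v \notin trail (v + step_of b) q].
Proof.
elim: s x => //= b s IH x.
case: (boolP (v \in trail (x + step_of b) s)) => [/IH[p [b' [q [-> e n]]]] _|n].
  by exists (b :: p), b', q.
rewrite inE (negbTE n) orbF => /eqP vx; exists [::], b, s; split => //.
by move: n; rewrite -vx.
Qed.

Lemma trail_ivt x s v : x <= v -> v < endp x s -> v \in trail x s.
Proof.
elim: s x => [|b s IH] x /=; first by lia.
move=> xv ve; rewrite inE; case: eqVneq => //= vx; apply: IH => //.
by rewrite /step_of; case: b ve; lia.
Qed.

Lemma trail_below x s v : x < v -> v \notin trail x s -> all (< v) (trail x s).
Proof.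
elim: s x => //= b s IH x xv; rewrite inE negb_or => /andP[_ n].
rewrite xv /=; case: s IH n => // b' s IH n; apply: IH => //.
have : x + step_of b != v by move: n; rewrite /= inE negb_or eq_sym => /andP[].
by rewrite /step_of; case: b {n}; lia.
Qed.

Lemma trail_nseq_true n x : trail x (nseq n true) = [seq x + i%:Z | i <- iota 0 n].
Proof.
elim: n x => //= n IH x; rewrite addr0 IH -(addn0 1%N) iotaDl -map_comp.
by congr cons; apply: eq_map => i /=; rewrite /step_of; lia.
Qed.

Lemma endp_nseq_true n x : endp x (nseq n true) = x + n%:Z.
Proof. by elim: n x => [|n IH] x /=; rewrite ?IH /step_of; lia. Qed.

Section exclusive_sites.
Context (excl : pred int) (Z : nat).

Definition excl_list : seq int := [seq v <- [seq i%:Z | i <- iota 0 Z] | excl v].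

Lemma excl_list_uniq : uniq excl_list.
Proof.
by rewrite filter_uniq// map_inj_uniq ?iota_uniq// => i j [].
Qed.

Lemma mem_excl_list v : (v \in excl_list) = [&& excl v, 0 <= v & v < Z%:Z].
Proof.
rewrite mem_filter; congr andb; apply/mapP/andP => [[i]|[v0 vZ]].
  by rewrite mem_iota => iZ ->; split; lia.
by exists `|v|%N; rewrite ?mem_iota; lia.
Qed.

Definition good (s : seq bool) : bool :=
  (endp 0 s == Z%:Z) && perm_eq [seq v <- trail 0 s | excl v] excl_list.

Lemma good_direct : good (nseq Z true).
Proof.
rewrite /good endp_nseq_true add0r eqxx trail_nseq_true.
have -> : [seq 0 + i%:Z | i <- iota 0 Z] = [seq i%:Z | i <- iota 0 Z].
  by apply: eq_map => i; rewrite add0r.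
exact: perm_refl.
Qed.

(** Since [p] avoids [y], the place of the loop can be read off from the shortened path as its first
    visit to [y]. Since the loop avoids [Z], all its vertices are deep. *)
Definition early_loop (y : int) (s : seq bool) : Prop := exists p b q,
  [/\ s = p ++ b ++ q, endp 0 p = y, y \notin trail 0 p &
      [/\ endp y b = y, b != [::] & Z%:Z \notin trail y b]].

(** Here the place is not recoverable; a factor [N + 1] pays for it, which is affordable because the
    length [2 K] yields a high power of [1 / k]. *)
Definition long_excursion (K : nat) (s : seq bool) : Prop := exists p e b q,
  [/\ s = p ++ (e :: b) ++ q, endp 0 p = Z, endp Z (e :: b) = Z,
      Z%:Z \notin trail (Z%:Z + step_of e) b & (2 * K <= (size b).+1)%N].

(** Cut the path at its first hit of [Z] into [u ++ v]. An exclusive site in [v] is further than [K]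
    from [Z] and forces a long excursion. The part [u] crosses every exclusive site of [(0, Z)], so
    its defect is either a visit to the left of 0, which closes a loop at 0, or a repeated visit,
    which closes a loop at that site. *)
Lemma bad_path (K : nat) s : ~~ excl 0 -> (0 < Z)%N ->
  (forall v, excl v -> K%:Z < `|v - Z%:Z|) ->
  endp 0 s = Z -> ~~ good s ->
  (exists2 y, y \in 0 :: excl_list & early_loop y s) \/ long_excursion K s.
Proof.
move=> e0 Z0 eK eZ; rewrite /good eZ eqxx /= => ng.
have [u [v [es uZ uN]]] : exists u v, [/\ s = u ++ v, endp 0 u = Z & Z%:Z \notin trail 0 u].
  case: (boolP (Z%:Z \in trail 0 s)) => [/first_visit[p [b [q [-> ? ?]]]]|?].
    by exists p, (b :: q).
  by exists s, [::]; rewrite cats0.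
have vZ : endp Z v = Z by move: eZ; rewrite es endp_cat uZ.
have ub : all (< Z%:Z) (trail 0 u) by apply: trail_below => //; lia.
case: (boolP (has excl (trail Z v))) => [/hasP[x xv ex]|nv].
  right; have [p [b [q [ev px _]]]] := first_visit xv.
  have xZ : x != Z by apply/eqP => xZ; have := eK x ex; rewrite xZ; lia.
  have qZ : endp x (b :: q) = Z by move: vZ; rewrite ev endp_cat px.
  have [p1 [e [p2 [ep p1Z n2]]]] : exists p1 e p2,
      [/\ p = p1 ++ e :: p2, endp Z p1 = Z & Z%:Z \notin trail (Z%:Z + step_of e) p2].
    apply: last_visit; case: p px {ev} => [/= ZZ|a p _]; last by rewrite /= mem_head.
    by rewrite ZZ eqxx in xZ.
  have [q1 [q2 [eq q1Z n1]]] : exists q1 q2,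
      [/\ b :: q = q1 ++ q2, endp x q1 = Z & Z%:Z \notin trail x q1].
    case: (boolP (Z%:Z \in trail x (b :: q))) => [/first_visit[r [c [w [-> ? ?]]]]|?].
      by exists r, (c :: w).
    by exists (b :: q), [::]; rewrite cats0.
  have p2x : endp (Z%:Z + step_of e) p2 = x by move: px; rewrite ep endp_cat p1Z.
  exists (u ++ p1), e, (p2 ++ q1), q2; split.
  - by rewrite es ev ep eq -!catA /= -!catA.
  - by rewrite endp_cat uZ.
  - by rewrite /= endp_cat p2x.
  - by rewrite trail_cat mem_cat p2x negb_or n2.
  - have := endp_dist (Z%:Z + step_of e) p2; rewrite p2x.
    have := endp_dist x q1; rewrite q1Z; have := eK x ex.
    rewrite size_cat /step_of; case: e {ep n2 p2x}; lia.
left; have fs : [seq v <- trail 0 s | excl v] = [seq v <- trail 0 u | excl v].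
  rewrite es trail_cat filter_cat uZ -[RHS]cats0; congr (_ ++ _).
  by apply/eqP; rewrite -[_ == _]negbK -has_filter.
rewrite fs in ng.
case: (boolP (has (fun x => excl x && (x < 0)) (trail 0 u))) => [/hasP[x xu /andP[ex x0]]|hn].
  exists 0; first by rewrite mem_head.
  have [p [b [q [eu px _]]]] := first_visit xu.
  have qZ : endp x (b :: q) = Z by move: uZ; rewrite eu endp_cat px.
  have /first_visit[q1 [b1 [q2 [eq q10 _]]]] : 0 \in trail x (b :: q).
    by apply: trail_ivt; rewrite ?qZ; lia.
  exists [::], (p ++ q1), (b1 :: q2 ++ v); split => //=.
    by rewrite es eu eq -!catA.
  split; first by rewrite endp_cat px.
    by rewrite -size_eq0 size_cat; case: p px {eu} => //= px; rewrite px in x0; lia.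
  by move: uN; rewrite eu eq catA trail_cat mem_cat negb_or => /andP[].
have sub : {subset [seq v <- trail 0 u | excl v] <= excl_list}.
  move=> x; rewrite mem_filter mem_excl_list => /andP[ex xu].
  have xZ : x < Z%:Z := allP ub _ xu; rewrite ex xZ andbT /=.
  by have /hasPn/(_ _ xu) := hn; rewrite ex /= -leNgt.
have nu : ~~ uniq [seq v <- trail 0 u | excl v].
  apply: contra ng => un; apply: uniq_perm => //; first exact: excl_list_uniq.
  move=> x; apply/idP/idP; first exact: sub.
  rewrite mem_excl_list mem_filter => /and3P[-> x0 xZ] /=.
  by apply: trail_ivt => //; rewrite uZ.
have [y yc] : exists y, (1 < count_mem y [seq v <- trail 0 u | excl v])%N.
  apply: contrapT => nex; move/negP: nu; apply; apply: count_mem_uniq => x.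
  have /negP : ~ (1 < count_mem x [seq v <- trail 0 u | excl v])%N by move=> h; apply: nex; exists x.
  rewrite -leqNgt -has_pred1 has_count.
  by case: (count_mem _ _) => [|[|]].
have yu : y \in [seq v <- trail 0 u | excl v].
  by rewrite -has_pred1 has_count (ltn_trans _ yc).
exists y; first by rewrite inE sub ?orbT.
have ycu : (1 < count_mem y (trail 0 u))%N.
  apply: leq_trans yc _; rewrite count_filter; apply: sub_count => z /=.
  by case/andP.
have /first_visit[p [b [q [eu py yn]]]] : y \in trail 0 u.
  by rewrite -has_pred1 has_count (ltn_trans _ ycu).
have /first_visit[b1 [c [q1 [eq b1y _]]]] : y \in trail (y + step_of b) q.
  rewrite -has_pred1 has_count; move: ycu; rewrite eu trail_cat count_cat py /= eqxx.
  by move/count_memPn: yn => ->; rewrite add0n add1n ltnS.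
exists p, (b :: b1), (c :: q1 ++ v); split => //=.
  by rewrite es eu eq -!catA /= -!catA.
split => //; move: uN.
by rewrite eu eq -cat_cons catA trail_cat mem_cat negb_or trail_cat mem_cat negb_or py => /andP[/andP[]].
Qed.

(** On reaching [Z] a path has crossed all of [(0, Z)], so the single visits allowed to it are used
    up. Deleting what follows therefore stays within the good paths, as the growth estimate for
    [rest_sum] requires. *)
Lemma good_last_excursion p b : good (p ++ b) -> endp 0 p = Z ->
  good p /\ all (predC excl) (trail Z b).
Proof.
rewrite /good endp_cat trail_cat filter_cat => /andP[_ pe] pZ.
rewrite pZ eqxx /= in pe *.
have nb : all (predC excl) (trail Z b).
  apply/allP => v vb /=; apply/negP => ev.
  have vE : v \in excl_list by rewrite -(perm_mem pe) mem_cat !mem_filter ev vb orbT.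
  have vp : v \in trail 0 p.
    by move: vE; rewrite mem_excl_list => /and3P[_ ? ?]; apply: trail_ivt; rewrite ?pZ.
  have := excl_list_uniq; rewrite -(perm_uniq pe) cat_uniq => /and3P[_ /hasPn + _].
  by move=> /(_ v); rewrite !mem_filter ev vb vp => /(_ isT).
split=> //; suff nil : [seq v <- trail Z b | excl v] = [::] by rewrite nil cats0 in pe.
by apply/eqP; rewrite -[_ == _]negbK -has_filter -all_predC.
Qed.

End exclusive_sites.

(** * Path sums *)

Lemma sub_uniq_perm (I : eqType) (s1 s2 : seq I) : uniq s1 -> {subset s1 <= s2} ->
  exists s3, perm_eq s2 (s1 ++ s3).
Proof.
elim: s1 s2 => [|x s1 IH] s2 /=; first by exists s2.
move=> /andP[xs1 us1] sub; have xs2 : x \in s2 by apply: sub; rewrite mem_head.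
have [|s3 ps3] := IH (rem x s2) us1.
  move=> y ys1; have ys2 : y \in s2 by apply: sub; rewrite inE ys1 orbT.
  have := ys2; rewrite (perm_mem (perm_to_rem xs2)) inE; case: eqVneq => // yx.
  by rewrite -yx ys1 in xs1.
exists s3; apply: (perm_trans (perm_to_rem xs2)).
by rewrite perm_cons.
Qed.

(** A choice of [j] for each [i] is injective because [phi] undoes it, so the left side is dominated
    by a partial sum of the right one. In the applications [phi] reassembles a path from its
    pieces. *)
Lemma lee_sum_inj (R : realType) (I J : eqType) (L : seq I) (M : seq J)
    (P : pred I) (Q : pred J) (phi : J -> I) (F : I -> \bar R) (F' : J -> \bar R)
    (j0 : J) :
  uniq L -> (forall j, 0 <= F' j)%E ->
  (forall i, i \in L -> P i ->
     exists j, [/\ j \in M, Q j, phi j = i & (F i <= F' j)%E]) ->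
  (\sum_(i <- L | P i) F i <= \sum_(j <- M | Q j) F' j)%E.
Proof.
move=> uL F0 H; have [g Hg] : exists g : I -> J, forall i, i \in L -> P i ->
    [/\ g i \in M, Q (g i), phi (g i) = i & (F i <= F' (g i))%E].
  suff /choice[g Hg] : forall i, exists j, i \in L -> P i ->
    [/\ j \in M, Q j, phi j = i & (F i <= F' j)%E] by exists g.
  move=> i.
  case: (boolP ((i \in L) && P i)) => [/andP[iL Pi]|nLP].
    by have [j Hj] := H i iL Pi; exists j.
  by exists j0 => iL Pi; rewrite iL Pi in nLP.
apply: (@le_trans _ _ (\sum_(i <- L | P i) F' (g i))%E).
  rewrite big_seq_cond [leRHS]big_seq_cond; apply: lee_sum => i /andP[iL Pi].
  by have [] := Hg i iL Pi.
rewrite -big_filter -[leRHS]big_filter -(big_map g predT F').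
have [s3 ps3] : exists s3,
    perm_eq [seq j <- M | Q j] ([seq g i | i <- L & P i] ++ s3).
  apply: sub_uniq_perm.
    rewrite map_inj_in_uniq ?filter_uniq// => i i'.
    rewrite !mem_filter => /andP[Pi iL] /andP[Pi' iL'] gg.
    have [_ _ <- _] := Hg i iL Pi; have [_ _ <- _] := Hg i' iL' Pi'.
    by rewrite gg.
  move=> j /mapP[i]; rewrite mem_filter => /andP[Pi iL] ->.
  by have [? Qj _ _] := Hg i iL Pi; rewrite mem_filter Qj.
by rewrite (perm_big _ ps3) big_cat/= leeDl// sume_ge0.
Qed.

Fixpoint bool_seqs (n : nat) : seq (seq bool) :=
  if n is n'.+1 then [seq true :: s | s <- bool_seqs n'] ++
                     [seq false :: s | s <- bool_seqs n']
  else [:: [::]].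

Lemma mem_bool_seqs n s : (s \in bool_seqs n) = (size s == n).
Proof.
elim: n s => [|n IH] s; first by case: s.
rewrite mem_cat; case: s => [|b s]; first by apply/orP => -[/mapP[]|/mapP[]].
rewrite eqSS -IH; apply/orP/idP => [[/mapP[u us [_ ->]]|/mapP[u us [_ ->]]]//|us].
by case: b; [left|right]; rewrite map_f.
Qed.

Lemma bool_seqs_uniq n : uniq (bool_seqs n).
Proof.
elim: n => //= n IH; rewrite cat_uniq !map_inj_uniq ?IH//=; last 2 first.
- by move=> ? ? [].
- by move=> ? ? [].
by rewrite andbT; apply/hasPn => s /mapP[u _ ->]; apply/mapP => -[].
Qed.

Lemma size_bool_seqs n : size (bool_seqs n) = (2 ^ n)%N.
Proof. by elim: n => //= n IH; rewrite size_cat !size_map IH expnS mul2n addnn. Qed.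

Definition short_seqs (N : nat) : seq (seq bool) :=
  flatten [seq bool_seqs n | n <- iota 0 N.+1].

Lemma mem_short_seqs N s : (s \in short_seqs N) = (size s <= N)%N.
Proof.
apply/flatten_mapP/idP => [[n]|sN]; rewrite ?mem_iota.
  by rewrite ltnS => nN; rewrite mem_bool_seqs => /eqP->.
by exists (size s); rewrite ?mem_iota ?mem_bool_seqs.
Qed.

Lemma short_seqs_uniq N : uniq (short_seqs N).
Proof.
rewrite /short_seqs; move: (iota_uniq 0 N.+1).
elim: (iota 0 N.+1) => //= n r IH /andP[nr ur].
rewrite cat_uniq bool_seqs_uniq IH// andbT; apply/hasPn => s /flatten_mapP[m mr].
rewrite !mem_bool_seqs => /eqP->; apply: contra nr => /eqP<-; exact: mr.
Qed.

Lemma geom_sum_le (R : realType) (x : R) n0 M : 0 <= x <= 2^-1 ->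
  \sum_(n0 <= n < M) x ^+ n <= 2 * x ^+ n0.
Proof.
move=> /andP[x0 x1]; have [Mn|nM] := leqP M n0.
  by rewrite big_geq// mulr_ge0// exprn_ge0.
suff : \sum_(n0 <= n < M) x ^+ n <= 2 * x ^+ n0 - 2 * x ^+ M.
  by move=> /le_trans; apply; rewrite gerBl mulr_ge0// exprn_ge0.
rewrite -(subnKC (ltnW nM)); elim: (M - n0)%N => [|m IH].
  by rewrite addn0 big_geq// subrr.
rewrite addnS big_nat_recr ?leq_addr//= exprS.
have : 0 <= x ^+ (n0 + m) by rewrite exprn_ge0.
nra.
Qed.

(** There are [2 ^ n] paths of length [n], and [4 <= k] makes the ratio [2 / k] at most one half. *)
Lemma sum_short_seqs (R : realType) (k : R) n0 N : 4 <= k ->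
  \sum_(b <- short_seqs N | (n0 <= size b)%N) k^-1 ^+ size b <= 2 * (2 / k) ^+ n0.
Proof.
move=> k4; have k0 : 0 < k by lra.
rewrite /short_seqs big_flatten big_map.
apply: (@le_trans _ _ (\sum_(n0 <= n < N.+1) (2 / k) ^+ n)); last first.
  apply: geom_sum_le; rewrite divr_ge0 ?(ltW k0)//= ler_pdivrMr//; lra.
rewrite -[iota 0 N.+1]/(index_iota 0 N.+1).
have [h|h] := leqP N.+1 n0.
  rewrite [leRHS]big_geq// big_nat big1// => n /andP[_ nN].
  rewrite big_seq_cond big_pred0// => b; rewrite mem_bool_seqs.
  by apply/andP => -[/eqP-> n0n]; lia.
rewrite (big_cat_nat (n := n0))//= ?(ltnW h)// big_nat big1 ?add0r => [|n /andP[_ nN]]; last first.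
  rewrite big_seq_cond big_pred0// => b; rewrite mem_bool_seqs.
  by apply/andP => -[/eqP-> n0n]; lia.
apply: ler_sum => n _; rewrite big_seq_cond.
rewrite (eq_big (fun b => (b \in bool_seqs n) && (n0 <= size b)%N) (fun b => k^-1 ^+ n)) => [|//|b]; last first.
  by rewrite mem_bool_seqs => /andP[/eqP->].
apply: (@le_trans _ _ (\sum_(b <- bool_seqs n) k^-1 ^+ n)).
  rewrite -big_seq_cond [leRHS](bigID (fun b => n0 <= size b)%N)/=.
  by rewrite lerDl sumr_ge0// => b _; rewrite exprn_ge0// invr_ge0 ltW.
rewrite big_const_seq count_predT size_bool_seqs iter_addr addr0 exprMn.
by rewrite -[leLHS]mulr_natl natrX.
Qed.

Lemma sume_const_seq (R : realType) (I : Type) (r : seq I) (x : \bar R) : (0 <= x)%E ->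
  \sum_(i <- r) x = ((size r)%:R%:E * x)%E.
Proof.
move=> x0; elim: r => [|i r IH]; first by rewrite big_nil mul0e.
by rewrite /= big_cons IH -natr1 EFinD ge0_muleDl// mul1e addeC.
Qed.

Section path_sums.
Context (R : realType) (excl : pred int) (Z N : nat) (k : R).
Implicit Types (c : int -> R) (t : R) (s b : seq bool).
Hypotheses (Z0 : (0 < Z)%N) (k4 : 4 <= k).
Local Notation h0 := (@heaviside R).

Definition wt c s t : \bar R := holds [seq c v | v <- trail 0 s] h0 t.

(** In the applications [c] is the potential, or its reflection, minus its value at [Z]. The
    condition on [v] holds for every site that a path of length at most [N] from 0 to [Z] can
    meet. *)
Definition deep c := c Z = 0 /\
  forall v : int, `|v| + `|Z%:Z - v| <= N%:Z -> v != Z -> c v <= - k.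

Definition total c t : \bar R := (\sum_(s <- short_seqs N | endp 0 s == Z) wt c s t)%E.

Let k0 : 0 < k. Proof. by apply: lt_le_trans k4. Qed.

Lemma wt_nnm c s : nnm (wt c s).
Proof. by apply: holds_nnm; exact: nnm_heaviside. Qed.

Lemma wt_ge0 c s t : (0 <= wt c s t)%E.
Proof. by have [_] := wt_nnm c s. Qed.

Lemma total_ge0 c t : (0 <= total c t)%E.
Proof. by apply: sume_ge0 => s _; exact: wt_ge0. Qed.

Lemma wt_insert c p b q t :
  wt c (p ++ b ++ q) t = holds [seq c v | v <- trail (endp 0 p) b]
    (holds ([seq c v | v <- trail 0 p] ++
            [seq c v | v <- trail (endp (endp 0 p) b) q]) h0) t.
Proof.
rewrite /wt !trail_cat !map_cat -holds_cat.
have nh := nnm_heaviside R.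
by rewrite (perm_holds nh (permEl (perm_catCA _ _ _))).
Qed.

Lemma deep_trail c p b q : deep c -> (size (p ++ b ++ q) <= N)%N ->
  endp 0 (p ++ b ++ q) = Z -> Z%:Z \notin trail (endp 0 p) b ->
  all (fun v => c v <= - k) (trail (endp 0 p) b).
Proof.
move=> [_ dc] sN eZ nZ; apply/allP => v vb; apply: dc; last first.
  by apply: contraNneq nZ => <-.
have : v \in trail 0 (p ++ b ++ q) by rewrite !trail_cat !mem_cat vb orbT.
by move=> /trail_dist; rewrite eZ; lia.
Qed.

Lemma wt_insert_loop c p b q t : endp (endp 0 p) b = endp 0 p ->
  all (fun v => c v <= - k) (trail (endp 0 p) b) ->
  (wt c (p ++ b ++ q) t <= (k^-1 ^+ size b)%:E * wt c (p ++ q) t)%E.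
Proof.
move=> eb ab; rewrite wt_insert eb.
have nh := nnm_heaviside R; have dh := @ndf_heaviside R.
have -> : size b = size [seq c v | v <- trail (endp 0 p) b].
  by rewrite size_map size_trail.
rewrite /wt trail_cat map_cat; apply: holds_le_inv => //.
- by rewrite all_map.
- exact: holds_nnm.
- exact: holds_ndf.
Qed.

Lemma wt_insert_excursion c p e b q t : 0 <= t -> c Z = 0 ->
  endp 0 p = Z -> endp Z (e :: b) = Z ->
  all (fun v => c v <= - k) (trail (Z%:Z + step_of e) b) ->
  (wt c (p ++ (e :: b) ++ q) t <= (t * k^-1 ^+ size b)%:E * wt c (p ++ q) t)%E.
Proof.
move=> t0 cZ pZ eb ab; rewrite wt_insert pZ eb /= cZ.
have nh := nnm_heaviside R; have dh := @ndf_heaviside R.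
set f := holds (_ ++ _) h0.
have nf : nnm f by exact: holds_nnm.
have df : ndf f by exact: holds_ndf.
apply: (@le_trans _ _ (t%:E * holds [seq c v | v <- trail (Z%:Z + step_of e) b] f t)%E).
  apply: holdT0_le => //; [exact: holds_nnm|exact: holds_ndf|].
  by move=> x x0; rewrite /f -holds_cat holds_neg.
rewrite EFinM -muleA; apply: lee_wpmul2l => //.
have -> : size b = size [seq c v | v <- trail (Z%:Z + step_of e) b].
  by rewrite size_map size_trail.
have -> : wt c (p ++ q) t = f t by rewrite /wt trail_cat map_cat pZ.
by apply: holds_le_inv => //; rewrite all_map.
Qed.

(** A loop made of deep vertices contributes at most [k^-1] per step. Loops have length at least 2
    by parity, and the sum over them is at most [2 (2 / k) ^ 2]. The map [phi] puts a loop back at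
    the first visit to [y]. *)
Lemma sum_early_loop c t y : deep c ->
  (\sum_(s <- short_seqs N | (endp 0 s == Z) && `[< early_loop Z y s >]) wt c s t <=
   (8 / k ^+ 2)%:E * total c t)%E.
Proof.
move=> dc.
pose phi (x : seq bool * seq bool) := let i := index y (trail 0 x.2) in
  take i x.2 ++ x.1 ++ drop i x.2.
pose Q (x : seq bool * seq bool) := let i := index y (trail 0 x.2) in
  [&& (2 <= size x.1)%N, endp 0 x.2 == Z, endp 0 (take i x.2) == y,
      endp y x.1 == y & all (fun v => c v <= - k) (trail y x.1)].
pose M := [seq (b, s) | b <- short_seqs N, s <- short_seqs N].
apply: (@le_trans _ _ (\sum_(x <- M | Q x) wt c (phi x) t)%E).
apply: (lee_sum_inj (phi := phi) ([::], [::]) (short_seqs_uniq N)).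
- by move=> x; exact: wt_ge0.
- move=> s; rewrite mem_short_seqs => sN /andP[/eqP eZ /asboolP].
  move=> [p [b [q [es py yp [yb bn Zb]]]]].
  have yZ : y != Z.
    by apply: contraNneq Zb => <-; case: b bn {es yb} => //= *; rewrite mem_head.
  have qn : q != [::].
    apply: contra_neq yZ => q0; move: eZ.
    by rewrite es q0 cats0 endp_cat py yb.
  have ip : index y (trail 0 (p ++ q)) = size p.
    rewrite trail_cat index_cat (negbTE yp) py size_trail.
    by case: q qn {es} => //= e q _; rewrite eqxx addn0.
  have ss : size s = (size p + size b + size q)%N by rewrite es !size_cat addnA.
  exists (b, p ++ q); rewrite /phi /Q /= ip take_size_cat// drop_size_cat// -es; split => //.
    by apply/allpairsP; exists (b, p ++ q); rewrite !mem_short_seqs size_cat; split=> //=; lia.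
  rewrite py yb !eqxx /= (loop_size bn yb)/=; apply/andP; split.
    by apply/eqP; rewrite -eZ es !endp_cat py yb.
  by rewrite -py; apply: (deep_trail (q := q)) => //; rewrite -?es ?py.
apply: (@le_trans _ _ (\sum_(x <- M | Q x) (k^-1 ^+ size x.1)%:E * wt c x.2 t)%E).
  apply: lee_sum => -[b s] /and5P[/= b2 sZ /eqP sy /eqP yb ab].
  rewrite /phi /=; set i := index _ _ in sy *.
  rewrite -[X in (_ <= _ * wt _ X _)%E](cat_take_drop i s).
  by apply: wt_insert_loop; rewrite sy.
apply: (@le_trans _ _ (\sum_(x <- M | (2 <= size x.1)%N && (endp 0 x.2 == Z))
   (k^-1 ^+ size x.1)%:E * wt c x.2 t)%E).
  rewrite big_mkcond [leRHS]big_mkcond; apply: lee_sum => x _.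
  case: ifP => [/and5P[/= -> -> _ _ _]//|_]; case: ifP => // _.
  by rewrite mule_ge0 ?wt_ge0// lee_fin exprn_ge0// invr_ge0 ltW.
rewrite /M big_mkcond big_allpairs /=.
apply: (@le_trans _ _ (\sum_(b <- short_seqs N | (2 <= size b)%N)
    (k^-1 ^+ size b)%:E * total c t)%E).
  rewrite [leRHS]big_mkcond; apply: lee_sum => b _ /=; case: ifP => b2 /=; last by rewrite big1.
  rewrite /total ge0_sume_distrr; last by move=> *; exact: wt_ge0.
  by rewrite [leRHS]big_mkcond; apply: lee_sum => s _.
rewrite -ge0_sume_distrl; last first.
  by move=> *; rewrite lee_fin exprn_ge0// invr_ge0 ltW.
rewrite lee_wpmul2r ?total_ge0// sumEFin lee_fin.
apply: (le_trans (sum_short_seqs 2 N k4)).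
by rewrite expr_div_n; lra.
Qed.

(** As for loops, except that the first vertex is [Z], whose factor is [t] instead of [k^-1] (hence
    [t * k]), and that the place of insertion is summed over [N + 1] indices. *)
Lemma sum_long_excursion c t (K : nat) : 0 <= t -> deep c ->
  (\sum_(s <- short_seqs N | (endp 0 s == Z) && `[< long_excursion Z K s >]) wt c s t <=
   (N.+1%:R * (t * k * (2 * (2 / k) ^+ (2 * K))))%:E * total c t)%E.
Proof.
move=> t0 dc.
pose phi (x : nat * (seq bool * seq bool)) :=
  take x.1 x.2.2 ++ x.2.1 ++ drop x.1 x.2.2.
pose Q (x : nat * (seq bool * seq bool)) :=
  [&& (2 * K <= size x.2.1)%N, endp 0 x.2.2 == Z, endp 0 (take x.1 x.2.2) == Z,
      endp Z x.2.1 == Z & (x.2.1 != [::]) && all (fun v => c v <= - k) (behead (trail Z x.2.1))].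
pose M0 := [seq (b, s) | b <- short_seqs N, s <- short_seqs N].
pose M := [seq (i, x) | i <- iota 0 N.+1, x <- M0].
apply: (@le_trans _ _ (\sum_(x <- M | Q x) wt c (phi x) t)%E).
apply: (lee_sum_inj (phi := phi) (0%N, ([::], [::])) (short_seqs_uniq N)).
- by move=> x; exact: wt_ge0.
- move=> s; rewrite mem_short_seqs => sN /andP[/eqP eZ /asboolP].
  move=> [p [e [b [q [es pZ bZ Zb Kb]]]]].
  have ss : size s = (size p + (size b).+1 + size q)%N by rewrite es !size_cat addnA.
  exists (size p, (e :: b, p ++ q)); rewrite /phi /Q /= take_size_cat// drop_size_cat// -[e :: b ++ q]/((e :: b) ++ q) -es; split => //.
    apply/allpairsP; exists (size p, (e :: b, p ++ q)); split => //=.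
      by rewrite -[0%N :: _]/(iota 0 N.+1) mem_iota; lia.
    by apply/allpairsP; exists (e :: b, p ++ q); rewrite !mem_short_seqs size_cat; split=> //=; lia.
  rewrite pZ -[endp (_ + _) b]/(endp Z (e :: b)) bZ !eqxx /= Kb /=; apply/andP; split.
    by apply/eqP; rewrite -eZ es !endp_cat pZ bZ.
  have e1 : endp 0 (p ++ [:: e]) = Z%:Z + step_of e by rewrite endp_cat pZ.
  rewrite -e1; apply: (deep_trail (q := q)) => //; rewrite ?e1// -catA /=; rewrite -?es//.
apply: (@le_trans _ _ (\sum_(x <- M | Q x) (t * k * k^-1 ^+ size x.2.1)%:E * wt c x.2.2 t)%E).
  apply: lee_sum => -[i [b s]] /and5P[/= b2 sZ /eqP sy /eqP yb /andP[bn ab]].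
  rewrite /phi /=.
  rewrite -[X in (_ <= _ * wt _ X _)%E](cat_take_drop i s).
  case: b bn b2 yb ab => // e b _ b2 yb ab.
  have -> : t * k * k^-1 ^+ size (e :: b) = t * k^-1 ^+ size b.
    by rewrite /= exprS mulrA mulfK// gt_eqF.
  by apply: wt_insert_excursion => //; case: dc.
apply: (@le_trans _ _ (\sum_(x <- M | (2 * K <= size x.2.1)%N && (endp 0 x.2.2 == Z))
   (t * k * k^-1 ^+ size x.2.1)%:E * wt c x.2.2 t)%E).
  rewrite big_mkcond [leRHS]big_mkcond; apply: lee_sum => x _.
  case: ifP => [/and5P[/= -> -> _ _ _]//|_]; case: ifP => // _.
  by rewrite mule_ge0 ?wt_ge0// lee_fin !mulr_ge0 ?exprn_ge0 ?invr_ge0// ltW.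
rewrite /M big_mkcond big_allpairs; under eq_bigr do rewrite big_allpairs /=.
rewrite sume_const_seq ?size_iota; last first.
  apply: sume_ge0 => b _; apply: sume_ge0 => s _; case: ifP => // _.
  by rewrite mule_ge0 ?wt_ge0// lee_fin !mulr_ge0 ?exprn_ge0 ?invr_ge0// ltW.
rewrite EFinM -muleA; apply: lee_wpmul2l => //.
apply: (@le_trans _ _ (\sum_(b <- short_seqs N | (2 * K <= size b)%N)
    (t * k * k^-1 ^+ size b)%:E * total c t)%E).
  rewrite [leRHS]big_mkcond; apply: lee_sum => b _ /=; case: ifP => b2 /=; last by rewrite big1.
  rewrite /total ge0_sume_distrr; last by move=> *; exact: wt_ge0.
  by rewrite [leRHS]big_mkcond; apply: lee_sum => s _.
rewrite -ge0_sume_distrl; last first.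
  by move=> *; rewrite lee_fin !mulr_ge0 ?exprn_ge0 ?invr_ge0// ltW.
rewrite lee_wpmul2r ?total_ge0// sumEFin lee_fin -mulr_sumr.
by rewrite ler_wpM2l ?mulr_ge0 ?(ltW k0)// sum_short_seqs.
Qed.

End path_sums.

Lemma prod_const_seq (R : realType) (I : Type) (r : seq I) (x : R) :
  \prod_(i <- r) x = x ^+ size r.
Proof. by elim: r => [|i r IH]; rewrite ?big_nil// big_cons IH exprS. Qed.

(** * Factorisation of the good paths over the exclusive sites *)

Section good_paths.
Context (R : realType) (excl : pred int) (Z N K : nat) (k : R).
Implicit Types (c : int -> R) (t x : R) (s b : seq bool).
Hypotheses (Z0 : (0 < Z)%N) (k4 : 4 <= k) (e0 : ~~ excl 0).
Hypothesis eK : forall v, excl v -> K%:Z < `|v - Z%:Z|.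
Hypothesis ZN : (Z <= N)%N.
Local Notation h0 := (@heaviside R).
Local Notation Elist := (excl_list excl Z).
Local Notation deep := (deep Z N k).
Local Notation total := (total Z N).

Let k0 : 0 < k. Proof. exact: lt_le_trans k4. Qed.

Definition rest c s : seq R := [seq c v | v <- trail 0 s & ~~ excl v].

Definition rest_wt c s t : \bar R := holds (rest c s) h0 t.

Definition rest_sum c t : \bar R :=
  (\sum_(s <- short_seqs N | good excl Z s) rest_wt c s t)%E.

Definition good_sum c t : \bar R :=
  (\sum_(s <- short_seqs N | good excl Z s) wt c s t)%E.

Lemma rest_wt_nnm c s : nnm (rest_wt c s).
Proof. by apply: holds_nnm; exact: nnm_heaviside. Qed.

Lemma rest_wt_ge0 c s t : (0 <= rest_wt c s t)%E.
Proof. by have [_] := rest_wt_nnm c s. Qed.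

Lemma rest_sum_nnm c : nnm (rest_sum c).
Proof.
rewrite /rest_sum; under [X in nnm X]funext do rewrite -big_filter.
by apply: nnm_sum => s; exact: rest_wt_nnm.
Qed.

Lemma rest_sum_ndf c : ndf (rest_sum c).
Proof.
move=> x y xy; apply: lee_sum => s _.
by apply: holds_ndf => //; [exact: nnm_heaviside|exact: ndf_heaviside].
Qed.

(** All good paths carry the same exclusive factors, and these commute with the others; they come
    out as one operator applied to the sum of the remainders. *)
Lemma good_sumE c t : good_sum c t = holds [seq c v | v <- Elist] (rest_sum c) t.
Proof.
have -> : rest_sum c = fun x =>
    (\sum_(s <- [seq s <- short_seqs N | good excl Z s]) rest_wt c s x)%E.
  by apply/funext => x; rewrite big_filter.
rewrite holds_sum; last by move=> s; exact: rest_wt_nnm.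
rewrite big_filter; apply: eq_bigr => s /andP[_ pe].
rewrite /wt /rest_wt -holds_cat; have nh := nnm_heaviside R.
rewrite (perm_holds nh (l2 := [seq c v | v <- Elist] ++ rest c s))//.
rewrite /rest -map_cat perm_map// perm_sym.
by apply: perm_trans (permEl (perm_filterC excl _)); rewrite perm_cat2r perm_sym.
Qed.

Lemma trail_deep c s v : deep c -> (size s <= N)%N -> endp 0 s = Z ->
  v \in trail 0 s -> v != Z -> c v <= - k.
Proof.
move=> [_ dc] sN sZ vs vZ; apply: dc => //.
by have := trail_dist vs; rewrite sZ; lia.
Qed.

Lemma trail_deep0 c s v : deep c -> (size s <= N)%N -> endp 0 s = Z ->
  v \in trail 0 s -> c v <= 0.
Proof.
move=> dc sN sZ vs; have [->|vZ] := eqVneq v Z; first by case: dc => ->.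
by apply: (le_trans (trail_deep dc sN sZ vs vZ)); rewrite oppr_le0 ltW.
Qed.

Lemma excl_deep c v : deep c -> v \in Elist -> c v <= - k.
Proof.
move=> [_ dc]; rewrite mem_excl_list => /and3P[ev v0 vZ].
by apply: dc; [lia|rewrite lt_eqF].
Qed.

Definition tiny t : R := 2 * (2 ^+ N * expR (- (k * t / 4))).

(** Paths that meet [Z] only at the end have stabilised in time up to [tiny t]. From the others the
    last excursion [b] is deleted, which leaves a good path; summing [x * k * k^-1 ^+ size b] over
    lengths at least 2 gives [8 x / k]. *)
Lemma rest_sum_growth c t x : deep c -> 0 <= x -> x <= t / 2 ->
  2 ^+ N * expR (- (k * t / 4)) <= 2^-1 ->
  (rest_sum c t <= rest_sum c (t - x) + (tiny t + x * (8 / k))%:E * rest_sum c t)%E.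
Proof.
move=> dc x0 xt He; have t0 : 0 <= t by lra.
have tin0 : 0 <= tiny t by rewrite /tiny !mulr_ge0// ?exprn_ge0// expR_ge0.
pose Q (j : seq bool * seq bool) := [&& good excl Z j.1 & (2 <= size j.2)%N].
pose M := [seq (p, b) | p <- short_seqs N, b <- short_seqs N].
pose T (j : seq bool * seq bool) := ((x * k * k^-1 ^+ size j.2)%:E * rest_wt c j.1 t)%E.
have T0 j : (0 <= T j)%E.
  by rewrite mule_ge0 ?rest_wt_ge0// lee_fin !mulr_ge0 ?exprn_ge0 ?invr_ge0// ltW.
(* Each path gets its error term together with the pair (good prefix, last excursion) that bounds
   it, so that the errors can be summed over pairs. *)
have [E HE] : exists E : seq bool -> \bar R, forall s,
    (s \in short_seqs N -> good excl Z s && (Z%:Z \in trail 0 s) ->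
      (rest_wt c s t <= rest_wt c s (t - x) + E s)%E /\
      exists j, [/\ j \in M, Q j, j.1 ++ j.2 = s & (E s <= T j)%E]).
  suff /choice[E HE] : forall s, exists e : \bar R, s \in short_seqs N ->
      good excl Z s && (Z%:Z \in trail 0 s) ->
      (rest_wt c s t <= rest_wt c s (t - x) + e)%E /\
      exists j, [/\ j \in M, Q j, j.1 ++ j.2 = s & (e <= T j)%E] by exists E.
  move=> s; case: (boolP (s \in _)) => [|ns]; last by exists 0%E.
  rewrite mem_short_seqs => sN.
  case: (boolP (_ && _)) => [/andP[gs Zs]|ng]; last by exists 0%E.
  have [p [b [q [es pZ nq]]]] := last_visit Zs.
  have gs' := gs; rewrite es in gs'.
  have [gp /allP nE] := good_last_excursion gs' pZ.
  have sZ : endp 0 s = Z by case/andP: gs => /eqP.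
  have bqZ : endp Z (b :: q) = Z by have := sZ; rewrite es endp_cat pZ.
  have ss : size s = (size p + (size q).+1)%N by rewrite es size_cat.
  exists (T (p, b :: q)) => _ _; split; last first.
    exists (p, b :: q); split => //; last by rewrite /Q gp /= (loop_size (s := b :: q) _ bqZ).
    have [pN qN] : (size p <= N)%N /\ ((size q).+1 <= N)%N by
      split; apply: leq_trans sN; rewrite ss ?leq_addr ?leq_addl.
    by apply/allpairsP; exists (p, b :: q); rewrite !mem_short_seqs.
  have rE : rest c s = rest c p ++ 0 :: [seq c v | v <- trail (Z%:Z + step_of b) q].
    rewrite /rest es trail_cat filter_cat map_cat pZ; congr (_ ++ _).
    have -> : [seq v <- trail Z (b :: q) | ~~ excl v] = trail Z (b :: q).
      by apply/all_filterP/allP => v /nE.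
    by rewrite /=; case: dc => ->.
  rewrite /rest_wt rE.
  have -> : (T (p, b :: q) = (x * k^-1 ^+ size [seq c v | v <- trail (Z%:Z + step_of b) q])%:E
      * rest_wt c p t)%E.
    by rewrite /T /= size_map size_trail exprS mulrA mulfK// gt_eqF.
  apply: holds_zero_growth => //; rewrite all_map; apply/allP => v vq /=.
  apply: (trail_deep dc sN sZ); first by rewrite es trail_cat pZ mem_cat inE vq !orbT.
  by apply: contraNneq nq => vZ; move: vq; rewrite vZ.
pose A1 := (\sum_(s <- short_seqs N | good excl Z s && (Z%:Z \in trail 0 s))
  rest_wt c s (t - x))%E.
pose A2 := (\sum_(s <- short_seqs N | good excl Z s && (Z%:Z \notin trail 0 s))
  rest_wt c s (t - x))%E.
have A1_ge0 : (0 <= A1)%E by apply: sume_ge0 => *; exact: rest_wt_ge0.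
have A2_ge0 : (0 <= A2)%E by apply: sume_ge0 => *; exact: rest_wt_ge0.
have -> : rest_sum c (t - x) = (A1 + A2)%E.
  by rewrite /rest_sum (bigID (fun s => Z%:Z \in trail 0 s)).
rewrite EFinD ge0_muleDl ?lee_fin//; last by rewrite mulr_ge0// divr_ge0// ltW.
rewrite {1}/rest_sum (bigID (fun s => Z%:Z \in trail 0 s))/=.
have G0 : (0 <= rest_sum c t)%E by have [_] := rest_sum_nnm c.
have S1 : (\sum_(s <- short_seqs N | good excl Z s && (Z%:Z \in trail 0 s)) rest_wt c s t
   <= A1 + (x * (8 / k))%:E * rest_sum c t)%E.
  apply: (@le_trans _ _ (A1 + \sum_(j <- M | Q j) T j)%E).
    rewrite big_seq_cond /A1 [X in (_ <= X + _)%E]big_seq_cond.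
    apply: (@le_trans _ _ (\sum_(s <- short_seqs N | (s \in short_seqs N) &&
       (good excl Z s && (Z%:Z \in trail 0 s))) (rest_wt c s (t - x) + E s))%E).
      by apply: lee_sum => s /andP[sN gs]; have [] := HE s sN gs.
    rewrite big_split/= leeD2l// -big_seq_cond.
    apply: (lee_sum_inj (phi := fun j => j.1 ++ j.2) ([::], [::]) (short_seqs_uniq N)) => //.
    by move=> s sN gs; have [_] := HE s sN gs.
  rewrite leeD2l// /M big_mkcond big_allpairs /rest_sum ge0_sume_distrr; last first.
    by move=> *; exact: rest_wt_ge0.
  rewrite [leRHS]big_mkcond; apply: lee_sum => p _; rewrite /Q /=.
  case: ifP => gp; last by rewrite big1.
  rewrite -big_mkcond /= -ge0_sume_distrl; last first.
    by move=> b _; rewrite lee_fin !mulr_ge0 ?exprn_ge0 ?invr_ge0// ltW.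
  rewrite lee_wpmul2r ?rest_wt_ge0// sumEFin lee_fin -mulr_sumr.
  apply: (@le_trans _ _ (x * k * (2 * (2 / k) ^+ 2))).
    by rewrite ler_wpM2l ?sum_short_seqs// mulr_ge0// ltW.
  rewrite le_eqVlt; apply/orP; left; apply/eqP; field.
  by rewrite gt_eqF.
have S2 : (\sum_(s <- short_seqs N | good excl Z s && (Z%:Z \notin trail 0 s)) rest_wt c s t
   <= A2 + (tiny t)%:E * rest_sum c t)%E.
  apply: (@le_trans _ _ (A2 + (tiny t)%:E * \sum_(s <- short_seqs N |
     good excl Z s && (Z%:Z \notin trail 0 s)) rest_wt c s t)%E); last first.
    rewrite leeD2l// lee_wpmul2l// /rest_sum big_mkcond [leRHS]big_mkcond.
    apply: lee_sum => s _; case: good => //=; case: ifP => // _.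
    exact: rest_wt_ge0.
  rewrite ge0_sume_distrr; last by move=> *; exact: rest_wt_ge0.
  rewrite /A2 -big_split/= big_seq_cond [leRHS]big_seq_cond.
  apply: lee_sum => s; rewrite mem_short_seqs => /and3P[sN gs nZ].
  have sZ : endp 0 s = Z by case/andP: gs => /eqP.
  have sr : (size (rest c s) <= N)%N.
    by rewrite size_map (leq_trans _ sN)// size_filter -(size_trail 0 s) count_size.
  have tr : 2 ^+ size (rest c s) * expR (- (k * t / 4)) <= 2 ^+ N * expR (- (k * t / 4)).
    by rewrite ler_wpM2r ?expR_ge0// ler_weXn2l// ler1n.
  apply: (@le_trans _ _ (rest_wt c s (t - x) +
     (2 * (2 ^+ size (rest c s) * expR (- (k * t / 4))))%:E * rest_wt c s t)%E).
    apply: holds_no_zero_growth => //; last exact: le_trans He.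
    rewrite all_map; apply/allP => v; rewrite mem_filter => /andP[_ vs] /=.
    by apply: (trail_deep dc sN sZ vs); apply: contraNneq nZ => <-.
  rewrite leeD2l// lee_wpmul2r ?rest_wt_ge0// lee_fin /tiny.
  by rewrite ler_wpM2l.
apply: (le_trans (leeD S1 S2)).
by rewrite addeACA [X in (_ + X <= _)%E]addeC.
Qed.

(** The form without subtraction that [holds_extract_ge] takes as hypothesis. For [t - tau <= t / 2]
    it follows from [1 + y <= exp y]; beyond that, the additional rate [2 / t] alone makes the
    exponential at least 2. *)
Lemma rest_sum_growth_exp c t : deep c -> 0 < t ->
  2 ^+ N * expR (- (k * t / 4)) <= 2^-1 -> forall tau, tau <= t ->
  ((2 - tiny t)%:E * rest_sum c t <=
   rest_sum c tau + rest_sum c t * (expR ((8 / k + 2 / t) * (t - tau)))%:E)%E.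
Proof.
move=> dc t0 He tau tt.
have tin0 : 0 <= tiny t by rewrite /tiny !mulr_ge0// ?exprn_ge0// expR_ge0.
have tin1 : tiny t <= 1 by rewrite /tiny; lra.
have [_ G0] := rest_sum_nnm c.
set x := t - tau; have x0 : 0 <= x by rewrite subr_ge0.
have taux : tau = t - x by rewrite /x; lra.
have k1 : 0 <= 8 / k by rewrite divr_ge0// ltW.
have t1 : 0 <= 2 / t by rewrite divr_ge0// ltW.
have [xt|xt] := leP x (t / 2); last first.
  apply: (@le_trans _ _ (2%:E * rest_sum c t)%E).
    by rewrite lee_wpmul2r// lee_fin; lra.
  rewrite muleC -[leLHS]add0e; apply: leeD => //.
  rewrite lee_wpmul2l// lee_fin; apply: le_trans (expR_ge1Dx _).
  have : 1 <= 2 / t * x.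
    by rewrite mulrAC ler_pdivlMr//; lra.
  have : 0 <= 8 / k * x by rewrite mulr_ge0.
  by rewrite mulrDl; lra.
have := rest_sum_growth dc x0 xt He; rewrite -taux => H.
apply: (@le_trans _ _ ((1 - tiny t)%:E * rest_sum c t + rest_sum c t)%E).
  rewrite -[X in (_ + X)%E]mul1e -ge0_muleDl ?lee_fin ?subr_ge0// -EFinD.
  by rewrite lee_wpmul2r// lee_fin; lra.
have [fG|] := boolP (rest_sum c t \is a fin_num); last first.
  rewrite ge0_fin_numE// -leNgt leye_eq => /eqP ->.
  rewrite gt0_mulye ?lte_fin ?expR_gt0//; apply: (@le_trans _ _ +oo%E).
    exact: leey.
  by case: (rest_sum c tau) (G0 tau).
move: H fG (G0 t) (G0 tau).
case: (rest_sum c t) => // g; case: (rest_sum c tau) => // [h|]; last first.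
  by rewrite !leey.
rewrite !lee_fin => H _ g0 h0.
have := expR_ge1Dx ((8 / k + 2 / t) * x).
have : 0 <= 2 / t * x * g by rewrite mulr_ge0// mulr_ge0.
move=> h1 h2.
have : (1 + (8 / k + 2 / t) * x) * g <= expR ((8 / k + 2 / t) * x) * g.
  by rewrite ler_wpM2r.
rewrite [g * expR _]mulrC; nra.
Qed.


Definition bad_rate t : R :=
  (size Elist).+1%:R * (8 / k ^+ 2) + N.+1%:R * (t * k * (2 * (2 / k) ^+ (2 * K))).

(** Deleting a loop or an excursion need not leave a good path, so the error is a multiple of
    [total] itself. It is absorbed on the left once [total] is known to be finite and [bad_rate] to
    be small. *)
Lemma total_le_good c t : 0 <= t -> deep c ->
  (total c t <= good_sum c t + (bad_rate t)%:E * total c t)%E.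
Proof.
move=> t0 dc; have T0 : (0 <= total c t)%E by exact: total_ge0.
have wt0 s : (0 <= wt c s t)%E by exact: wt_ge0.
rewrite {1}/total (bigID (good excl Z))/=; apply: leeD.
  rewrite /good_sum big_mkcond [leRHS]big_mkcond; apply: lee_sum => s _ /=.
  by rewrite /good; case: (_ == _) => //=; case: ifP.
pose B1 : \bar R := \sum_(y <- 0 :: Elist) \sum_(s <- short_seqs N |
    (endp 0 s == Z) && `[< early_loop Z y s >]) wt c s t.
pose B2 : \bar R := \sum_(s <- short_seqs N |
    (endp 0 s == Z) && `[< long_excursion Z K s >]) wt c s t.
apply: (@le_trans _ _ (B1 + B2)%E).
  rewrite /B1 /B2.
  under [X in (_ <= X + _)%E]eq_bigr do rewrite big_mkcond.
  rewrite exchange_big/= [X in (_ <= _ + X)%E]big_mkcond -big_split/= big_mkcond.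
  apply: lee_sum => s _; have [/eqP eZ|nZ] /= := boolP (endp 0 s == Z); last first.
    by rewrite adde_ge0// sume_ge0.
  have S0 (r : seq int) : (0 <= \sum_(y <- r) (if `[< early_loop Z y s >] then wt c s t else 0))%E.
    by apply: sume_ge0 => y _; case: ifP.
  have L0 : (0 <= if `[< long_excursion Z K s >] then wt c s t else 0)%E by case: ifP.
  case: ifP => [ng|_]; last by rewrite adde_ge0.
  have [[y yE /asboolP ye]|/asboolP->] := bad_path e0 Z0 eK eZ ng; last first.
    by rewrite -[leLHS]add0e; exact: leeD.
  rewrite (big_rem y yE)/= ye -addeA -[leLHS]adde0; apply: leeD => //.
  exact: adde_ge0.
rewrite /bad_rate EFinD ge0_muleDl ?lee_fin; last 2 first.
- by rewrite mulr_ge0// divr_ge0// exprn_ge0// ltW.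
- by rewrite !mulr_ge0// ?exprn_ge0 ?divr_ge0// ltW.
apply: leeD; last exact: sum_long_excursion.
rewrite EFinM -muleA -[(size Elist).+1]/(size (0 :: Elist)) -sume_const_seq; last first.
  by rewrite mule_ge0// lee_fin divr_ge0// exprn_ge0// ltW.
by apply: lee_sum => y _; exact: sum_early_loop.
Qed.

Lemma wt_fin c s t : deep c -> (size s <= N)%N -> endp 0 s = Z ->
  (wt c s t < +oo)%E.
Proof.
move=> dc sN sZ; apply: le_lt_trans (ltry _).
apply: (@holds_le_exp _ _ 1 0) => //; rewrite all_map; apply/allP => v vs /=.
exact: trail_deep0 dc sN sZ vs.
Qed.

Lemma rest_sum_fin c t : deep c -> rest_sum c t \is a fin_num.
Proof.
move=> dc; rewrite ge0_fin_numE; last by have [_] := rest_sum_nnm c.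
rewrite /rest_sum big_seq_cond; apply: lte_sum_pinfty => s.
rewrite mem_short_seqs => /andP[sN /andP[/eqP sZ _]].
apply: le_lt_trans (ltry _); apply: (@holds_le_exp _ _ 1 0) => //.
rewrite all_map; apply/allP => v; rewrite mem_filter => /andP[_ vs] /=.
exact: trail_deep0 dc sN sZ vs.
Qed.

Lemma total_fin c t : deep c -> total c t \is a fin_num.
Proof.
move=> dc; rewrite ge0_fin_numE; last exact: total_ge0.
rewrite /total big_seq_cond; apply: lte_sum_pinfty => s.
by rewrite mem_short_seqs => /andP[sN /eqP sZ]; exact: wt_fin.
Qed.

Lemma wt_direct_le c t : (wt c (nseq Z true) t <= good_sum c t)%E.
Proof.
have dS : nseq Z true \in short_seqs N by rewrite mem_short_seqs size_nseq.
rewrite /good_sum (big_rem _ dS)/= good_direct leeDl// sume_ge0// => s _.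
exact: wt_ge0.
Qed.

Lemma good_le_total c t : (good_sum c t <= total c t)%E.
Proof.
rewrite /good_sum /total big_mkcond [leRHS]big_mkcond; apply: lee_sum => s _ /=.
by rewrite /good; case: (_ == _) => //=; case: ifP => // _; exact: wt_ge0.
Qed.

Definition excl_weight c : R := \prod_(v <- Elist) (- c v)^-1.

Lemma excl_weight_gt0 c : deep c -> 0 < excl_weight c.
Proof.
move=> dc; rewrite /excl_weight big_seq; apply: prodr_gt0 => v vE.
by rewrite invr_gt0 oppr_gt0 (le_lt_trans (excl_deep dc vE))// oppr_lt0.
Qed.

Lemma good_sum_upper c t : deep c ->
  (good_sum c t <= (excl_weight c)%:E * rest_sum c t)%E.
Proof.
move=> dc; rewrite good_sumE /excl_weight -(big_map c predT (fun x => (- x)^-1)).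
apply: holds_extract_le; [|exact: rest_sum_nnm|exact: rest_sum_ndf].
rewrite all_map; apply/allP => v /(excl_deep dc) /= ck.
by rewrite (le_lt_trans ck)// oppr_lt0.
Qed.

Lemma good_sum_lower c t rho : deep c -> 0 < t ->
  2 ^+ N * expR (- (k * t / 4)) <= 2^-1 -> 8 / k + 2 / t < k ->
  (1 - (8 / k + 2 / t) / k)^-1 ^+ size Elist <= 1 + rho ->
  (((1 - tiny t - rho) * excl_weight c)%:E * rest_sum c t <= good_sum c t)%E.
Proof.
move=> dc t0 He gk Hr; set g := 8 / k + 2 / t in gk Hr *.
have g0 : 0 <= g by rewrite addr_ge0// divr_ge0// ltW.
have p0 := excl_weight_gt0 dc.
have [_ G0] := rest_sum_nnm c.
have tin1 : tiny t <= 1 by rewrite /tiny; lra.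
have := @holds_extract_ge _ [seq c v | v <- Elist] (rest_sum c) g (tiny t) t _ g0 tin1
  (rest_sum_nnm c) (rest_sum_growth_exp dc t0 He).
rewrite -good_sumE !big_map -/(excl_weight c) => /(_ _)/wrap[].
  rewrite all_map; apply/allP => v /(excl_deep dc) /= ck.
  by rewrite (le_lt_trans ck)// ltrN2.
(* As [- c v >= k], each factor [(- c v - g)^-1] is at most [(1 - g / k)^-1 * (- c v)^-1]; the
   hypothesis on [rho] bounds the product of the correction factors. *)
have Hp : \prod_(v <- Elist) (- c v - g)^-1 <= (1 + rho) * excl_weight c.
  apply: (@le_trans _ _ ((1 - g / k)^-1 ^+ size Elist * excl_weight c)); last first.
    by rewrite ler_wpM2r// ltW.
  rewrite /excl_weight -prod_const_seq -big_split/=.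
  rewrite big_seq [leRHS]big_seq; apply: ler_prod => v vE.
  have cv := excl_deep dc vE; have cg : 0 < - c v - g by lra.
  have gk1 : 0 < 1 - g / k by rewrite subr_gt0 ltr_pdivrMr// mul1r.
  rewrite invr_ge0 (ltW cg)/= -invfM lef_pV2 ?posrE//; last by rewrite mulr_gt0//; lra.
  have : g * (- c v / k) >= g.
    rewrite ler_peMr// ler_pdivlMr// mul1r; lra.
  have -> : (1 - g / k) * - c v = - c v - g * (- c v / k) by ring.
  by move=> h; rewrite lerD2l lerN2.
move: (rest_sum_fin t dc) (G0 t); case: (rest_sum c t) => // G _; rewrite lee_fin => GG.
have gs0 : (0 <= good_sum c t)%E by apply: sume_ge0 => s _; exact: wt_ge0.
case: (good_sum c t) gs0 => [A|_ _|//]; last by rewrite leey.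
move=> _; rewrite !lee_fin => H.
have : G * \prod_(v <- Elist) (- c v - g)^-1 <= G * ((1 + rho) * excl_weight c).
  by rewrite ler_wpM2l.
nra.
Qed.

End good_paths.

(** * The Feynman-Kac functional as a path sum *)

Section independence.
Context d (Omega : measurableType d) (R : realType) (P : probability Omega R).
Context (I : eqType) (X : I -> Omega -> R) (j : I).
Hypothesis indX : mutually_independent P X.
Local Open Scope ereal_scope.

(* Generates the sigma-algebra of all X i with i different from j. *)
Definition cylinders_but : set (set Omega) :=
  [set B | exists (J : seq I) (A : I -> set R), [/\ uniq J, j \notin J,
    forall i, i \in J -> measurable (A i) &
    B = \big[setI/setT]_(i <- J) (X i @^-1` A i)]].

(** The set [Omega] itself with a smaller sigma-algebra: measurability of a map on it expresses that
    the map is determined by the coordinates other than [j]. *)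
Definition space_but := g_sigma_algebraType cylinders_but.

Lemma mem_big_setI (T : Type) (J : seq I) (F : I -> set T) w :
  (\big[setI/setT]_(i <- J) F i) w <-> forall i, i \in J -> F i w.
Proof.
elim: J => [|i J IH]; first by rewrite big_nil.
rewrite big_cons; split=> [[Fi /IH FJ] k|H].
  by rewrite inE => /predU1P[->|/FJ].
split; first by apply: H; rewrite mem_head.
by apply/IH => k kJ; apply: H; rewrite inE kJ orbT.
Qed.

Lemma measurable_indX i A : measurable A -> measurable (X i @^-1` A).
Proof. by move=> mA; have [mX _] := indX; rewrite -[X in measurable X]setTI; exact: mX. Qed.

Lemma measurable_big_preimage (J : seq I) (A : I -> set R) :
  (forall i, i \in J -> measurable (A i)) ->
  measurable (\big[setI/setT]_(i <- J) (X i @^-1` A i)).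
Proof.
elim: J => [|i J IH] H; first by rewrite big_nil.
rewrite big_cons; apply: measurableI.
  by apply: measurable_indX; apply: H; rewrite mem_head.
by apply: IH => k kJ; apply: H; rewrite inE kJ orbT.
Qed.

Lemma measurable_space_but (B : set Omega) :
  measurable (B : set space_but) -> measurable B.
Proof.
apply: smallest_sub; first exact: sigma_algebra_measurable.
by move=> _ [J [A [_ _ mA ->]]]; exact: measurable_big_preimage.
Qed.

Lemma measurable_fun_to_but :
  measurable_fun setT (idfun : Omega -> space_but).
Proof. by move=> _ B mB; rewrite setTI; exact: measurable_space_but. Qed.

Lemma measurable_fun_but i : i != j -> measurable_fun setT (X i : space_but -> R).
Proof.
move=> ij _ A mA; rewrite setTI; apply: sub_sigma_algebra.
exists [:: i], (fun=> A); split => //.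
- by rewrite inE eq_sym.
- by rewrite big_seq1.
Qed.

Lemma cylinders_but_setI : setI_closed cylinders_but.
Proof.
move=> _ _ [J1 [A1 [u1 n1 m1 ->]]] [J2 [A2 [u2 n2 m2 ->]]].
exists (undup (J1 ++ J2)), (fun i => (if i \in J1 then A1 i else setT) `&`
  (if i \in J2 then A2 i else setT)); split.
- exact: undup_uniq.
- by rewrite mem_undup mem_cat negb_or n1.
- move=> i _; apply: measurableI; case: ifP => //; [exact: m1|exact: m2].
- apply/seteqP; split => w.
    move=> [/mem_big_setI H1 /mem_big_setI H2]; apply/mem_big_setI => i _.
    by split; case: ifP => // iJ; [exact: H1|exact: H2].
  move/mem_big_setI => H; split; apply/mem_big_setI => i iJ.
    have /H[] : i \in undup (J1 ++ J2) by rewrite mem_undup mem_cat iJ.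
    by rewrite iJ.
  have /H[] : i \in undup (J1 ++ J2) by rewrite mem_undup mem_cat iJ orbT.
  by rewrite iJ.
Qed.

(** Both sides are finite measures in [B] and agree on the cylinders, which form a pi-system. *)
Lemma indep_but A (B : set Omega) : measurable A -> measurable (B : set space_but) ->
  P (X j @^-1` A `&` B) = P (X j @^-1` A) * P B.
Proof.
move=> mA; have mXA := measurable_indX j mA.
have c0 : (0 <= fine (P (X j @^-1` A)))%R by rewrite fine_ge0.
pose c := NngNum c0.
have mid := measurable_fun_to_but.
have mB' : measurable_fun setT (idfun : Omega -> space_but) := mid.
pose m1 : {measure set space_but -> \bar R} :=
  measure_function_pushforward__canonical__measure_function_Measure (mrestr P mXA) mid.
pose m2 : {measure set space_but -> \bar R} :=
  measure_function_pushforward__canonical__measure_function_Measure (mscale c P) mid.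
have H := @measure_unique _ _ space_but cylinders_but (fun=> setT) erefl
  cylinders_but_setI _ _ m1 m2 _ _.
move=> mB; transitivity (m1 B); first by rewrite /m1 /= /pushforward /mrestr setIC.
transitivity (m2 B); last by rewrite /m2 /= /pushforward /mscale /= fineK// fin_num_measure.
apply: H => //.
- by move=> _; exists [::], (fun=> setT); rewrite big_nil.
- by rewrite bigcup_const.
- move=> _ [J [A' [uJ nJ mJ ->]]].
  rewrite /m1 /m2 /= /pushforward /mrestr /mscale /= fineK ?fin_num_measure// setIC.
  have [_ ind] := indX.
  pose A2 i := if i == j then A else A' i.
  have mA2 i : i \in j :: J -> measurable (A2 i).
    rewrite inE /A2; case: eqVneq => //= _; exact: mJ.
  have EJ : \big[setI/setT]_(i <- J) (X i @^-1` A' i) =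
            \big[setI/setT]_(i <- J) (X i @^-1` A2 i).
    apply: eq_big_seq => i iJ; rewrite /A2; case: eqVneq => // ij.
    by rewrite -ij iJ in nJ.
  have := ind (j :: J) A2; rewrite /= nJ => /(_ uJ mA2).
  rewrite !big_cons {1 3}/A2 eqxx -EJ => ->; congr (_ * _).
  rewrite EJ (ind J A2)// => i iJ.
  by apply: mA2; rewrite inE iJ orbT.
- move=> k; apply: (@le_lt_trans _ _ 1); last exact: ltry.
  by rewrite /m1 /= /pushforward /mrestr preimage_setT setTI; exact: probability_le1.
Qed.

(** The pair formed by [X j] and the identity into [space_but] has a product law, by [indep_but] on
    rectangles; Tonelli then integrates [X j] separately from all the rest. *)
Lemma indep_integral (f : R * space_but -> \bar R) :
  measurable_fun setT f -> (forall z, 0 <= f z) ->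
  \int[P]_w f (X j w, w) = \int[P]_w' \int[P]_w f (X j w', w).
Proof.
move=> mf f0; have [mX _] := indX.
have mid := measurable_fun_to_but.
have mj : measurable_fun setT (fun w : Omega => (X j w, w) : R * space_but).
  by apply/measurable_fun_pairP; split => //; exact: mX.
pose X1 : {mfun Omega >-> R} := mfun_Sub (mem_set (mX j)).
pose X2 : {mfun Omega >-> space_but} := mfun_Sub (mem_set mid).
pose m1 : probability R R := distribution P X1.
pose m2 : probability space_but R := distribution P X2.
pose m' : {measure set (R * space_but) -> \bar R} :=
  measure_function_pushforward__canonical__measure_function_Measure P mj.
have E A : measurable A -> (m1 \x m2) A = m' A.
  move=> mA; apply: product_measure_unique => // A1 A2 mA1 mA2.
  by have := indep_but mA1 mA2.
transitivity (\int[m']_z f z).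
  by rewrite (ge0_integral_pushforward mj)// => z _; exact: f0.
transitivity (\int[m1 \x m2]_z f z).
  by apply: eq_measure_integral => A mA _; rewrite -E.
rewrite fubini_tonelli1//.
have mF : measurable_fun setT (fubini_F m2 f).
  exact: measurable_fun_fubini_tonelli_F.
rewrite (ge0_integral_pushforward (mX j))//; last first.
  by move=> x _; apply: integral_ge0.
apply: eq_integral => w _ /=; rewrite /fubini_F.
have mfw : measurable_fun setT (fun y : space_but => f (X j w, y)).
  by apply: measurableT_comp => //; apply/measurable_fun_pairP; split.
by rewrite (ge0_integral_pushforward mid P measurableT mfw).
Qed.

End independence.

Import HBNNSimple.

Section density.
Context d (T : measurableType d) (R : realType).
Context (mu nu : {measure set T -> \bar R}) (p : T -> R).
Hypothesis mp : measurable_fun setT p.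
Hypothesis p0 : forall x, 0 <= p x.
Hypothesis nuE : forall A, measurable A -> nu A = (\int[mu]_(x in A) (p x)%:E)%E.
Local Open Scope ereal_scope.

Lemma ge0_integral_density (g : T -> \bar R) : measurable_fun setT g ->
  (forall x, 0 <= g x) -> \int[nu]_x g x = \int[mu]_x ((p x)%:E * g x).
Proof.
move=> mg g0; pose f_ := nnsfun_approx measurableT mg.
have cvgf x : (f_ n x)%:E @[n --> \oo] --> g x.
  by apply: cvg_nnsfun_approx => // *; exact: g0.
have f0 n x : 0 <= (f_ n x)%:E by rewrite lee_fin.
have ndfx x : {homo (fun n => (f_ n x)%:E) : m n / (m <= n)%N >-> m <= n}.
  by move=> m n mn; rewrite lee_fin; exact/lefP/nd_nnsfun_approx.
have mfn n : measurable_fun setT (fun x => (f_ n x)%:E).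
  exact/measurable_EFinP/measurable_funP.
have mpE : measurable_fun setT (fun x => (p x)%:E) by exact/measurable_EFinP.
transitivity (limn (fun n => \int[nu]_x (f_ n x)%:E)).
  rewrite -monotone_convergence//.
  by apply: eq_integral => x _; apply/esym/cvg_lim => //; exact: cvgf.
transitivity (limn (fun n => \int[mu]_x ((p x)%:E * (f_ n x)%:E))); last first.
  rewrite -monotone_convergence//; last 3 first.
  - by move=> n; exact: emeasurable_funM.
  - by move=> n x _; rewrite mule_ge0// lee_fin.
  - by move=> x _ m n mn; apply: lee_wpmul2l; [rewrite lee_fin|exact: ndfx].
  by apply: eq_integral => x _; apply/cvg_lim => //; apply: cvgeZl.
congr (limn _); apply/funext => n.
have mfk r : measurable (f_ n @^-1` [set r]) by [].
transitivity (\sum_(k \in range (f_ n)) k%:E * nu (f_ n @^-1` [set k])).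
  by rewrite integralT_nnsfun sintegralE.
transitivity (\sum_(k \in range (f_ n))
    \int[mu]_x ((p x)%:E * (k * \1_(f_ n @^-1` [set k]) x)%:E)); last first.
  rewrite -ge0_integral_fsum//; last 2 first.
  - move=> k; apply: emeasurable_funM => //; apply/measurable_EFinP.
    exact: measurable_funM.
  - by move=> k x _; rewrite mule_ge0 ?lee_fin// -lee_fin EFinM nnfun_muleindic_ge0.
  apply: eq_integral => x _.
  rewrite -ge0_mule_fsumr; last by move=> k; rewrite EFinM nnfun_muleindic_ge0.
  by rewrite fsumEFin// -fimfunE.
apply: eq_fsbigr => k; rewrite inE => -[x _ <-].
rewrite nuE// [in LHS]integral_mkcond -ge0_integralZl//; last 2 first.
- by apply/measurable_restrict => //; exact: measurable_funTS.
- by move=> y _; rewrite erestrict_ge0// => z _; rewrite lee_fin.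
apply: eq_integral => y _; rewrite patchE indicE.
by case: ifP => _; rewrite ?mulr1 ?mulr0 ?mul0e ?mule0// muleC.
Qed.

End density.

Section exponential_law.
Context d (Omega : measurableType d) (R : realType) (Q : probability Omega R).
Context (E : Omega -> R).
Hypothesis mE : measurable_fun setT E.
Hypothesis lawE : forall x, 0 <= x -> Q [set w | x < E w] = (expR (- (2 * x)))%:E.
Local Open Scope ereal_scope.

Lemma exponential_prob_ray (x : R) :
  exponential_prob 2 `]x, +oo[ = if (0 <= x)%R then (expR (- (2 * x)))%:E else 1.
Proof.
have p2 : (0 < 2 :> R)%R by [].
have mpdf : measurable_fun setT (fun x : R => (exponential_pdf 2 x)%:E).
  by apply/measurable_EFinP; exact: measurable_exponential_pdf.
have pdf0 (y : R) : 0 <= (exponential_pdf 2 y)%:E by rewrite lee_fin exponential_pdf_ge0.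
have H : exponential_prob 2 `]-oo, x] + exponential_prob 2 `]x, +oo[ = 1.
  rewrite -(integral_exponential_pdf p2) /exponential_prob -ge0_integral_setU//.
  - by rewrite -itv_bndbnd_setU// set_itvE.
  - exact: measurable_funTS.
  - apply/disj_setPS => y /= []; rewrite !in_itv/= andbT => yx xy.
    by move: (lt_le_trans xy yx); rewrite ltxx.
have L : exponential_prob 2 `]-oo, x] =
    if (0 <= x)%R then 1 - (expR (- (2 * x)))%:E else 0.
  have Z y : (y < 0)%R -> exponential_pdf 2 y = 0%R by exact: lt0_exponential_pdf.
  case: ltgtP => x0.
  - rewrite -mulNr -exponential_prob_itv0c// /exponential_prob.
    rewrite integral_mkcond [RHS]integral_mkcond; apply: eq_integral => y _.
    rewrite !patchE !mem_setE !in_itv/=; case: (leP 0%R y) => //= y0.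
    by case: ifP => //; rewrite Z.
  - rewrite /exponential_prob integral0_eq// => y /=; rewrite in_itv/= => yx.
    by rewrite Z// (le_lt_trans yx).
  - rewrite -x0 mulr0 oppr0 expR0 subee// /exponential_prob.
    have -> : `]-oo, (0%R : R)]%classic = `]-oo, (0%R : R)[ `|` [set (0%R : R)].
      by rewrite setUitv1.
    rewrite ge0_integral_setU//.
    + rewrite integral_set1 adde0 integral0_eq// => y /=; rewrite in_itv/= => yx.
      by rewrite Z.
    + exact: measurable_funTS.
    + by apply/disj_setPS => y /= []; rewrite in_itv/= => + y0; rewrite y0 ltxx.
move: H; rewrite L; case: ifP => _; last by rewrite add0e.
have : exponential_prob 2 `]x, +oo[ <= 1.
  rewrite -(integral_exponential_pdf p2) /exponential_prob.
  by apply: ge0_subset_integral.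
have : 0 <= exponential_prob 2 `]x, +oo[ by apply: integral_ge0.
case: (exponential_prob _ _) => // r _ _; rewrite -EFinB -EFinD => -[H].
by congr (_%:E); lra.
Qed.

(** The law of [E] and the exponential distribution agree on the rays []x, +oo[], a generating
    pi-system. For negative [x] both give 1: the ray from 0 already has full probability. *)
Lemma integral_exponential_law (g : R -> \bar R) : measurable_fun setT g ->
  (forall x, 0 <= g x) ->
  \int[Q]_w g (E w) = \int[lebesgue_measure]_x ((exponential_pdf 2 x)%:E * g x).
Proof.
move=> mg g0; have mE' : measurable_fun setT (E : Omega -> measurableTypeR R) := mE.
pose nu : {measure set (measurableTypeR R) -> \bar R} :=
  measure_function_pushforward__canonical__measure_function_Measure Q mE'.
have p2 : (0 < 2 :> R)%R by [].
pose nu2 : {measure set (measurableTypeR R) -> \bar R} :=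
  exponential_distribution_exponential_prob__canonical__measure_function_Measure p2.
transitivity (\int[nu]_x g x).
  by rewrite (ge0_integral_pushforward mE')// => x _.
apply: ge0_integral_density => //.
- exact: measurable_exponential_pdf.
- by move=> x; exact: exponential_pdf_ge0.
move=> A mA; transitivity (nu2 A) => //.
apply: (@measure_unique _ _ (measurableTypeR R) (@RGenOInfty.G R)
  (fun n => `](- n%:R)%R, +oo[%classic) _ _ _ _ nu nu2) => //.
- exact: RGenOInfty.measurableE.
- move=> _ _ [x ->] [y ->]; exists (Num.max x y).
  by apply/seteqP; split => z /=; rewrite !in_itv/= !andbT gt_max => /andP.
- by move=> n; exists (- n%:R)%R.
- apply/seteqP; split => // x _; exists (Num.bound `|x|%R) => //=.
  rewrite in_itv/= andbT ltrNl.
  by apply: (le_lt_trans (ler_norm _)); rewrite normrN; exact: archi_boundP.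
- move=> _ [x ->]; rewrite /nu2 /=  exponential_prob_ray /nu /= /pushforward.
  have e : E @^-1` `]x, +oo[%classic = [set w | x < E w]%R.
    by apply/seteqP; split => w /=; rewrite in_itv/= andbT.
  rewrite e; case: ifPn => x0; first exact: lawE.
  apply/eqP; rewrite eq_le; apply/andP; split.
    by rewrite -e; apply: probability_le1; rewrite -[X in measurable X]setTI; exact: mE.
  have := lawE (lexx 0%R); rewrite mulr0 oppr0 expR0 => <-.
  apply: le_measure; rewrite ?inE.
  + have -> : [set w | 0 < E w]%R = E @^-1` `]0%R, +oo[%classic.
      by apply/seteqP; split => w /=; rewrite in_itv/= andbT.
    by rewrite -[X in measurable X]setTI; exact: mE.
  + by rewrite -e -[X in measurable X]setTI; exact: mE.
  + by move=> w /=; apply: lt_trans; rewrite ltNge.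
- move=> n; apply: (@le_lt_trans _ _ 1); last exact: ltry.
  by apply: probability_le1; rewrite -[X in measurable X]setTI; exact: mE.
Qed.

End exponential_law.

Definition sign_of (R : realType) (b : bool) : R := if b then 1 else -1.

(* Contribution to the Feynman-Kac functional, from time j-th jump on, of the
   walk started at x that makes exactly the steps s within time t. *)
Fixpoint fk_path (T : Type) (R : realType) (E D : nat -> T -> R) (c : int -> R)
    (x : int) (s : seq bool) (j : nat) (t : R) (w : T) : \bar R :=
  if s is b :: s' then
    (hold (c x) (E j w) * ((D j w == sign_of R b)%:R%:E *
      fk_path E D c (x + step_of b) s' j.+1 (t - E j w) w))%E
  else if (0 <= t) && (t < E j w) then (expR (c x * t))%:E else 0%E.

Lemma fk_path_ge0 (T : Type) (R : realType) (E D : nat -> T -> R) c x s j t w :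
  (0 <= fk_path E D c x s j t w)%E.
Proof.
elim: s x j t => [|b s IH] x j t /=.
  by case: ifP => // _; rewrite lee_fin expR_ge0.
by rewrite mule_ge0 ?hold_ge0// mule_ge0.
Qed.

(** Asking measurability only of the coordinates from [j] on makes the statement applicable on
    [space_but] with an earlier coordinate left out. *)
Lemma measurable_fk_path d (T : measurableType d) (R : realType)
    (E D : nat -> T -> R) c x s j :
  (forall k, (j <= k)%N -> measurable_fun setT (E k)) ->
  (forall k, (j <= k)%N -> measurable_fun setT (D k)) ->
  measurable_fun setT (fun z : R * T => fk_path E D c x s j z.1 z.2).
Proof.
elim: s x j => [|b s IH] x j mE mD /=.
  apply: measurable_fun_ifT.
  - apply: measurable_and.
      by apply: measurable_fun_ler => //; exact: measurable_fst.
    apply: measurable_fun_ltr; first exact: measurable_fst.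
    by apply: measurableT_comp; [exact: mE|exact: measurable_snd].
  - apply/measurable_EFinP; apply: measurableT_comp; first exact: measurable_expR.
    by apply: measurable_funM => //; exact: measurable_fst.
  - by [].
have mEj : measurable_fun setT (fun z : R * T => E j z.2).
  by apply: measurableT_comp; [exact: mE|exact: measurable_snd].
apply: emeasurable_funM.
  by apply: measurableT_comp => //; exact: measurable_hold.
apply: emeasurable_funM.
  apply/measurable_EFinP; apply: measurableT_comp => //.
  apply: measurable_fun_eqr => //.
  by apply: measurableT_comp; [exact: mD|exact: measurable_snd].
have IH' : measurable_fun setT (fun z : R * T => fk_path E D c (x + step_of b) s j.+1 z.1 z.2).
  by apply: IH => k jk; [apply: mE|apply: mD]; exact: ltnW.
apply: (measurableT_comp IH' (g := fun z : R * T => (z.1 - E j z.2, z.2))).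
apply/measurable_fun_pairP; split => /=; last exact: measurable_snd.
by apply: measurable_funB => //; exact: measurable_fst.
Qed.

Section feynman_kac_expectation.
Context d (Omega : measurableType d) (R : realType) (Q : probability Omega R).
Context (E D : nat -> Omega -> R).
Hypothesis indED : mutually_independent Q
    (fun i : nat + nat => match i with inl k => E k | inr k => D k end).
Hypothesis lawE : forall k x, 0 <= x -> Q [set w | x < E k w] = (expR (- (2 * x)))%:E.
Hypothesis lawD : forall k b, Q [set w | D k w = sign_of R b] = (1 / 2)%:E.
Local Open Scope ereal_scope.

Let mE k : measurable_fun setT (E k).
Proof. by have [m _] := indED; exact: (m (inl k)). Qed.

Let mD k : measurable_fun setT (D k).
Proof. by have [m _] := indED; exact: (m (inr k)). Qed.

Local Notation fam :=
  (fun i : nat + nat => match i with inl k => E k | inr k => D k end).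

Lemma integral_fk_path_sign c x s j b t :
  \int[Q]_w ((D j w == sign_of R b)%:R%:E * fk_path E D c x s j.+1 t w) =
  (1 / 2)%:E * \int[Q]_w fk_path E D c x s j.+1 t w.
Proof.
pose f (z : R * space_but fam (inr j)) : \bar R :=
  (z.1 == sign_of R b)%:R%:E * fk_path E D c x s j.+1 t z.2.
have mfb : measurable_fun setT
    (fun z : R * space_but fam (inr j) => fk_path E D c x s j.+1 z.1 z.2).
  apply: measurable_fk_path => k jk; first exact: (measurable_fun_but (X := fam) (i := inl k)).
  apply: (measurable_fun_but (X := fam) (i := inr k)).
  by apply/eqP => -[kj]; rewrite kj ltnn in jk.
have mf2 : measurable_fun setT
    (fun w : space_but fam (inr j) => fk_path E D c x s j.+1 t w).
  by apply: (measurableT_comp mfb (g := fun w => (t, w))); apply/measurable_fun_pairP;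
    split => /=; [exact: measurable_cst|exact: measurable_id].
have meq : measurable_fun setT (fun y : R => (y == sign_of R b)%:R%:E : \bar R).
  apply/measurable_EFinP; apply: measurableT_comp => //.
  exact: measurable_fun_eqr.
have mf : measurable_fun setT f.
  apply: emeasurable_funM.
    by apply: (measurableT_comp meq); exact: measurable_fst.
  by apply: (measurableT_comp mf2); exact: measurable_snd.
have f0 z : 0 <= f z by rewrite mule_ge0// fk_path_ge0.
rewrite (indep_integral indED mf f0) /f /=.
have mfQ : measurable_fun setT (fun w : Omega => fk_path E D c x s j.+1 t w).
  by apply: (measurableT_comp mf2); exact: measurable_fun_to_but indED.
have I0 : 0 <= \int[Q]_w fk_path E D c x s j.+1 t w.
  by apply: integral_ge0 => w _; exact: fk_path_ge0.
under eq_integral => w _.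
  rewrite ge0_integralZl//; last by move=> *; exact: fk_path_ge0.
  rewrite muleC; over.
have meQ : measurable_fun setT (fun w : Omega => (D j w == sign_of R b)%:R%:E : \bar R).
  by apply: (measurableT_comp meq); exact: mD.
rewrite ge0_integralZl//= muleC; congr (_ * _).
have mS : measurable [set w | D j w = sign_of R b].
  by rewrite -[X in measurable X]setTI; apply: (mD j measurableT (measurable_set1 _)).
rewrite -(lawD j b).
transitivity (\int[Q]_w (\1_[set w | D j w = sign_of R b] w)%:E).
  apply: eq_integral => w _; rewrite indicE.
  have -> // : (w \in [set w | D j w = sign_of R b]) = (D j w == sign_of R b).
  by apply/idP/eqP => [/set_mem|/mem_set].
by rewrite integral_indic// setIT.
Qed.

Lemma measurable_fk_path_Q c x s j : measurable_fun setT
  (fun z : R * Omega => fk_path E D c x s j z.1 z.2).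
Proof. by apply: measurable_fk_path => k _; [exact: mE|exact: mD]. Qed.

(** The density [2 exp (- 2 s)] of a holding time and the probability [1 / 2] of a step combine to
    [exp (- 2 s)], which turns [c v] into [c v - 2]. The last factor contains the probability that
    no further jump occurs. *)
Lemma integral_fk_path c x s j t :
  \int[Q]_w fk_path E D c x s j t w =
  holds [seq (c v - 2)%R | v <- trail x s] (hold (c (endp x s) - 2)%R) t.
Proof.
elim: s x j t => [|b s IH] x j t.
  rewrite [RHS]/= /hold; have [t0|t0] := leP 0%R t; last first.
    by rewrite integral0_eq// => w _ /=; rewrite leNgt t0.
  transitivity (\int[Q]_w ((expR (c x * t))%:E * (\1_[set w | t < E j w]%R w)%:E)).
    apply: eq_integral => w _ /=; rewrite t0 indicE /=.
    have -> : (w \in [set w | t < E j w]%R) = (t < E j w)%R.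
      by apply/idP/idP; rewrite inE.
    by case: ifP => _; rewrite ?mule1 ?mule0.
  have mS : measurable [set w | t < E j w]%R.
    have -> : [set w | t < E j w]%R = E j @^-1` `]t, +oo[%classic.
      by apply/seteqP; split => w /=; rewrite in_itv/= andbT.
    by rewrite -[X in measurable X]setTI; exact: mE.
  rewrite ge0_integralZl//=; last first.
    by apply/measurable_EFinP; exact: measurable_indic.
  rewrite integral_indic// setIT [X in _ * X](lawE j t0) -EFinM -expRD.
  by congr (expR _)%:E; ring.
pose f (z : R * space_but fam (inl j)) : \bar R := hold (c x) z.1 *
  ((D j z.2 == sign_of R b)%:R%:E * fk_path E D c (x + step_of b) s j.+1 (t - z.1)%R z.2).
have f0 z : 0 <= f z by rewrite mule_ge0 ?hold_ge0// mule_ge0// fk_path_ge0.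
have mDb k : measurable_fun setT (D k : space_but fam (inl j) -> R).
  exact: (measurable_fun_but (X := fam) (i := inr k)).
have mfb : measurable_fun setT (fun z : R * space_but fam (inl j) =>
    fk_path E D c (x + step_of b) s j.+1 z.1 z.2).
  apply: measurable_fk_path => k jk; last exact: mDb.
  apply: (measurable_fun_but (X := fam) (i := inl k)).
  by apply/eqP => -[kj]; rewrite kj ltnn in jk.
have mf : measurable_fun setT f.
  apply: emeasurable_funM.
    by apply: (measurableT_comp (measurable_hold _)); exact: measurable_fst.
  apply: emeasurable_funM.
    apply/measurable_EFinP; apply: measurableT_comp => //.
    apply: measurable_fun_eqr => //.
    by apply: (measurableT_comp (mDb j)); exact: measurable_snd.
  apply: (measurableT_comp mfb (g := fun z : R * space_but fam (inl j) => ((t - z.1)%R, z.2))).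
  apply/measurable_fun_pairP; split => /=; last exact: measurable_snd.
  by apply: measurable_funB => //; exact: measurable_fst.
transitivity (\int[Q]_w f (E j w, w)) => //.
rewrite (indep_integral indED mf f0) /f /=.
pose H := holds [seq (c v - 2)%R | v <- trail (x + step_of b) s]
  (hold (c (endp (x + step_of b) s) - 2)%R).
have nH : nnm H.
  by apply: holds_nnm; split; [exact: measurable_hold|exact: hold_ge0].
have [mH H0] := nH.
have mDQ : measurable_fun setT (fun w : Omega => (D j w == sign_of R b)%:R%:E : \bar R).
  by apply/measurable_EFinP; apply: measurableT_comp => //; exact: measurable_fun_eqr.
transitivity (\int[Q]_w (hold (c x) (E j w) * ((1 / 2)%:E * H (t - E j w)%R))).
  apply: eq_integral => w _; rewrite ge0_integralZl//=.
  - by rewrite integral_fk_path_sign IH.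
  - apply: emeasurable_funM => //.
    apply: (measurableT_comp (measurable_fk_path_Q _ _ _ _) (g := fun w' => ((t - E j w)%R, w'))).
    apply/measurable_fun_pairP.
    by split => /=; [exact: measurable_cst|exact: measurable_id].
  - by move=> w' _; rewrite mule_ge0// fk_path_ge0.
  - exact: hold_ge0.
rewrite (integral_exponential_law (mE j) (lawE j)
  (g := fun y => hold (c x) y * ((1 / 2)%:E * H (t - y)%R))); last 2 first.
- apply: emeasurable_funM; first exact: measurable_hold.
  apply: emeasurable_funM => //; apply: (measurableT_comp mH).
  exact: measurable_funB.
- by move=> y; rewrite mule_ge0 ?hold_ge0// mule_ge0.
apply: eq_integral => y _; rewrite -/H !muleA; congr (_ * _).
rewrite /hold; have [y0|y0] := leP 0%R y.
  rewrite exponential_pdfE// -!EFinM; congr (_%:E).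
  by rewrite mulrBl expRD mulNr; field.
by rewrite mule0 mul0e.
Qed.

End feynman_kac_expectation.

Section negligible_modification.
Context d (T : measurableType d) (R : realType) (mu : {measure set T -> \bar R}).
Local Open Scope ereal_scope.

Lemma ge0_le_integralT (f g : T -> \bar R) : (forall x, 0 <= f x) ->
  (forall x, f x <= g x) -> \int[mu]_x f x <= \int[mu]_x g x.
Proof.
move=> f0 fg; rewrite !ge0_integralTE//; last by move=> x; exact: le_trans (fg x).
by apply: ereal_sup_le => _ [h hf <-]; exists h => // x; exact: le_trans (fg x).
Qed.

(** The Feynman-Kac integrand is not known to be measurable, since [is_walk] prescribes [X] only
    where the steps are signs and the time lies in a holding interval. Adding [+oo] on the null set
    [N] gives measurable majorants with unchanged integral. *)
Lemma ge0_integral_negligible (f g : T -> \bar R) : (forall x, 0 <= f x) ->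
  (forall x, 0 <= g x) -> measurable_fun setT g ->
  mu.-negligible [set x | f x != g x] -> \int[mu]_x f x = \int[mu]_x g x.
Proof.
move=> f0 g0 mg [N [mN N0 fgN]].
have fg x : ~ N x -> f x = g x.
  by move=> Nx; apply: contrapT => /eqP fgx; exact/Nx/fgN.
pose h x : \bar R := +oo * (\1_N x)%:E.
have h0 x : 0 <= h x by rewrite mule_ge0// lee_fin.
have mh : measurable_fun setT h.
  by apply: emeasurable_funM => //; apply/measurable_EFinP; exact: measurable_indic.
have Ih : \int[mu]_x h x = 0.
  rewrite ge0_integralZl//; last by apply/measurable_EFinP; exact: measurable_indic.
  by rewrite integral_indic// setIT N0 mule0.
have hN x : N x -> h x = +oo.
  by move=> Nx; rewrite /h indicE mem_set// mule1.
pose g' x : \bar R := g x * (\1_(~` N) x)%:E.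
have g'0 x : 0 <= g' x by rewrite mule_ge0// lee_fin.
have mg' : measurable_fun setT g'.
  apply: emeasurable_funM => //; apply/measurable_EFinP.
  by apply: measurable_indic; exact: measurableC.
apply/eqP; rewrite eq_le; apply/andP; split.
  apply: (@le_trans _ _ (\int[mu]_x (g x + h x))); last first.
    by rewrite ge0_integralD// Ih adde0.
  apply: ge0_le_integralT => // x; have [Nx|Nx] := pselect (N x).
    by rewrite hN// addey ?leey// gt_eqF// (lt_le_trans (ltNyr 0)).
  by rewrite fg// leeDl.
apply: (@le_trans _ _ (\int[mu]_x (g' x + h x))).
  apply: ge0_le_integralT => // x; have [Nx|Nx] := pselect (N x).
    by rewrite hN// addey ?leey// gt_eqF// (lt_le_trans (ltNyr 0)).
  by rewrite /g' indicE mem_set// mule1 leeDl.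
rewrite ge0_integralD// Ih adde0; apply: ge0_le_integralT => // x.
rewrite /g' indicE; have [Nx|Nx] := pselect (N x).
  by rewrite memNset ?mule0//; exact.
by rewrite mem_set// mule1 fg.
Qed.

End negligible_modification.

(** * Evaluation along a single trajectory *)

Section one_trajectory.
Context (Omega : Type) (R : realType) (E D : nat -> Omega -> R).
Context (X : R -> Omega -> int) (w : Omega) (c : int -> R).
Hypothesis walkX : is_walk E D X.
Hypothesis E0 : forall k, 0 < E k w.
Hypothesis D1 : forall k, D k w = 1 \/ D k w = -1.

Definition steps_upto (n : nat) : seq bool := mkseq (fun i => D i w == 1) n.

Definition site_at (n : nat) : int := endp 0 (steps_upto n).

Lemma D_sign k b : (D k w == sign_of R b) = ((D k w == 1) == b).
Proof.
have n11 : (-1 == 1 :> R) = false by apply/eqP; lra.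
have p11 : (1 == -1 :> R) = false by apply/eqP; lra.
by case: (D1 k) => ->; case: b; rewrite /sign_of ?eqxx ?n11 ?p11.
Qed.

Fixpoint steps_match (s : seq bool) (j : nat) : bool :=
  if s is b :: s' then (D j w == sign_of R b) && steps_match s' j.+1 else true.

Fixpoint path_action (x : int) (s : seq bool) (j : nat) : R :=
  if s is b :: s' then c x * E j w + path_action (x + step_of b) s' j.+1 else 0.

Lemma fk_pathE x s j t : fk_path E D c x s j t w =
  if steps_match s j && (0 <= t - \sum_(i < size s) E (j + i)%N w < E (j + size s)%N w)
  then (expR (path_action x s j + c (endp x s) * (t - \sum_(i < size s) E (j + i)%N w)))%:E
  else 0%E.
Proof.
elim: s x j t => [|b s IH] x j t /=; first by rewrite big_ord0 subr0 addn0 add0r.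
rewrite IH big_ord_recl addn0 /hold (ltW (E0 j)) opprD addrA addSnnS.
under eq_bigr do rewrite addSnnS.
case: (D j w == _) => /=; last by rewrite mul0e mule0.
rewrite mul1e; case: ifP => _; last by rewrite mule0.
by rewrite -EFinM -expRD addrA.
Qed.

Lemma steps_matchP s : steps_match s 0 -> s = steps_upto (size s).
Proof.
rewrite /steps_upto /mkseq; move: 0%N => j.
elim: s j => //= b s IH j /andP[]; rewrite D_sign => /eqP-> /IH {1}->.
by [].
Qed.

Lemma steps_match_upto n : steps_match (steps_upto n) 0.
Proof.
rewrite /steps_upto /mkseq; move: 0%N => j.
by elim: n j => //= n IH j; rewrite D_sign eqxx IH.
Qed.

Lemma size_steps_upto n : size (steps_upto n) = n. Proof. exact: size_mkseq. Qed.

Lemma path_action_rcons x s b j : path_action x (rcons s b) j =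
  path_action x s j + c (endp x s) * E (j + size s)%N w.
Proof.
elim: s x j => [|a s IH] x j /=; first by rewrite add0r addr0 addn0.
by rewrite IH addrA addSnnS.
Qed.

Lemma steps_uptoS n : steps_upto n.+1 = rcons (steps_upto n) (D n w == 1).
Proof. by rewrite /steps_upto /mkseq -[in LHS]addn1 iotaD map_cat cats1. Qed.

Lemma path_action_upto n :
  path_action 0 (steps_upto n) 0 = \sum_(i < n) c (site_at i) * E i w.
Proof.
elim: n => [|n IH]; first by rewrite big_ord0.
by rewrite steps_uptoS path_action_rcons IH big_ord_recr/= add0n size_steps_upto.
Qed.

Lemma site_at_skeleton n : (site_at n)%:~R = skeleton D n w.
Proof.
elim: n => [|n IH]; first by rewrite /skeleton big_ord0.
rewrite /skeleton big_ord_recr/= -/(skeleton D n w) -IH /site_at.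
rewrite steps_uptoS -cats1 endp_cat /= rmorphD/=; congr (_ + _).
by case: (D1 n) => ->; rewrite /step_of ?eqxx//; case: eqP => //; lra.
Qed.

Lemma walk_at s n : jump_time E n w <= s < jump_time E n.+1 w -> X s w = site_at n.
Proof.
move=> sn; apply/eqP; rewrite -(eqr_int R) (walkX _ sn)//.
by rewrite site_at_skeleton.
Qed.

Lemma jump_timeS n : jump_time E n.+1 w = jump_time E n w + E n w.
Proof. by rewrite /jump_time big_ord_recr. Qed.

Lemma jump_time_le m n : (m <= n)%N -> jump_time E m w <= jump_time E n w.
Proof.
move=> /subnK <-; elim: (n - m)%N => // k IH.
by rewrite addSn jump_timeS (le_trans IH)// lerDl ltW.
Qed.

Lemma jump_time_locate s n : 0 <= s -> s < jump_time E n w ->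
  exists2 i, (i < n)%N & jump_time E i w <= s < jump_time E i.+1 w.
Proof.
move=> s0; elim: n => [|n IH]; first by rewrite /jump_time big_ord0 ltNge s0.
have [/IH[i ? ?] _|sn sn1] := ltP s (jump_time E n w); first by exists i => //; exact: ltnW.
by exists n => //; rewrite sn.
Qed.

Lemma jump_time_uniq s m n : jump_time E m w <= s < jump_time E m.+1 w ->
  jump_time E n w <= s < jump_time E n.+1 w -> m = n.
Proof.
move=> /andP[m1 m2] /andP[n1 n2]; apply/eqP; rewrite eqn_leq; apply/andP; split.
  by rewrite leqNgt; apply/negP => /jump_time_le h; lra.
by rewrite leqNgt; apply/negP => /jump_time_le h; lra.
Qed.

Lemma integral_walk n t : (forall v, 0 <= c v) -> 0 <= t ->
  jump_time E n w <= t < jump_time E n.+1 w ->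
  (\int[lebesgue_measure]_(s in `[0%R, t]%classic) (c (X s w))%:E =
   (path_action 0 (steps_upto n) 0 + c (site_at n) * (t - jump_time E n w))%:E)%E.
Proof.
move=> c0 t0 tn; have /andP[tn1 tn2] := tn.
pose J (i : 'I_n.+1) : set (measurableTypeR R) :=
  `[jump_time E i w, jump_time E i.+1 w[%classic.
have mJ i : measurable (J i) by exact: measurable_itv.
transitivity (\int[lebesgue_measure]_(s in `[0%R, t]%classic)
   (\sum_(i < n.+1) (c (site_at i))%:E * (\1_(J i) s)%:E))%E.
  apply: eq_integral => s; rewrite mem_setE in_itv/= => /andP[s0 st].
  have [i iN si] := jump_time_locate s0 (le_lt_trans st tn2).
  rewrite (walk_at si) (bigD1 (Ordinal iN))//= big1 ?adde0.
    by rewrite indicE mem_set ?mule1// /J /= in_itv.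
  move=> k ki; rewrite indicE memNset ?mule0// /J /= in_itv/= => sk.
  by move/eqP: ki; apply; apply: val_inj => /=; exact: jump_time_uniq sk si.
rewrite ge0_integral_sum//; last 2 first.
- move=> i; apply: emeasurable_funM => //; apply/measurable_EFinP.
  exact: measurable_indic.
- by move=> i s _; rewrite mule_ge0 ?lee_fin.
under eq_bigr => i _.
  rewrite ge0_integralZl//=; last 2 first.
    by apply/measurable_EFinP; exact: measurable_indic.
    by rewrite lee_fin.
  rewrite integral_indic//=.
  over.
rewrite path_action_upto EFinD -sumEFin big_ord_recr/=; congr (_ + _)%E.
  apply: eq_bigr => i _; rewrite EFinM; congr (_ * _)%E.
  have -> : J (widen_ord (leqnSn n) i) `&` `[0%R, t] = J (widen_ord (leqnSn n) i).
    apply/setIidPl => s; rewrite /J /= !in_itv/= => /andP[s1 s2]; apply/andP; split.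
      by apply: le_trans s1; have := jump_time_le (leq0n i); rewrite {1}/jump_time big_ord0.
    by apply: ltW; apply: (lt_le_trans s2); apply: le_trans tn1; exact: jump_time_le.
  rewrite /J lebesgue_measure_itv/= lte_fin jump_timeS ltrDl E0 -EFinB.
  by congr (_%:E); ring.
rewrite EFinM; congr (_ * _)%E.
have -> : J ord_max `&` `[0%R, t] = `[jump_time E n w, t]%classic.
  apply/seteqP; split => s; rewrite /J /= !in_itv/=.
    by move=> [/andP[-> _] /andP[_ ->]].
  move=> /andP[s1 s2]; split; apply/andP; split => //; first exact: le_lt_trans tn2.
  by apply: le_trans s1; have := jump_time_le (leq0n n); rewrite {1}/jump_time big_ord0.
rewrite lebesgue_measure_itv/= lte_fin; case: ltP => [_|h]; first by rewrite -EFinB.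
by have -> : t = jump_time E n w; [apply/le_anti; rewrite tn1 h|rewrite subrr].
Qed.

End one_trajectory.

Section feynman_kac.
Context d (Omega : measurableType d) (R : realType) (Q : probability Omega R).
Context (E D : nat -> Omega -> R) (X : R -> Omega -> int).
Hypothesis indED : mutually_independent Q
    (fun i : nat + nat => match i with inl k => E k | inr k => D k end).
Hypothesis lawE : forall k x, 0 <= x -> Q [set w | x < E k w] = (expR (- (2 * x)))%:E.
Hypothesis lawD1 : forall k, Q [set w | D k w = 1] = (1 / 2)%:E.
Hypothesis lawDN1 : forall k, Q [set w | D k w = -1] = (1 / 2)%:E.
Hypothesis walkX : is_walk E D X.

Let lawD k b : Q [set w | D k w = sign_of R b] = (1 / 2)%:E.
Proof. by case: b; [exact: lawD1|exact: lawDN1]. Qed.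

Let mE k : measurable_fun setT (E k).
Proof. by have [m _] := indED; exact: (m (inl k)). Qed.

Let mD k : measurable_fun setT (D k).
Proof. by have [m _] := indED; exact: (m (inr k)). Qed.

Let measurable_E_gt k (x : R) : measurable [set w | x < E k w].
Proof.
have -> : [set w | x < E k w] = E k @^-1` `]x, +oo[%classic.
  by apply/seteqP; split => w /=; rewrite in_itv/= andbT.
by rewrite -[X in measurable X]setTI; exact: mE.
Qed.

Lemma negligible_hold_le0 : Q.-negligible [set w | exists k, E k w <= 0].
Proof.
have -> : [set w | exists k, E k w <= 0] = \bigcup_k ~` [set w | 0 < E k w].
  apply/seteqP; split => w /= [k].
    by move=> h; exists k => //=; apply/negP; rewrite -leNgt.
  by move=> _ /= /negP; rewrite -leNgt => h; exists k.
apply: negligible_bigcup => k; exists (~` [set w | 0 < E k w]); split => //.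
  exact: measurableC.
pose S := [set w | 0 < E k w].
transitivity (1 - Q S)%E; first exact: probability_setC.
rewrite /S.
by rewrite lawE// mulr0 oppr0 expR0 subee.
Qed.

Lemma negligible_bad_step : Q.-negligible [set w | exists k, ~ (D k w = 1 \/ D k w = -1)].
Proof.
have mS k x : measurable [set w | D k w = x].
  by rewrite -[X in measurable X]setTI; apply: (mD k measurableT (measurable_set1 _)).
have -> : [set w | exists k, ~ (D k w = 1 \/ D k w = -1)] =
    \bigcup_k ~` ([set w | D k w = 1] `|` [set w | D k w = -1]).
  by apply/seteqP; split => w /= [k]; [move=> h; exists k|move=> _ h; exists k].
apply: negligible_bigcup => k.
exists (~` ([set w | D k w = 1] `|` [set w | D k w = -1])); split => //.
  by apply: measurableC; exact: measurableU.
pose S := [set w | D k w = 1] `|` [set w | D k w = -1].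
transitivity (1 - Q S)%E.
  by apply: probability_setC; exact: measurableU.
rewrite /S measureU//; last first.
  by apply/seteqP; split => // w /= [-> /eqP]; apply/negP/eqP; lra.
transitivity (1 - ((1 / 2)%:E + (1 / 2)%:E) :> \bar R)%E.
  by congr (1 - (_ + _))%E; [exact: lawD1|exact: lawDN1].
have -> // : (1 - ((1 / 2)%:E + (1 / 2)%:E))%E = (1 - (1 / 2 + 1 / 2))%:E :> \bar R by [].
by congr (_%:E); field.
Qed.

(** This excludes explosion: infinitely many holding times exceed 1, so the jump times are
    unbounded. Independence of [L] consecutive holding times bounds the event by [q ^+ L], for every
    [L]. *)
Lemma negligible_eventually_short :
  Q.-negligible [set w | exists l, forall i, (l <= i)%N -> E i w <= 1].
Proof.
have -> : [set w | exists l, forall i, (l <= i)%N -> E i w <= 1] =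
    \bigcup_l \bigcap_(i in [set i | (l <= i)%N]) ~` [set w | 1 < E i w].
  apply/seteqP; split => w /= [l].
    by move=> h; exists l => // i /= li; apply/negP; rewrite -leNgt h.
  by move=> _ h; exists l => i li; rewrite leNgt; apply/negP; exact: h.
apply: negligible_bigcup => l.
set A := \bigcap_(i in _) _.
have mA : measurable A.
  by apply: bigcap_measurable => [|i _]; [exists l => /=|exact: measurableC].
exists A; split => //.
pose q : R := 1 - expR (- (2 * 1)).
have q0 : 0 <= q by rewrite /q subr_ge0 -[leRHS]expR0 ler_expR; lra.
have q1 : q < 1 by rewrite /q ltrBlDr ltrDl expR_gt0.
have QL L : (Q A <= (q ^+ L)%:E)%E.
  have [_ ind] := indED.
  pose J := [seq inl i : nat + nat | i <- iota l L].
  have uJ : uniq J by rewrite map_inj_uniq ?iota_uniq// => ? ? [].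
  have := ind J (fun=> `]-oo, 1]%classic) uJ (fun _ _ => measurable_itv _).
  move=> H; apply: (@le_trans _ _ (Q (\big[setI/setT]_(i <- J)
      ((match i with inl k => E k | inr k => D k end) @^-1` `]-oo, 1]%classic)))).
    apply: le_measure; rewrite ?inE//.
      by apply: (measurable_big_preimage indED) => i _; exact: measurable_itv.
    move=> w Aw; apply/mem_big_setI => i /mapP[k]; rewrite mem_iota => /andP[lk _] -> /=.
    by rewrite in_itv/= leNgt; apply/negP; exact: Aw.
  rewrite H /J big_map.
  have QE i : Q (E i @^-1` `]-oo, 1]%classic) = q%:E.
    have -> : E i @^-1` `]-oo, 1]%classic = ~` [set w | 1 < E i w].
      apply/seteqP; split => w /=; rewrite in_itv/= leNgt; first by move/negP.
      by move=> h; apply/negP.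
    pose S := [set w | 1 < E i w].
    transitivity (1 - Q S)%E; first exact: probability_setC.
    by rewrite lawE.
  rewrite le_eqVlt; apply/orP; left; apply/eqP.
  elim: L {H J uJ} l {A mA} => [|L IH] l; first by rewrite big_nil.
  by rewrite /= big_cons QE IH exprS EFinM.
apply/eqP; rewrite eq_le measure_ge0 andbT.
pose a := fine (Q A).
have QA : Q A = a%:E by rewrite fineK// fin_num_measure.
apply: (@le_trans _ _ a%:E); first by rewrite -QA.
rewrite lee_fin.
have : q ^+ n @[n --> \oo] --> 0 by apply: cvg_expr; rewrite ger0_norm.
move=> /cvg_lim <-//; apply: limr_ge => //.
  by apply/cvg_ex; exists 0; apply: cvg_expr; rewrite ger0_norm.
by near=> n; rewrite -lee_fin -QA; exact: QL.
Unshelve. all: by end_near. Qed.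

Lemma negligible_bad_trajectory : Q.-negligible
  [set w | ~ [/\ forall k, 0 < E k w, forall k, D k w = 1 \/ D k w = -1 &
    forall l, exists2 i, (l <= i)%N & 1 < E i w]].
Proof.
apply: negligibleS (negligibleU negligible_hold_le0
  (negligibleU negligible_bad_step negligible_eventually_short)) => w /= H.
have [h1|h1] := pselect (exists k, E k w <= 0); first by left.
have [h2|h2] := pselect (exists k, ~ (D k w = 1 \/ D k w = -1)); first by right; left.
right; right; apply: contrapT => h3; apply: H; split.
- by move=> k; rewrite ltNge; apply/negP => h; apply: h1; exists k.
- by move=> k; apply: contrapT => h; apply: h2; exists k.
- move=> l; apply: contrapT => h; apply: h3; exists l => i li.
  by rewrite leNgt; apply/negP => e; apply: h; exists i.
Qed.

Lemma jump_time_unbounded w t : (forall k, 0 < E k w) ->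
  (forall l, exists2 i, (l <= i)%N & 1 < E i w) -> exists n, t < jump_time E n w.
Proof.
move=> E0 H; have [m] : exists m : nat, t < m%:R.
  by exists (Num.bound `|t|); apply: (le_lt_trans (ler_norm _)); exact: archi_boundP.
suff [n mn] : exists n, m%:R <= jump_time E n w by move=> /lt_le_trans h; exists n; exact: h.
elim: m => [|m [n IH]]; first by exists 0%N; rewrite /jump_time big_ord0.
have [i ni Ei] := H n; exists i.+1; rewrite jump_timeS -natr1 lerD//; last exact: ltW.
exact: le_trans (jump_time_le E0 ni).
Qed.

Lemma nneseries_single (f : nat -> \bar R) n : (forall k, k != n -> f k = 0%E) ->
  (0 <= f n)%E -> (\sum_(0 <= k <oo) f k = f n)%E.
Proof.
move=> fk fn; rewrite (nneseries_split 0 n.+1); last first.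
  by move=> k _; have [->//|/fk->] := eqVneq k n.
rewrite add0n eseries0; last first.
  by move=> k kn _; apply: fk; rewrite gt_eqF.
rewrite adde0 big_nat_recr//= big_nat big1 ?add0e// => k /andP[_ kn].
by rewrite fk// lt_eqF.
Qed.

(** Outside a null set only the step sequence actually performed up to time [t] has a nonzero
    [fk_path], and this value is the exponential of the integrated potential. Summing over all
    sequences thus recovers the integrand, and Tonelli exchanges sum and expectation. *)
Lemma fk_solutionE (xi : int -> R) t z : (forall v, 0 <= xi v) -> 0 <= t ->
  fk_solution Q X xi t z = (\sum_(0 <= n <oo) \sum_(s <- bool_seqs n | endp 0 s == z)
    holds [seq (xi v - 2)%R | v <- trail 0 s] (hold (xi z - 2)%R) t)%E.
Proof.
move=> xi0 t0; rewrite /fk_solution.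
pose g n w := (\sum_(s <- bool_seqs n | endp 0 s == z) fk_path E D xi 0 s 0 t w)%E.
have mfk s : measurable_fun setT (fun w => fk_path E D xi 0 s 0 t w).
  apply: (measurableT_comp (measurable_fk_path_Q indED _ _ _ _) (g := fun w => (t, w))).
  by apply/measurable_fun_pairP; split => /=; [exact: measurable_cst|exact: measurable_id].
have g0 n w : (0 <= g n w)%E by apply: sume_ge0 => s _; exact: fk_path_ge0.
have mg n : measurable_fun setT (g n).
  rewrite /g; under eq_fun do rewrite -big_filter.
  by apply: emeasurable_sum => s; exact: mfk.
transitivity (\int[Q]_w (\sum_(0 <= n <oo) g n w))%E; last first.
  rewrite integral_nneseries//; apply: eq_eseriesr => n _.
  rewrite /g; under eq_integral do rewrite -big_filter.
  rewrite ge0_integral_sum//; last by move=> s w _; exact: fk_path_ge0.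
  rewrite big_filter; apply: eq_bigr => s /eqP sz.
  by rewrite (integral_fk_path indED lawE lawD) sz.
apply: ge0_integral_negligible.
- by move=> w; rewrite mule_ge0 ?expeR_ge0.
- by move=> w; apply: nneseries_ge0.
- by apply: ge0_emeasurable_sum || apply: ge0_emeasurable_fun_sum.
apply: negligibleS negligible_bad_trajectory => w /= fg [E0 D1 big].
move/eqP: fg; apply.
have [N tN] := jump_time_unbounded t E0 big.
have [n _ tn] := jump_time_locate t0 tN.
rewrite (integral_walk walkX E0 D1 xi0 t0 tn) (walk_at walkX D1 tn).
have fkE s : fk_path E D xi 0 s 0 t w != 0%E -> s = steps_upto D w n.
  rewrite (fk_pathE _ _ E0); case: ifP => [|_]; last by rewrite eqxx.
  move=> /andP[/(steps_matchP D1) -> + _]; rewrite size_steps_upto.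
  under eq_bigr do rewrite add0n.
  rewrite subr_ge0 ltrBlDl -[X in _ < X + _]/(jump_time E (size s) w) -jump_timeS => ts.
  by rewrite (jump_time_uniq E0 ts tn).
have fkn : fk_path E D xi 0 (steps_upto D w n) 0 t w =
    (expR (path_action E w xi 0 (steps_upto D w n) 0 +
      xi (site_at D w n) * (t - jump_time E n w)))%:E.
  rewrite (fk_pathE _ _ E0) (steps_match_upto D1) size_steps_upto.
  under eq_bigr do rewrite add0n.
  by rewrite subr_ge0 ltrBlDl -[X in _ < X + _]/(jump_time E n w) -jump_timeS tn.
rewrite (nneseries_single (n := n)) => [| k kn |]; last 2 first.
- rewrite /g big_seq_cond big1// => s /andP[]; rewrite mem_bool_seqs => /eqP sk _.
  apply/eqP; apply: contraNT kn => /fkE es.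
  by rewrite -sk es size_steps_upto.
- exact: g0.
have sn : steps_upto D w n \in bool_seqs n by rewrite mem_bool_seqs size_steps_upto.
rewrite /g big_mkcond (bigD1_seq _ sn (bool_seqs_uniq n))/= big1 ?adde0; last first.
  move=> s sns; case: ifP => // _; apply/eqP; apply: contraNT sns => /fkE ->.
  exact: eqxx.
rewrite fkn -[endp 0 _]/(site_at D w n); case: ifP => _; last by rewrite mule0.
by rewrite mule1.
Qed.

End feynman_kac.

(** * Comparison of the path sum with its reflection *)

Section reflection.
Context (R : realType).
Implicit Types (c : int -> R) (s : seq bool).

Lemma step_of_negb b : step_of (~~ b) = - step_of b.
Proof. by case: b. Qed.

Lemma endp_negb x s : endp (- x) (map negb s) = - endp x s.
Proof. by elim: s x => //= b s IH x; rewrite -IH step_of_negb opprD. Qed.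

Lemma trail_negb x s : trail (- x) (map negb s) = [seq - v | v <- trail x s].
Proof.
by elim: s x => //= b s IH x; rewrite -IH step_of_negb opprD.
Qed.

Lemma bool_seqs_negb n : perm_eq [seq map negb s | s <- bool_seqs n] (bool_seqs n).
Proof.
have inj : injective (map negb) by apply: inj_map; exact: negb_inj.
apply: uniq_perm; rewrite ?map_inj_uniq ?bool_seqs_uniq// => s.
apply/mapP/idP => [[u + ->]|sn]; rewrite ?mem_bool_seqs ?size_map//.
exists (map negb s); first by move: sn; rewrite !mem_bool_seqs size_map.
by rewrite -map_comp (eq_map negbK) map_id.
Qed.

Lemma holds_tilt (a : R) (l : seq R) (f : R -> \bar R) t : nnm f ->
  (holds [seq (x + a)%R | x <- l] (fun y => (expR (a * y))%:E * f y) t =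
   (expR (a * t))%:E * holds l f t)%E.
Proof.
move=> nf; elim: l t => //= x l IH t.
rewrite /holdT -ge0_integralZl//; last 2 first.
- by have [] := nnm_hold_mul x t (holds_nnm l nf).
- by move=> y _; have [_] := nnm_hold_mul x t (holds_nnm l nf).
apply: eq_integral => y _; rewrite IH muleA [in RHS]muleA; congr (_ * _)%E.
rewrite /hold; case: ifP => _; last by rewrite mul0e mule0.
by rewrite -!EFinM -!expRD; congr (expR _)%:E; ring.
Qed.

End reflection.

Section path_expansion.
Context d (Omega : measurableType d) (R : realType) (Q : probability Omega R).
Context (E D : nat -> Omega -> R) (X : R -> Omega -> int).
Hypothesis indED : mutually_independent Q
    (fun i : nat + nat => match i with inl k => E k | inr k => D k end).
Hypothesis lawE : forall k x, 0 <= x -> Q [set w | x < E k w] = (expR (- (2 * x)))%:E.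
Hypothesis lawD1 : forall k, Q [set w | D k w = 1] = (1 / 2)%:E.
Hypothesis lawDN1 : forall k, Q [set w | D k w = -1] = (1 / 2)%:E.
Hypothesis walkX : is_walk E D X.
Context (xi : int -> R) (t : R) (Z : nat).
Hypotheses (xi0 : forall v, 0 <= xi v) (t0 : 0 <= t).
Local Notation lam := (xi Z).

Definition full_sum (c : int -> R) : \bar R :=
  (\sum_(0 <= n <oo) \sum_(s <- bool_seqs n | endp 0 s == Z) wt c s t)%E.

(** Extracting [exp ((lam - 2) t)] makes the value at [Z] zero and turns the endpoint factor into a
    step function. The same exponential is extracted at [- Z], so it cancels in the ratio. *)
Lemma fk_solution_full : fk_solution Q X xi t Z =
  ((expR ((lam - 2) * t))%:E * full_sum (fun v => xi v - lam)%R)%E.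
Proof.
rewrite (fk_solutionE indED lawE lawD1 lawDN1 walkX Z xi0 t0) /full_sum.
rewrite -nneseriesZl; last by move=> n _; apply: sume_ge0 => s _; exact: wt_ge0.
apply: eq_eseriesr => n _; rewrite ge0_sume_distrr; last by move=> s _; exact: wt_ge0.
apply: eq_bigr => s _; rewrite /wt -holds_tilt; last exact: nnm_heaviside.
rewrite -map_comp (eq_map (g := (fun x => x + (lam - 2)) \o (fun v => xi v - lam))); last first.
  by move=> v /=; lra.
congr (holds _ _ t); apply/funext => y; rewrite /hold /heaviside.
by case: ifP => _; rewrite ?mule1 ?mule0.
Qed.

Lemma fk_solution_full_opp : xi (- Z%:Z) = lam -> fk_solution Q X xi t (- Z%:Z) =
  ((expR ((lam - 2) * t))%:E * full_sum (fun v => xi (- v) - lam)%R)%E.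
Proof.
move=> xiN; rewrite (fk_solutionE indED lawE lawD1 lawDN1 walkX _ xi0 t0) /full_sum.
rewrite -nneseriesZl; last by move=> n _; apply: sume_ge0 => s _; exact: wt_ge0.
apply: eq_eseriesr => n _; rewrite ge0_sume_distrr; last by move=> s _; exact: wt_ge0.
rewrite -(perm_big _ (bool_seqs_negb n)) big_map /=.
have en s : endp 0 (map negb s) = - endp 0 s by rewrite -endp_negb oppr0.
have tn s : trail 0 (map negb s) = [seq - v | v <- trail 0 s] by rewrite -trail_negb oppr0.
apply: eq_big => [s|s _]; first by rewrite en eqr_opp.
rewrite /wt -holds_tilt; last exact: nnm_heaviside.
rewrite tn -!map_comp xiN.
rewrite (eq_map (g := (fun x => x + (lam - 2)) \o (fun v => xi (- v) - lam))); last first.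
  by move=> v /=; lra.
congr (holds _ _ t); apply/funext => y; rewrite /hold /heaviside.
by case: ifP => _; rewrite ?mule1 ?mule0.
Qed.

End path_expansion.

Lemma near_equal_key (R : realType) (eps u u' a b : R) : 0 < eps -> eps <= 1 / 10 -> (1 - eps) * a <= b -> 0 < a ->
  (1 - eps) * u <= (1 + eps) * a -> (1 - 2 * eps) * b <= u' ->
  (1 - 4 * eps) * u <= (1 + eps) * u'.
Proof.
move=> eps0 eps1 ab a0 hu hu'.
have h1 : (1 - eps) * ((1 - eps) * u) <= (1 + eps) * b.
  apply: (@le_trans _ _ ((1 - eps) * ((1 + eps) * a))).
    by rewrite ler_wpM2l//; lra.
  by rewrite mulrCA ler_wpM2l//; lra.
have h2 : (1 - 2 * eps) * ((1 - eps) * ((1 - eps) * u)) <= (1 + eps) * u'.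
  apply: (@le_trans _ _ ((1 - 2 * eps) * ((1 + eps) * b))).
    by rewrite ler_wpM2l//; lra.
  by rewrite mulrCA ler_wpM2l//; lra.
have [u0|u0] := leP 0 u; last first.
  apply: (@le_trans _ _ 0); first by nra.
  have b0 : 0 < b by apply: lt_le_trans ab; rewrite mulr_gt0//; lra.
  rewrite mulr_ge0//; first by lra.
  by apply: le_trans hu'; rewrite mulr_ge0// ?ltW//; lra.
apply: le_trans h2; rewrite !mulrA ler_wpM2r//; nra.
Qed.

Lemma ratio_key (R : realType) (eps u u' a b : R) : 0 < eps -> eps <= 1 / 10 ->
  (1 - eps) * b <= a -> (1 - eps) * a <= b -> 0 < a -> 0 < b ->
  (1 - 2 * eps) * a <= u -> (1 - eps) * u <= (1 + eps) * a ->
  (1 - 2 * eps) * b <= u' -> (1 - eps) * u' <= (1 + eps) * b ->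
  `|u / u' - 1| <= 10 * eps.
Proof.
move=> eps0 eps1 ba ab a0 b0 lo hi lo' hi'.
have e2 : 0 < 1 - 2 * eps by lra.
have u0 : 0 < u by apply: lt_le_trans lo; rewrite mulr_gt0.
have u0' : 0 < u' by apply: lt_le_trans lo'; rewrite mulr_gt0.
have -> : u / u' - 1 = (u - u') / u' by rewrite mulrBl mulfV// gt_eqF.
rewrite normrM (ger0_norm (_ : 0 <= u'^-1)); last by rewrite invr_ge0 ltW.
rewrite ler_pdivrMr// ler_norml.
have h1 := near_equal_key eps0 eps1 ab a0 hi lo'.
have h2 := near_equal_key eps0 eps1 ba b0 hi' lo.
by apply/andP; split; nra.
Qed.

(** In the application [tn] is [tiny], [br] is [bad_rate], [g] the product of [excl_weight] and
    [rest_sum], [A] the sum over good paths, [T] the sum over paths of length at most [N], and [S]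
    the sum over longer ones. *)
Lemma bounds_key (R : realType) (eps tn br g A T S : R) : 0 < eps -> eps <= 1 / 10 ->
  tn <= eps -> br <= eps -> 0 < g -> 0 <= A -> 0 <= S ->
  S <= eps * A -> T <= A + br * T -> A <= T -> A <= g -> (1 - tn - eps) * g <= A ->
  (1 - 2 * eps) * g <= T + S /\ (1 - eps) * (T + S) <= (1 + eps) * g.
Proof.
move=> eps0 eps1 tnH brH g0 A0 S0 SA TA AT Ag gA; split.
  suff : (1 - 2 * eps) * g <= (1 - tn - eps) * g by lra.
  by rewrite ler_wpM2r ?(ltW g0)//; lra.
have T0 : 0 <= T by lra.
have : br * T <= eps * T by rewrite ler_wpM2r.
nra.
Qed.

Section ratio.
Context (R : realType) (excl : pred int) (Z N K : nat) (k t eps : R).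
Implicit Types (c : int -> R).
Hypotheses (Z0 : (0 < Z)%N) (ZN : (Z <= N)%N) (k4 : 4 <= k) (t0 : 0 < t).
Hypotheses (e0 : ~~ excl 0) (eps0 : 0 < eps) (eps1 : eps <= 1 / 10).
Hypothesis eK : forall v, excl v -> K%:Z < `|v - Z%:Z|.
Hypothesis tinyH : tiny N k t <= eps.
Hypothesis gH : 8 / k + 2 / t < k.
Hypothesis growH : (1 - (8 / k + 2 / t) / k)^-1 ^+ size (excl_list excl Z) <= 1 + eps.
Hypothesis badH : bad_rate excl Z N K k t <= eps.
Local Notation deep := (deep Z N k).

(** The factor [4^-1 ^+ size s] beats the [2 ^ n] paths of length [n] and leaves a geometric series.
    The reference [dir] bounds the straight path from below, which is one of the good paths. *)
Definition negligible_tail c := exists dir : R, [/\ 0 < dir,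
  (dir%:E <= wt c (nseq Z true) t)%E &
  forall s, (N < size s)%N -> (wt c s t <= (eps * dir * 4^-1 ^+ size s)%:E)%E].

Lemma full_sum_total c : full_sum t Z c = (total Z N c t +
  \sum_(N.+1 <= n <oo) \sum_(s <- bool_seqs n | endp 0 s == Z) wt c s t)%E.
Proof.
rewrite /full_sum (nneseries_split 0 N.+1); last first.
  by move=> n _; apply: sume_ge0 => s _; exact: wt_ge0.
congr (_ + _)%E; rewrite add0n /total /short_seqs big_flatten big_map.
by rewrite -[iota 0 N.+1]/(index_iota 0 N.+1).
Qed.

Lemma tail_le c : negligible_tail c ->
  (\sum_(N.+1 <= n <oo) \sum_(s <- bool_seqs n | endp 0 s == Z) wt c s t <=
   eps%:E * good_sum excl Z N c t)%E.
Proof.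
move=> [dir [d0 dle H]].
apply: (@le_trans _ _ (eps%:E * dir%:E)%E); last first.
  by rewrite lee_wpmul2l ?lee_fin ?(ltW eps0)// (le_trans dle)// wt_direct_le.
apply: lime_le.
  apply: is_cvg_ereal_nneg_natsum_cond => n _ _.
  by apply: sume_ge0 => s _; exact: wt_ge0.
near=> M; apply: (@le_trans _ _ (\sum_(N.+1 <= n < M) (eps * dir * 2^-1 ^+ n)%:E)%E).
  rewrite big_nat [leRHS]big_nat; apply: lee_sum => n /andP[Nn nM].
  apply: (@le_trans _ _ (\sum_(s <- bool_seqs n) (eps * dir * 4^-1 ^+ n)%:E)%E).
    rewrite big_mkcond big_seq [leRHS]big_seq; apply: lee_sum => s.
    rewrite mem_bool_seqs => /eqP sn; case: ifP => _; first by rewrite -sn H// sn.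
    by rewrite lee_fin !mulr_ge0// ?exprn_ge0// ltW.
  rewrite sume_const_seq ?lee_fin ?mulr_ge0 ?exprn_ge0 ?(ltW d0) ?(ltW eps0)//.
  rewrite size_bool_seqs natrX mulrCA.
  rewrite -exprMn le_eqVlt; apply/orP; left; apply/eqP; congr (_ * _ ^+ _).
  by field.
rewrite sumEFin -mulr_sumr -EFinM lee_fin.
rewrite ler_piMr ?mulr_ge0 ?(ltW d0) ?(ltW eps0)//.
apply: (le_trans (geom_sum_le _ _ _)); first by lra.
rewrite exprS mulrA mulfV// mul1r exprn_ile1//; lra.
Unshelve. all: by end_near. Qed.

Lemma full_sum_bounds c : deep c -> negligible_tail c ->
  let p := excl_weight excl Z c in let G := fine (rest_sum excl Z N c t) in
  [/\ 0 < G, full_sum t Z c \is a fin_num,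
    (1 - 2 * eps) * (p * G) <= fine (full_sum t Z c) &
    (1 - eps) * fine (full_sum t Z c) <= (1 + eps) * (p * G)].
Proof.
move=> dc tc p G.
have p0 : 0 < p by exact: (excl_weight_gt0 Z0 k4 e0 ZN dc).
have GE : rest_sum excl Z N c t = G%:E by rewrite fineK// (rest_sum_fin Z0 k4 e0 ZN t dc).
have tinyH' : 2 ^+ N * expR (- (k * t / 4)) <= 2^-1.
  by move: tinyH eps1; rewrite /tiny; lra.
have up := good_sum_upper Z0 k4 e0 ZN t dc.
have lo := good_sum_lower Z0 k4 e0 ZN dc t0 tinyH' gH growH.
have tg := total_le_good Z0 k4 e0 eK (ltW t0) dc.
have gt := good_le_total excl Z N c t.
have TE := total_fin Z0 k4 e0 ZN t dc.
move: (tail_le tc) tg gt up lo; rewrite full_sum_total GE.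
move: TE; case: (total Z N c t) => // T _.
have [dir [d0 dle _]] := tc; move: (le_trans dle (wt_direct_le excl ZN c t)).
case: (good_sum excl Z N c t) => [A||] dA; [|by move=> _ _|by []].
set S := (\sum_(_ <= _ <oo) _)%E.
have S0 : (0 <= S)%E.
  by apply: nneseries_ge0 => n _ _; apply: sume_ge0 => s _; exact: wt_ge0.
rewrite -EFinM; case: S S0 => [S|//|//] S0; rewrite ?lee_fin in dA S0 *.
rewrite -/p => SA TA AT Aup Alo.
have A0 : 0 < A by apply: lt_le_trans dA.
have G0 : 0 < G by rewrite -(pmulr_rgt0 _ p0) (lt_le_trans A0).
rewrite -mulrA in Alo.
have [lo hi] := bounds_key eps0 eps1 tinyH badH (mulr_gt0 p0 G0) (ltW A0) S0 SA TA AT Aup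
  Alo.
by split.
Qed.

Lemma ratio_bound c c' : deep c -> deep c' -> (forall v, ~~ excl v -> c v = c' v) ->
  negligible_tail c -> negligible_tail c' ->
  (1 - eps) * excl_weight excl Z c' <= excl_weight excl Z c ->
  (1 - eps) * excl_weight excl Z c <= excl_weight excl Z c' ->
  `|fine (full_sum t Z c) / fine (full_sum t Z c') - 1| <= 10 * eps.
Proof.
move=> dc dc' cc' tc tc' pp pp'.
have [G0 _ lo hi] := full_sum_bounds dc tc.
have [_ _ lo' hi'] := full_sum_bounds dc' tc'.
have GE : rest_sum excl Z N c' t = rest_sum excl Z N c t.
  apply: eq_bigr => s _; rewrite /rest_wt /rest; congr (holds _ _ t).
  apply/eq_in_map => v; rewrite mem_filter => /andP[nv _].
  by rewrite cc'.
move: lo hi lo' hi' G0 pp pp' (excl_weight_gt0 Z0 k4 e0 ZN dc) (excl_weight_gt0 Z0 k4 e0 ZN dc').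
rewrite GE; set p := excl_weight _ _ _; set p' := excl_weight _ _ _.
set G := fine _; set u := fine _; set u' := fine _.
move=> lo hi lo' hi' G0 pp pp' p0 p0'.
have pG : (1 - eps) * (p' * G) <= p * G by rewrite mulrA ler_wpM2r// ltW.
have pG' : (1 - eps) * (p * G) <= p' * G by rewrite mulrA ler_wpM2r// ltW.
exact: (ratio_key eps0 eps1 pG pG' (mulr_gt0 p0 G0) (mulr_gt0 p0' G0)).
Qed.

End ratio.

(** * Typical environments *)

Lemma sub_ln_mono (R : realType) (b u v : R) : 0 <= b -> 0 < u -> b <= u -> u <= v ->
  u - b * ln u <= v - b * ln v.
Proof.
move=> b0 u0 bu uv; have v0 : 0 < v by exact: lt_le_trans uv.
have h : ln v - ln u <= (v - u) / u.
  rewrite -ln_div ?posrE//; apply: le_trans (le_ln1Dx _); last first.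
    by rewrite mulrBl mulfV ?gt_eqF// ltrBrDl subrr divr_gt0.
  by rewrite mulrBl mulfV ?gt_eqF// addrC subrK.
have : b * (ln v - ln u) <= v - u.
  apply: (le_trans (ler_wpM2l b0 h)).
  by rewrite mulrCA ler_piMr ?subr_ge0// ler_pdivrMr// mul1r.
lra.
Qed.

Lemma powR34_sublinear (R : realType) (k X : R) : 0 < k -> 1 <= X -> (2 / k) ^+ 4 <= X ->
  (1 + X) `^ (3 / 4) <= k * X.
Proof.
move=> k0 X1 kX; set Y := 1 + X; set q := Y `^ (4^-1).
have Y0 : 0 < Y by rewrite /Y; lra.
have q0 : 0 < q by rewrite powR_gt0.
have q4 : q ^+ 4 = Y.
  by rewrite /q -powR_mulrn ?powR_ge0// -powRrM mulVf ?powRr1 ?ltW.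
have -> : Y `^ (3 / 4) = q ^+ 3.
  by rewrite /q -powR_mulrn ?powR_ge0// -powRrM mulrC.
have kq : 2 / k <= q.
  rewrite -(@ler_pXn2r _ 4)// ?nnegrE ?ltW// ?divr_gt0// q4 /Y; lra.
have q2X : q ^+ 4 <= 2 * X by rewrite q4 /Y; lra.
rewrite ler_pdivrMr// in kq.
have q3 : 0 < q ^+ 3 by rewrite exprn_gt0.
have : 2 * q ^+ 3 <= (q * k) * q ^+ 3 by rewrite ler_wpM2r// ltW.
have -> : q * k * q ^+ 3 = k * q ^+ 4 by ring.
have : k * q ^+ 4 <= k * (2 * X) by rewrite ler_wpM2l// ltW.
lra.
Qed.

(** * Location of the maximiser *)

Section landscape.
Context (R : realType) (xi : int -> R) (t a r L C C1 M0 M s c : R).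
Hypotheses (t0 : 0 < t) (a0 : 0 < a) (r0 : 0 < r) (L0 : 0 < L) (tE : t * a = r * L).
Hypotheses (s0 : 0 < s) (sM0 : s <= M0) (M0M : M0 <= M).
Hypothesis C1E : C * (1 + M) `^ (3 / 4) <= C1.
Hypothesis C0 : 0 < C.
Hypothesis xi1 : forall v, 1 < xi v.
Hypothesis envelope : forall v, xi v <= C * a * (1 + (`|v|%N)%:R / r) `^ (3 / 4).

Let xi0 v : 0 < xi v. Proof. exact: lt_trans (xi1 v). Qed.

Let rE : r = t * a / L.
Proof. by rewrite tE mulfK// gt_eqF. Qed.

Lemma envelope_near v : (`|v|%N)%:R <= M * r -> xi v <= C1 * a.
Proof.
move=> vM; apply: (le_trans (envelope v)); rewrite mulrAC ler_wpM2r ?(ltW a0)//.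
apply: le_trans C1E; rewrite ler_wpM2l ?(ltW C0)//.
apply: ge0_ler_powR => //; rewrite ?nnegrE.
- by rewrite addr_ge0// divr_ge0// ltW.
- by move: sM0 M0M s0; lra.
- by rewrite lerD2l ler_pdivrMr.
Qed.

Lemma Psi_le y : Psi xi t y <= xi y.
Proof. by rewrite /Psi gerBl mulr_ge0 ?divr_ge0 ?(ltW t0)// ln_ge0// ltW. Qed.

Hypothesis log_hi : ln (C1 * a) <= L.

Lemma ln_xi_near (y : nat) : y%:R <= M * r -> ln (xi y) <= L.
Proof.
move=> yM; apply: le_trans log_hi; rewrite ler_ln ?posrE//.
  exact: envelope_near.
by apply: lt_le_trans (envelope_near _); first exact: (xi0 y).
Qed.

Lemma Psi_ge (y : nat) (x : R) : y%:R <= x * r -> y%:R <= M * r -> xi y - x * a <= Psi xi t y.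
Proof.
move=> yx yM; rewrite /Psi lerD2l lerN2.
have -> : x * a = x * r / t * L by rewrite rE; field; rewrite !gt_eqF.
apply: ler_pM => //; first by rewrite divr_ge0// ltW.
- by rewrite ln_ge0// ltW.
- by rewrite ler_wpM2r ?invr_ge0 ?(ltW t0).
- exact: ln_xi_near.
Qed.

Context (alpha : R).
Hypothesis al0 : 0 < alpha.
Hypothesis log_lo : L / (2 * alpha) <= ln (s * a).
Hypothesis M0_1 : 1 <= M0.
Hypothesis M0C : (2 / (2 * alpha * C)^-1) ^+ 4 <= M0.

(** Put [X = y / r]. A site with [xi y > s a] has logarithm at least [L / (2 alpha)], so it pays a
    penalty of at least [X a / (2 alpha)]; for [X >= M0] this exceeds the envelope, which grows like
    [X ^ (3 / 4)]. *)
Lemma Psi_far (y : nat) : M0 * r <= y%:R -> Psi xi t y <= s * a.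
Proof.
move=> yM; have [le|lt] := leP (xi y) (s * a); first exact: le_trans (Psi_le y) le.
apply: (@le_trans _ _ 0); last by rewrite mulr_ge0 ?ltW.
set X := y%:R / r.
have X0 : M0 <= X by rewrite ler_pdivlMr.
rewrite subr_le0; apply: (le_trans (envelope y)).
have -> : y%:R / t = X * a / L.
  by rewrite /X rE; field; rewrite !gt_eqF.
apply: (@le_trans _ _ (X * a / L * (L / (2 * alpha)))); last first.
  rewrite ler_wpM2l//; last first.
    by apply: le_trans log_lo _; rewrite ler_ln ?posrE ?mulr_gt0// ltW.
  by rewrite divr_ge0 ?(ltW L0)// mulr_ge0 ?(ltW a0)// (le_trans _ X0)// (le_trans ler01).
have kX : (1 + X) `^ (3 / 4) <= (2 * alpha * C)^-1 * X.
  apply: powR34_sublinear; rewrite ?invr_gt0 ?mulr_gt0//.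
  - exact: le_trans M0_1 X0.
  - exact: le_trans M0C X0.
apply: (@le_trans _ _ (C * a * ((2 * alpha * C)^-1 * X))).
  by rewrite ler_wpM2l// mulr_ge0 ?ltW.
rewrite le_eqVlt; apply/orP; left; apply/eqP; field.
by rewrite !gt_eqF.
Qed.

Hypothesis high : exists y0 : nat, [/\ y0%:R <= s * r, 2 * s * a < xi y0 & xi y0 = xi (- y0%:Z)].
Hypothesis low : forall y : nat, y%:R <= c * r -> xi y <= s * a.

Lemma high_Psi : exists y0 : nat, [/\ y0%:R <= s * r, s * a < Psi xi t y0 & xi y0 = xi (- y0%:Z)].
Proof.
have [y0 [ys ya yD]] := high; exists y0; split => //.
apply: lt_le_trans (Psi_ge ys _); first by move: ya; lra.
by apply: (le_trans ys); rewrite ler_wpM2r ?(ltW r0)// (le_trans sM0 M0M).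
Qed.

(** The competitor [y0] pushes the maximum above [s a]. Sites beyond [M0 r] cannot reach this by
    [Psi_far], and sites below [c r] cannot by [low]. *)
Lemma max_Psi_loc (Z : nat) : is_max_Psi xi t Z ->
  [/\ c * r < Z%:R, Z%:R < M0 * r, s * a < Psi xi t Z, s * a < xi Z & xi Z <= C1 * a].
Proof.
move=> [ZD Zm]; have [y0 [_ yP yD]] := high_Psi.
have ZP : s * a < Psi xi t Z by exact: lt_le_trans yP (Zm _ yD).
have Zxi : s * a < xi Z by exact: lt_le_trans ZP (Psi_le Z).
have ZM : Z%:R < M0 * r.
  by rewrite ltNge; apply/negP => /Psi_far; rewrite leNgt ZP.
split => //.
  by rewrite ltNge; apply/negP => /low; rewrite leNgt Zxi.
by apply: envelope_near => /=; apply: (le_trans (ltW ZM)); rewrite ler_wpM2r// ltW.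
Qed.

Lemma max_Psi_exists : exists Z, is_max_Psi xi t Z.
Proof.
have [y0 [ys yP yD]] := high_Psi.
pose n := (Num.bound (M0 * r)).
have nM : M0 * r < n%:R.
  by have := archi_boundP (ltW (mulr_gt0 (lt_le_trans ltr01 M0_1) r0)).
have y0n : (y0 < n)%N.
  rewrite -(ltr_nat R); apply: le_lt_trans nM.
  by apply: (le_trans ys); rewrite ler_wpM2r// ltW.
pose D := [pred i : 'I_n | xi (i : nat) == xi (- (i : nat)%:Z)].
have D0 : D (Ordinal y0n) by rewrite /= yD.
have := @arg_maxP _ _ _ (Ordinal y0n) D (fun i : 'I_n => Psi xi t i) D0.
case => Z /eqP ZD Zm; exists (Z : nat); split => // y /eqP yD'.
have [yn|ny] := ltnP y n; first exact: (Zm (Ordinal yn)).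
apply: (le_trans (Psi_far _)).
  by apply: (le_trans (ltW nM)); rewrite ler_nat.
by apply: (le_trans (ltW yP)); exact: (Zm (Ordinal y0n)).
Qed.

End landscape.

Lemma near_path_site (v : int) (Z n : nat) : `|v| + `|Z%:Z - v| <= n%:Z -> v != Z ->
  (2 * `|v| <= n + Z)%N /\ (`|v|%N = Z -> (3 * Z <= n)%N).
Proof. by lia. Qed.

Section deep_and_tail.
Context (R : realType) (xi : int -> R) (t a r L C1 M0 M s c g g2 ep : R) (Z : nat).
Hypotheses (t0 : 0 < t) (a0 : 0 < a) (r0 : 0 < r) (L0 : 0 < L) (tE : t * a = r * L).
Hypotheses (s0 : 0 < s) (c0 : 0 < c) (g0 : 0 < g) (g20 : 0 < g2) (ep0 : 0 < ep).
Hypotheses (gs : 2 * g <= s) (g2g : g2 <= g) (eps2 : 2 * ep <= s) (g2c : g2 < 2 * c).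
Hypothesis M0g2M : M0 + g2 <= M.
Hypothesis xi1 : forall v, 1 < xi v.
Hypothesis near_le : forall v, (`|v|%N)%:R <= M * r -> xi v <= C1 * a.
Local Notation lam := (xi Z).
Hypothesis Zmax : is_max_Psi xi t Z.
Hypotheses (cZ : c * r < Z%:R) (ZM0 : Z%:R < M0 * r) (ZPsi : s * a < Psi xi t Z)
  (Zs : s * a < lam).
Local Notation excl v := (xi v != xi (- v)).
Hypothesis excl_small : forall v : int, (`|v|%N)%:R <= M * r -> excl v -> xi v <= ep * a.
Hypothesis gap : forall y z : nat, y != z -> y%:R <= M * r -> z%:R <= M * r ->
  s / 2 * a <= Psi xi t y -> s / 2 * a <= Psi xi t z ->
  g * a < `|Psi xi t y - Psi xi t z|.
Let C2 := C1 + M.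
Hypothesis log_hi : ln (C2 * a) <= L.
Hypothesis sa2 : 2 <= s * a.
Hypothesis L_M : 2 * M <= s * L.
Hypothesis L_M0 : 2 * M0 * ln (C2 / s) <= g * L.

Let rE : r = t * a / L.
Proof. by rewrite tE mulfK// gt_eqF. Qed.

Let xi0 v : 0 < xi v. Proof. exact: lt_trans (xi1 v). Qed.

Let ZM : Z%:R <= M * r.
Proof.
apply: (le_trans (ltW ZM0)); rewrite ler_wpM2r ?(ltW r0)//.
by move: M0g2M g20; lra.
Qed.

Let M_gt0 : 0 < M.
Proof. by rewrite -(pmulr_lgt0 _ r0) (lt_le_trans _ ZM)// (lt_trans _ cZ)// mulr_gt0. Qed.

Let lamC2 : lam <= C2 * a.
Proof.
apply: (le_trans (@near_le Z ZM)); rewrite ler_wpM2r ?(ltW a0)// /C2.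
by move: M_gt0; lra.
Qed.

(* If [xi y] exceeded [m], then [Psi y] would lie within the gap of the maximum,
   because [m - x / t * ln m] increases in [m] and decreases in [x]. *)
Lemma other_site_le (y : nat) (x m : R) : y != Z -> y%:R <= x -> x <= M * r ->
  xi y = xi (- y%:Z) -> m <= C2 * a -> s / 2 * a <= m ->
  lam - Z%:R / t * ln lam - g * a <= m - x / t * ln m -> xi y <= m.
Proof.
move=> yZ yx xM yD mC sm hm; rewrite leNgt; apply/negP => my.
have m0 : 0 < m by apply: lt_le_trans sm; rewrite mulr_gt0// divr_gt0.
have m1 : x / t <= m.
  apply: le_trans sm; rewrite ler_pdivrMr//.
  apply: (le_trans xM); rewrite rE.
  have -> : M * (t * a / L) = (M / L) * (t * a) by ring.
  have -> : s / 2 * a * t = s / 2 * (t * a) by ring.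
  rewrite ler_wpM2r ?mulr_ge0 ?(ltW a0) ?(ltW t0)// ler_pdivrMr//.
  by move: L_M; lra.
have yt0 : 0 <= y%:R / t by rewrite divr_ge0// ltW.
have yxt : y%:R / t <= x / t by rewrite ler_wpM2r ?invr_ge0 ?(ltW t0).
have lm0 : 0 <= ln m by apply: ln_ge0; move: sm sa2; lra.
have Psiy : m - x / t * ln m <= Psi xi t y.
  apply: le_trans (sub_ln_mono _ m0 _ (ltW my)) => //; last exact: le_trans m1.
  by rewrite lerD2l lerN2 ler_wpM2r.
have ZPy := Zmax.2 _ yD.
have hZ : Psi xi t Z - g * a <= Psi xi t y by apply: le_trans Psiy.
have yM : y%:R <= M * r by exact: le_trans xM.
have ga : 2 * g * a <= s * a by rewrite ler_wpM2r ?(ltW a0).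
have ZPs : s / 2 * a <= Psi xi t Z.
  by apply: le_trans (ltW ZPsi); rewrite ler_wpM2r ?(ltW a0)// ler_pdivrMr// ler_peMr ?ler1n ?ltW.
have [yPs|yPs] := leP (s / 2 * a) (Psi xi t y).
  have := gap yZ yM ZM yPs ZPs; rewrite distrC ger0_norm ?subr_ge0// => h.
  by move: h hZ; lra.
by move: yPs hZ ZPsi ga; lra.
Qed.

(** An exclusive site has value at most [ep a], far below [lam]. For the other sites the gap [g a]
    in [Psi] is split: one half pays for the distance [g2 / 2 * r] beyond [Z], the other half
    remains as depth. *)
Lemma site_deep (v : int) : (`|v|%N)%:R <= Z%:R + g2 / 2 * r -> `|v|%N != Z ->
  xi v <= lam - g / 2 * a.
Proof.
move=> vZ vnZ.
have g2r : 0 < g2 / 2 * r by rewrite mulr_gt0// divr_gt0.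
have ZgM : Z%:R + g2 / 2 * r <= M * r.
  have : (M0 + g2) * r <= M * r by rewrite ler_wpM2r ?(ltW r0).
  by move: ZM0 g2r; lra.
have vM := le_trans vZ ZgM.
have gsa : 2 * g * a <= s * a by rewrite ler_wpM2r ?(ltW a0).
have [vx|] := boolP (excl v).
  have : 2 * ep * a <= s * a by rewrite ler_wpM2r ?(ltW a0).
  by move: (excl_small vM vx) Zs gsa sa2; lra.
rewrite negbK => /eqP vD.
have vE : xi v = xi (`|v|%N) by case: (intP v) vD => [|n|n] //= ->; rewrite ?opprK.
have vD' : xi (`|v|%N) = xi (- (`|v|%N)%:Z) by case: (intP v) vD => [|n|n] //= ->; rewrite ?opprK.
rewrite vE; apply: (@other_site_le _ (Z%:R + g2 / 2 * r)) => //.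
- by apply: le_trans lamC2; rewrite gerBl mulr_ge0 ?(ltW a0)// divr_ge0// ltW.
- by move: Zs gsa sa2; lra.
set m := lam - g / 2 * a; have mlam : m <= lam by rewrite gerBl mulr_ge0 ?(ltW a0)// divr_ge0// ltW.
have m1 : 1 <= m by rewrite /m; move: Zs gsa sa2; lra.
have lmlam : ln m <= ln lam by rewrite ler_ln ?posrE// (lt_le_trans _ m1).
have lmL : ln m <= L.
  apply: (le_trans lmlam); apply: le_trans log_hi.
  by rewrite ler_ln ?posrE// (lt_le_trans (xi0 Z)).
have h1 : Z%:R / t * ln m <= Z%:R / t * ln lam by rewrite ler_wpM2l// divr_ge0// ltW.
have h2 : g2 / 2 * r / t * ln m <= g / 2 * a.
  apply: (@le_trans _ _ (g2 / 2 * r / t * L)).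
    by rewrite ler_wpM2l// divr_ge0// ltW.
  have -> : g2 / 2 * r / t * L = g2 / 2 * a by rewrite rE; field; rewrite !gt_eqF.
  by rewrite ler_wpM2r ?(ltW a0)// ler_wpM2r.
have mE : m = lam - g / 2 * a by [].
have -> : (Z%:R + g2 / 2 * r) / t * ln m = Z%:R / t * ln m + g2 / 2 * r / t * ln m by ring.
by move: h1 h2 mE; lra.
Qed.

Let L' := ln (C2 * a).

(** A site beyond [Z] may exceed [lam], but only by what its larger penalty in [Psi] permits: at
    most [L' / t] per unit of distance, reduced by half the gap. *)
Definition overshoot (n : nat) : R := Num.max 0 ((n%:R - Z%:R) * L' / t - g / 2 * a).

Let C2_gt0 : 0 < C2.
Proof. by rewrite -(pmulr_lgt0 _ a0) (lt_le_trans (xi0 Z)). Qed.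

Lemma site_overshoot (n : nat) (v : int) : (Z <= n)%N -> n%:R <= M * r -> (`|v| <= n)%N ->
  xi v <= lam + overshoot n.
Proof.
move=> Zn nM vn; have o0 : 0 <= overshoot n by rewrite le_max lexx.
have vM : (`|v|%N)%:R <= M * r by apply: le_trans nM; rewrite ler_nat.
have [vx|] := boolP (excl v).
  have : 2 * ep * a <= s * a by rewrite ler_wpM2r ?(ltW a0).
  have := mulr_gt0 s0 a0; have := excl_small vM vx; move: Zs o0; lra.
rewrite negbK => /eqP vD.
have vE : xi v = xi (`|v|%N) by case: (intP v) vD => [|k|k] //= ->; rewrite ?opprK.
have vD' : xi (`|v|%N) = xi (- (`|v|%N)%:Z) by case: (intP v) vD => [|k|k] //= ->; rewrite ?opprK.
have [vZ|vZ] := eqVneq `|v|%N Z; first by rewrite vE vZ lerDl.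
have nZ0 : 0 <= n%:R - Z%:R :> R by rewrite subr_ge0 ler_nat.
set m := lam + overshoot n.
have lamm : lam <= m by rewrite lerDl.
have m0 : 0 < m by exact: lt_le_trans (xi0 Z) _.
have mC : m <= C2 * a.
  rewrite /m /C2 mulrDl; apply: lerD; first exact: (@near_le Z ZM).
  rewrite ge_max mulr_ge0 ?(ltW a0) ?(ltW M_gt0)//=.
  apply: (@le_trans _ _ ((n%:R - Z%:R) * L' / t)).
    by rewrite gerBl mulr_ge0 ?(ltW a0)// divr_ge0// ltW.
  have -> : M * a = M * r * L / t by rewrite rE; field; rewrite !gt_eqF.
  rewrite ler_wpM2r ?invr_ge0 ?(ltW t0)//.
  apply: (@le_trans _ _ ((n%:R - Z%:R) * L)); first by rewrite ler_wpM2l.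
  by rewrite ler_wpM2r ?(ltW L0)//; apply: le_trans nM; rewrite gerBl.
rewrite vE; apply: (@other_site_le _ n%:R) => //; first by rewrite ler_nat.
  by have := mulr_gt0 s0 a0; move: Zs lamm; lra.
have mC2 : ln m <= L' by rewrite ler_ln ?posrE ?mulr_gt0.
have h1 : (n%:R - Z%:R) / t * ln m <= (n%:R - Z%:R) * L' / t.
  by rewrite [leRHS]mulrAC ler_wpM2l// divr_ge0// ltW.
have h2 : Z%:R / t * (ln m - ln lam) <= g / 2 * a.
  have hl : ln m - ln lam <= ln (C2 / s).
    have -> : C2 / s = (C2 * a) / (s * a) by field; rewrite !gt_eqF.
    rewrite [leRHS]ln_div ?posrE ?mulr_gt0//; apply: lerB => //.
    by rewrite ler_ln ?posrE ?mulr_gt0// ltW.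
  have l0 : 0 <= ln m - ln lam by rewrite subr_ge0 ler_ln ?posrE.
  apply: (@le_trans _ _ (M0 * r / t * ln (C2 / s))).
    apply: ler_pM => //; first by rewrite divr_ge0// ltW.
    by rewrite ler_wpM2r ?invr_ge0 ?ltW.
  have -> : M0 * r / t * ln (C2 / s) = M0 * ln (C2 / s) / L * a.
    by rewrite rE; field; rewrite !gt_eqF.
  by rewrite ler_wpM2r ?(ltW a0)// ler_pdivrMr//; move: L_M0; lra.
have h3 : (n%:R - Z%:R) * L' / t - g / 2 * a <= overshoot n by rewrite le_max lexx orbT.
have -> : n%:R / t * ln m = (n%:R - Z%:R) / t * ln m + Z%:R / t * (ln m - ln lam) + Z%:R / t * ln lam.
  by ring.
have mE : m = lam + overshoot n by [].
by move: h1 h2 h3 mE; lra.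
Qed.

Definition radius : nat := (Z + Num.truncn (g2 * r))%N.

Lemma radius_lt (n : nat) : (radius < n)%N -> Z%:R + g2 * r < n%:R.
Proof.
move=> h; have /ltW/truncn_itv/andP[_ h2] : 0 < g2 * r by rewrite mulr_gt0.
have : ((Z + (Num.truncn (g2 * r)).+1)%N)%:R <= n%:R :> R.
  by rewrite ler_nat addnS.
by rewrite natrD; lra.
Qed.

Lemma radius_le : radius%:R <= Z%:R + g2 * r.
Proof.
have /ltW/truncn_itv/andP[h1 _] : 0 < g2 * r by rewrite mulr_gt0.
by rewrite natrD lerD2l.
Qed.

(** Meeting [- Z] on the way to [Z] takes length at least [3 Z], while [g2 < 2 c] and [c r < Z] keep
    the radius below that. *)
Lemma deep_site (v : int) : `|v| + `|Z%:Z - v| <= radius%:Z -> v != Z ->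
  (`|v|%N)%:R <= Z%:R + g2 / 2 * r /\ `|v|%N != Z.
Proof.
move=> vr vZ; have [h2 h3] := near_path_site vr vZ.
have h2R : 2 * (`|v|%N)%:R <= radius%:R + Z%:R :> R by rewrite -natrM -natrD ler_nat.
split; first by move: radius_le h2R; lra.
apply/negP => /eqP /h3 {}h3.
have : 3 * Z%:R <= radius%:R :> R by rewrite -natrM ler_nat.
have : g2 * r < 2 * c * r by rewrite ltr_pM2r.
by move: radius_le cZ; lra.
Qed.

Lemma deep_potential : deep Z radius (g / 2 * a) (fun v => xi v - lam).
Proof.
split=> [|v vr vZ]; first by rewrite subrr.
have [vr' vZ'] := deep_site vr vZ.
by move: (site_deep vr' vZ'); lra.
Qed.

Lemma deep_potential_opp : deep Z radius (g / 2 * a) (fun v => xi (- v) - lam).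
Proof.
split=> [|v vr vZ]; first by rewrite -Zmax.1 subrr.
have [vr' vZ'] := deep_site vr vZ.
rewrite -abszN in vr' vZ'.
by move: (site_deep vr' vZ'); lra.
Qed.

End deep_and_tail.

Section tails.
Context (R : realType).
Implicit Types (c : int -> R).

(** The tilt [m + n / t], with [n] the length, minimises the bound of [holds_le_exp]. *)
Lemma wt_le c (m t : R) (s : seq bool) : 0 < t -> 0 <= m -> (0 < size s)%N ->
  (forall v, (`|v| <= size s)%N -> c v <= m) ->
  (wt c s t <= (expR (m * t + (size s)%:R * (1 + ln t - ln (size s)%:R)))%:E)%E.
Proof.
move=> t0 m0 n0 cm; set n := size s.
have nR0 : 0 < n%:R :> R by rewrite ltr0n.
have th : m < m + n%:R / t by rewrite ltrDl divr_gt0.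
have th0 : 0 <= m + n%:R / t by exact: ltW (le_lt_trans m0 th).
have al : all (fun x => x <= m) [seq c v | v <- trail 0 s].
  apply/allP => x /mapP[v vs ->]; apply: cm.
  by have := trail_dist vs; lia.
have sz : size [seq c v | v <- trail 0 s] = n by rewrite size_map size_trail.
have := holds_le_exp t th0 th al; rewrite sz => /le_trans; apply.
rewrite lee_fin le_eqVlt; apply/orP; left; apply/eqP.
have -> : (m + n%:R / t - m)^-1 = t / n%:R by rewrite addrC addKr invf_div.
rewrite mulrDl divfK ?gt_eqF//.
have -> : m * t + n%:R * (1 + ln t - ln n%:R) = m * t + n%:R + n%:R * ln (t / n%:R).
  by rewrite ln_div ?posrE//; ring.
by rewrite [in RHS]expRD expRM_natl lnK// posrE divr_gt0.
Qed.

Lemma wt_direct_ge c (lam t : R) (Z : nat) : 0 < lam -> (forall v, - lam <= c v) ->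
  Z%:R <= t * lam ->
  ((expR (- (Z%:R * (1 + ln lam))))%:E <= wt c (nseq Z true) t)%E.
Proof.
move=> l0 cl Zt.
have sz : size [seq c v | v <- trail 0 (nseq Z true)] = Z by rewrite size_map size_trail size_nseq.
have al : all (fun x => - lam <= x) [seq c v | v <- trail 0 (nseq Z true)].
  by apply/allP => x /mapP[v _ ->].
have := @holds_ge _ _ lam t l0 al; rewrite sz ler_pdivrMr// => /(_ Zt); apply: le_trans.
rewrite lee_fin le_eqVlt; apply/orP; left; apply/eqP.
rewrite -mulrN expRM_natl opprD expRD; congr ((_ * _) ^+ _).
by rewrite expRN lnK.
Qed.

(** The 3 is the 1 of [wt_le] plus a 2 that pays for [4^-1 ^+ n], which is at least [exp (- 2 n)].
    The last summand divides by the lower bound for the straight path. *)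
Lemma negligible_tailP c (lam t eps : R) (Z N : nat) : 0 < t -> 0 < eps ->
  0 < lam -> (forall v, - lam <= c v) -> Z%:R <= t * lam ->
  (forall n, (N < n)%N -> exists m, [/\ 0 <= m, forall v, (`|v| <= n)%N -> c v <= m &
     m * t + n%:R * (3 + ln t - ln n%:R) + Z%:R * (1 + ln lam) <= ln eps]) ->
  negligible_tail Z N t eps c.
Proof.
move=> t0 e0 l0 cl Zt H; exists (expR (- (Z%:R * (1 + ln lam)))).
split; [exact: expR_gt0|exact: wt_direct_ge|move=> s Ns].
have [m [m0 cm mE]] := H _ Ns.
apply: (le_trans (wt_le t0 m0 (leq_trans (ltn0Sn _) Ns) cm)).
set n := size s in mE *.
have h4 : expR (- (2 * n%:R)) <= 4^-1 ^+ n :> R.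
  rewrite -mulNr mulrC expRM_natl lerXn2r ?nnegrE ?expR_ge0//.
  rewrite expRN lef_pV2 ?posrE ?expR_gt0//.
  have -> : 2 = 1 + 1 :> R by [].
  rewrite expRD; have := @expR_ge1Dx R 1; nra.
rewrite lee_fin; apply: (@le_trans _ _ (expR (ln eps) * expR (- (Z%:R * (1 + ln lam))) * expR (- (2 * n%:R)))).
  by rewrite -!expRD ler_expR; move: mE; lra.
by rewrite lnK ?posrE// ler_wpM2l// mulr_ge0 ?expR_ge0// ltW.
Qed.

End tails.

(** Here [l], [la], [lC], [lc], [le], [lam] stand for the logarithms of [L], [a], [C2], [c], [eps],
    [xi Z], and [o] for [ln t - ln n]. With an overshoot the multiples of [la] cancel exactly, and
    the half gap [g / 2 * (r * L)] beats the remaining terms. Without one, [(n - Z) * la] is left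
    over and does so. *)
Lemma tail_exponent_near (R : realType) (n Z M r l la lC lc le g2r o mt lam L g : R) :
  Z <= n -> n <= M * r -> g2r <= n - Z -> 1 <= r -> le <= 0 -> 0 <= M -> 0 <= Z ->
  0 <= lC -> lc <= 0 -> 0 <= l -> 0 <= la -> o <= l - la - lc -> lam <= lC + la ->
  mt <= Num.max 0 ((n - Z) * (lC + la) - g / 2 * (r * L)) ->
  M * (4 + l - lc + lC) - le <= g2r / r * la ->
  M * (4 + l - lc + lC) - le <= g / 2 * L ->
  mt + n * (3 + o) + Z * (1 + lam) <= le.
Proof.
move=> Zn nM gZ r1 le0 M0 Z0 lC0 lc0 l0 la0 ho hlam hmt num0 num1.
have r0 : 0 < r by lra.
have n0 : 0 <= n by lra.
set E0 := 4 + l - lc + lC in num0 num1.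
have E00 : 0 <= E0 by rewrite /E0; lra.
have h1 : n * (3 + o) <= n * (3 + l - la - lc) by rewrite ler_wpM2l//; lra.
have h2 : Z * (1 + lam) <= Z * (1 + lC + la) by rewrite ler_wpM2l//; lra.
have h3 : n * E0 <= M * r * E0 by rewrite ler_wpM2r.
have h4 : Z * (1 + lC) <= n * (1 + lC) by rewrite ler_wpM2r//; lra.
have h5 : r * le <= le by nra.
move: hmt; rewrite le_max => /orP[hmt|hmt].
  have h6 : g2r * la <= (n - Z) * la by rewrite ler_wpM2r.
  have h7 : r * (M * E0 - le) <= g2r * la.
    have -> : g2r * la = r * (g2r / r * la) by field; rewrite gt_eqF.
    by rewrite ler_wpM2l// ltW.
  by move: h3; rewrite /E0 in h7 *; nra.
have h7 : r * (M * E0 - le) <= r * (g / 2 * L) by rewrite ler_wpM2l// ltW.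
have h8 : (n - Z) * lC <= n * lC by rewrite ler_wpM2r//; lra.
by move: h3; rewrite /E0 in h7 *; nra.
Qed.

(** The envelope allows a gain of at most [k * n * L] with a small [k]. As [2 Z <= n], half of the
    jump cost [n * la] survives the comparison with the straight path. *)
Lemma tail_exponent_far (R : realType) (n Z l la lC lc le o mt lam k L : R) :
  2 * Z <= n -> 1 <= n -> le <= 0 -> 0 <= Z ->
  0 <= lC -> lc <= 0 -> 0 <= l -> 0 <= la -> o <= l - la - lc -> lam <= lC + la ->
  mt <= k * (n * L) ->
  k * L + (4 + l - lc + lC) - le <= la / 2 ->
  mt + n * (3 + o) + Z * (1 + lam) <= le.
Proof.
move=> Zn n1 le0 Z0 lC0 lc0 l0 la0 ho hlam hmt num.
have h1 : n * (3 + o) <= n * (3 + l - la - lc) by rewrite ler_wpM2l//; lra.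
have h2 : Z * (1 + lam) <= Z * (1 + lC + la) by rewrite ler_wpM2l//; lra.
have h4 : Z * (1 + lC) <= n * (1 + lC) by rewrite ler_wpM2r//; lra.
have h5 : Z * la <= n * (la / 2) by nra.
have h6 : n * le <= le by nra.
have h7 : n * (k * L + (4 + l - lc + lC) - le) <= n * (la / 2) by rewrite ler_wpM2l//; lra.
nra.
Qed.

Section tail_control.
Context (R : realType) (xi : int -> R) (t a r L C C1 M0 M c g g2 k eps : R) (Z : nat).
Hypotheses (t0 : 0 < t) (a0 : 0 < a) (r1 : 1 <= r) (L1 : 1 <= L) (tE : t * a = r * L).
Hypothesis la0 : 0 <= ln a.
Hypotheses (c0 : 0 < c) (c1 : c <= 1) (g20 : 0 < g2) (k0 : 0 < k).
Hypotheses (eps0 : 0 < eps) (eps1 : eps <= 1) (C0 : 0 < C).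
Hypotheses (M0M : 2 * M0 <= M) (M01 : 1 <= M0).
Hypothesis kM : (2 / (k / C)) ^+ 4 <= M.
Hypothesis xi1 : forall v, 1 < xi v.
Hypothesis envelope : forall v, xi v <= C * a * (1 + (`|v|%N)%:R / r) `^ (3 / 4).
Local Notation lam := (xi Z).
Hypotheses (cZ : c * r < Z%:R) (ZM0 : Z%:R < M0 * r).
Let C2 := C1 + M.
Hypothesis C21 : 1 <= C2.
Hypothesis lamC2 : lam <= C2 * a.
Local Notation N := (radius r g2 Z).
Local Notation overshoot := (overshoot t a C1 M g Z).
Hypothesis site_over : forall (n : nat) (v : int), (Z <= n)%N -> n%:R <= M * r ->
  (`|v| <= n)%N -> xi v <= lam + overshoot n.
Hypothesis tZ : M0 * r <= t * lam.
Let E0 := 4 + ln L - ln c + ln C2.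
Hypothesis num0 : M * E0 - ln eps <= g2 * ln a.
Hypothesis num1 : M * E0 - ln eps <= g / 2 * L.
Hypothesis num2 : k * L + E0 - ln eps <= ln a / 2.

Lemma log_quotient_le (n : nat) : c * r <= n%:R -> ln t - ln n%:R <= ln L - ln a - ln c.
Proof.
move=> cn; have cr0 : 0 < c * r by rewrite mulr_gt0// (lt_le_trans ltr01).
have : ln (c * r) <= ln n%:R :> R by rewrite ler_ln ?posrE// (lt_le_trans cr0).
rewrite lnM ?posrE// ?(lt_le_trans ltr01)//.
have := congr1 (@ln R) tE; rewrite !lnM ?posrE// ?(lt_le_trans ltr01)//; lra.
Qed.

(** The function [xi'] stands for the potential or its reflection. Lengths up to [M r] are treated
    through the overshoot, longer ones through the envelope. *)
Lemma tail_control (xi' : int -> R) : (forall v, exists w, xi' v = xi w /\ `|w|%N = `|v|%N) ->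
  negligible_tail Z N t eps (fun v => xi' v - lam).
Proof.
move=> xiE.
have r0 : 0 < r by rewrite (lt_le_trans ltr01).
have lam1 : 1 < lam by exact: xi1.
have lam0 : 0 < lam by exact: lt_trans lam1.
have ZR0 : 0 <= Z%:R :> R by [].
have C20 : 0 < C2 by exact: lt_le_trans C21.
have lamE : ln lam <= ln C2 + ln a.
  by rewrite -lnM ?posrE// ler_ln ?posrE// mulr_gt0.
have lC0 : 0 <= ln C2 by rewrite ln_ge0.
have lc0 : ln c <= 0 by rewrite ln_le0.
have l0 : 0 <= ln L by rewrite ln_ge0.
have le0 : ln eps <= 0 by rewrite ln_le0.
apply: (negligible_tailP t0 eps0 lam0).
- by move=> v; have [w [-> _]] := xiE v; rewrite lerBrDl subrr ltW// (lt_trans ltr01).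
- exact: le_trans (ltW ZM0) tZ.
move=> n Nn; have nN := radius_lt r0 g20 Nn.
have g2r0 : 0 < g2 * r by rewrite mulr_gt0.
have ZnR : Z%:R <= n%:R :> R by move: nN; lra.
have Zn : (Z <= n)%N by rewrite -(ler_nat R).
have ho := log_quotient_le (le_trans (ltW cZ) ZnR).
have [nM|nM] := leP n%:R (M * r).
  exists (overshoot n); split; first by rewrite le_max lexx.
    move=> v vn; have [w [-> wv]] := xiE v; rewrite -wv in vn.
    by move: (site_over Zn nM vn); lra.
  have -> : 3 + ln t - ln n%:R = 3 + (ln t - ln n%:R) by ring.
  apply: (@tail_exponent_near _ _ _ M r (ln L) (ln a) (ln C2) (ln c) _ (g2 * r) _ _ _ L g) => //.
  - by move: nN; lra.
  - by move: M01 M0M; lra.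
  - rewrite /overshoot maxr_pMl ?(ltW t0)// mul0r.
    rewrite lnM ?posrE// mulrBl divfK ?gt_eqF//.
    by rewrite -tE; have -> : g / 2 * a * t = g / 2 * (t * a) by ring.
  - by rewrite mulfK ?gt_eqF.
have nr : r <= n%:R.
  by apply: le_trans (ltW nM); rewrite ler_peMl ?ltW//; move: M01 M0M; lra.
have X1 : 1 <= n%:R / r by rewrite ler_pdivlMr// mul1r.
have kX : (1 + n%:R / r) `^ (3 / 4) <= k / C * (n%:R / r).
  apply: powR34_sublinear; rewrite ?divr_gt0//.
  by apply: (le_trans kM); rewrite ler_pdivlMr// ltW.
exists (C * a * (1 + n%:R / r) `^ (3 / 4)); split.
- by rewrite !mulr_ge0 ?powR_ge0// ltW.
- move=> v vn; have [w [-> wv]] := xiE v; rewrite -wv in vn.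
  apply: (@le_trans _ _ (xi w)); first by rewrite gerBl ltW.
  apply: (le_trans (envelope w)); rewrite ler_wpM2l ?mulr_ge0 ?(ltW a0) ?(ltW C0)//.
  apply: ge0_ler_powR; rewrite ?nnegrE ?addr_ge0 ?divr_ge0 ?(ltW r0)//.
  by rewrite lerD2l ler_wpM2r ?invr_ge0 ?(ltW r0)// ler_nat.
have -> : 3 + ln t - ln n%:R = 3 + (ln t - ln n%:R) by ring.
apply: (@tail_exponent_far _ _ _ (ln L) (ln a) (ln C2) (ln c) _ _ _ _ k L) => //.
- by move: ZM0 nM; have := ler_wpM2r (ltW r0) M0M; lra.
- exact: le_trans r1 nr.
apply: (@le_trans _ _ (C * a * (k / C * (n%:R / r)) * t)).
  by rewrite ler_wpM2r ?(ltW t0)// ler_wpM2l// mulr_ge0 ?ltW.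
have -> : C * a * (k / C * (n%:R / r)) * t = k * n%:R / r * (t * a).
  by field; rewrite !gt_eqF.
by rewrite tE le_eqVlt; apply/orP; left; apply/eqP; field; rewrite gt_eqF.
Qed.

End tail_control.

Lemma expRN_le1B (R : realType) (x : R) : 0 <= x -> x <= 1 / 2 -> expR (- (x + 2 * x ^+ 2)) <= 1 - x.
Proof.
move=> x0 x1; set y := x + 2 * x ^+ 2.
have := expR_ge1Dx y; have y0 := expR_gt0 y.
rewrite expRN => h; rewrite -(ler_pM2l y0) mulfV ?gt_eqF//.
have : (1 + y) * (1 - x) <= expR y * (1 - x) by rewrite ler_wpM2r//; lra.
apply: le_trans; rewrite /y; nra.
Qed.

(** With [x = u / lam] and [x' = u' / lam], use [1 - x' >= exp (- x' - 2 x' ^ 2)], valid up to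
    [x' = 1 / 2], and [1 - x <= exp (- x)]. The exponents add up to at least [- (b + 2 q)]. *)
Lemma prod_inv_ratio (R : realType) (l : seq int) (lam b q : R) (u u' : int -> R) : 0 < lam ->
  (forall v, v \in l -> 0 <= u v <= lam / 2) -> (forall v, v \in l -> 0 <= u' v <= lam / 2) ->
  \sum_(v <- l) (u' v - u v) <= b * lam -> \sum_(v <- l) u' v ^+ 2 <= q * lam ^+ 2 ->
  (1 - (b + 2 * q)) * \prod_(v <- l) (lam - u' v)^-1 <= \prod_(v <- l) (lam - u v)^-1.
Proof.
move=> l0 hu hu' hb hq.
pose e v := - ((u' v - u v) / lam + 2 * (u' v / lam) ^+ 2).
have pos v : 0 <= u v <= lam / 2 -> 0 < lam - u v by move=> /andP[? ?]; lra.
have pos' v : 0 <= u' v <= lam / 2 -> 0 < lam - u' v by move=> /andP[? ?]; lra.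
apply: (@le_trans _ _ (\prod_(v <- l) (expR (e v) * (lam - u' v)^-1))); last first.
  rewrite big_seq [leRHS]big_seq; apply: ler_prod => v vl.
  have p := pos _ (hu _ vl); have p' := pos' _ (hu' _ vl).
  rewrite mulr_ge0 ?expR_ge0 ?invr_ge0 ?(ltW p')//= ler_pdivrMr// ler_pdivlMl//.
  have -> : e v = - (u' v / lam + 2 * (u' v / lam) ^+ 2) + u v / lam.
    by rewrite /e mulrBl; ring.
  have /andP[u0 u1] := hu _ vl; have /andP[u0' u1'] := hu' _ vl.
  have h1 : expR (- (u' v / lam + 2 * (u' v / lam) ^+ 2)) <= 1 - u' v / lam.
    by apply: expRN_le1B; rewrite ?divr_ge0 ?(ltW l0)// ler_pdivrMr//; lra.
  have h2 : (1 - u v / lam) * expR (u v / lam) <= 1.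
    rewrite -ler_pdivlMr ?expR_gt0// mul1r -expRN.
    by apply: le_trans (expR_ge1Dx _).
  have -> : lam - u v = lam * (1 - u v / lam) by field; rewrite gt_eqF.
  have -> : lam - u' v = lam * (1 - u' v / lam) by field; rewrite gt_eqF.
  rewrite -mulrA ler_wpM2l ?(ltW l0)// expRD mulrCA -[leRHS]mulr1.
  apply: ler_pM => //; rewrite ?expR_ge0// mulr_ge0 ?expR_ge0// subr_ge0 ler_pdivrMr//; lra.
rewrite big_split/= ler_wpM2r//.
  by rewrite big_seq; apply: prodr_ge0 => v vl; rewrite invr_ge0 ltW// pos' ?hu'.
rewrite -expR_sum; apply: le_trans (expR_ge1Dx _).
rewrite lerD2l /e sumrN lerN2 big_split/= -mulr_suml -mulr_sumr.
apply: lerD; first by rewrite ler_pdivrMr.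
rewrite ler_wpM2l//; under eq_bigr do rewrite exprMn.
by rewrite -mulr_suml exprVn ler_pdivrMr// exprn_gt0.
Qed.

Lemma geom_growth_le (R : realType) (n : nat) (x e : R) : 0 <= x -> n%:R * x <= e / 2 ->
  0 <= e -> e <= 1 -> x < 1 -> (1 - x)^-1 ^+ n <= 1 + e.
Proof.
move=> x0 nx e0 e1 x1.
have bern : 1 - n%:R * x <= (1 - x) ^+ n.
  elim: (n) => [|m IH]; first by rewrite mul0r subr0 expr0.
  rewrite exprS; have : (1 - x) * (1 - m%:R * x) <= (1 - x) * (1 - x) ^+ m.
    by rewrite ler_wpM2l// subr_ge0 ltW.
  have : 0 <= m%:R :> R by [].
  by rewrite -natr1; nra.
have p : 0 < 1 - n%:R * x by lra.
rewrite exprVn; apply: (@le_trans _ _ (1 - n%:R * x)^-1).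
  by rewrite lef_pV2 ?posrE// exprn_gt0// subr_gt0.
rewrite -[leLHS]mul1r ler_pdivrMr//; nra.
Qed.

Section exclusive_sites.
Context (R : realType) (xi : int -> R).
Local Notation excl v := (xi v != xi (- v)).

Lemma abszP (v : int) : v = (`|v|%N)%:Z \/ v = - (`|v|%N)%:Z.
Proof. by lia. Qed.

Lemma absz_dist_le (v : int) (n : nat) : `|(`|v|%N)%:Z - n%:Z| <= `|v - n%:Z|.
Proof. by lia. Qed.

Lemma excl_absz (v : int) : excl v -> xi (`|v|%N)%:Z != xi (- (`|v|%N)%:Z).
Proof. by case: (abszP v) => {1 2}->; rewrite ?opprK// eq_sym. Qed.

Lemma excl_list_sum (f : int -> R) (n : nat) :
  \sum_(v <- excl_list (fun v => excl v) n) f v =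
  \sum_(1 <= y < n | xi y%:Z != xi (- y%:Z)) f y%:Z.
Proof.
rewrite /excl_list big_filter big_map -{1}[n]subn0 -/(index_iota 0 n).
case: n => [|n]; first by rewrite !big_geq.
by rewrite big_mkcond big_ltn//= oppr0 eqxx add0r -big_mkcond.
Qed.

Lemma excl_list_lt (v : int) (n : nat) : v \in excl_list (fun v => excl v) n -> (`|v| < n)%N.
Proof. by rewrite mem_excl_list => /and3P[_ v0 vn]; lia. Qed.

Lemma excl_list_sumS (f : int -> R) (n : nat) : (forall v, 0 <= f v) ->
  \sum_(v <- excl_list (fun v => excl v) n) f v <= \sum_(v <- excl_list (fun v => excl v) n.+1) f v.
Proof.
move=> f0; rewrite /excl_list -[n.+1]addn1 iotaD map_cat filter_cat big_cat/= lerDl.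
exact: sumr_ge0.
Qed.

End exclusive_sites.

Section final_ratio.
Context (R : realType).

(* The constants are chosen in the order [C], [s], [M0], [c], [M], [C1], [g],
   [g2], [ep], [K], each one in terms of the previous ones. *)
Record admissible (alpha C C1 M0 M s c g g2 ep eps : R) (K : nat) : Prop := Admissible {
  ad_alpha : 2 <= alpha; ad_C : 0 < C; ad_M01 : 1 <= M0;
  ad_M0C : (2 / (2 * alpha * C)^-1) ^+ 4 <= M0;
  ad_s : 0 < s; ad_sM0 : s <= M0; ad_c : 0 < c; ad_c1 : c <= 1;
  ad_M : 2 * M0 <= M; ad_MC : (2 / ((8 * alpha)^-1 / C)) ^+ 4 <= M;
  ad_C1 : C * (1 + M) `^ (3 / 4) <= C1; ad_C11 : 1 <= C1;
  ad_g : 0 < g; ad_gs : 2 * g <= s; ad_g2 : 0 < g2; ad_g2g : g2 <= g;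
  ad_g2c : g2 < 2 * c; ad_g21 : g2 <= 1;
  ad_eps : 0 < eps; ad_eps1 : eps <= 1 / 10; ad_ep : 0 < ep;
  ad_epg : 160 * ep ^+ 2 <= eps * g ^+ 2; ad_eps_s : 2 * ep <= eps * s;
  ad_K : alpha + 2 <= K%:R }.

(** The demands on a large [t]. The conditions [lt_num0] to [lt_num2] make [ln L] and constants
    negligible against [ln a] and [L] in the tail exponents; [lt_far] is the part of [bad_rate] due
    to long excursions. *)
Record late (alpha C1 M0 M s c g g2 eps : R) (K : nat) (t a r L : R) : Prop := Late {
  lt_t : 0 < t; lt_a : 0 < a; lt_r : 1 <= r; lt_L : 1 <= L; lt_tE : t * a = r * L;
  lt_la : 0 <= ln a;
  lt_hi : ln ((C1 + M) * a) <= L; lt_lo : L / (2 * alpha) <= ln (s * a);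
  lt_sa : 2 <= s * a; lt_LM : 2 * M <= s * L;
  lt_LM0 : 2 * M0 * ln ((C1 + M) / s) <= g * L;
  lt_num0 : M * (4 + ln L - ln c + ln (C1 + M)) - ln eps <= g2 * ln a;
  lt_num1 : M * (4 + ln L - ln c + ln (C1 + M)) - ln eps <= g / 2 * L;
  lt_num2 : (8 * alpha)^-1 * L + (4 + ln L - ln c + ln (C1 + M)) - ln eps <= ln a / 2;
  lt_tiny : M + 1 - ln eps <= g / 8 * L;
  lt_ga : 8 <= g * a; lt_ga2 : 128 <= eps * (g * a) ^+ 2; lt_gat : g / 2 * a <= t;
  lt_far : 2 * M * r * (t * (g / 2 * a) * (2 * (2 / (g / 2 * a)) ^+ (2 * K))) <= eps / 2 }.

(** The field [ty_squares] is used three times: it bounds every single exclusive value, it bounds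
    the number of exclusive sites (each square exceeds 1), and it controls the quadratic error of
    the product ratio. *)
Record typical (C M s c g ep : R) (K : nat) (t a r : R) (xi : int -> R) : Prop := Typical {
  ty_gt1 : forall v, 1 < xi v;
  ty_envelope : forall v, xi v <= C * a * (1 + (`|v|%N)%:R / r) `^ (3 / 4);
  ty_high : exists y0 : nat, [/\ y0%:R <= s * r, 2 * s * a < xi y0 & xi y0 = xi (- y0%:Z)];
  ty_low : forall y : nat, y%:R <= c * r -> xi y <= s * a;
  ty_gap : forall y z : nat, y != z -> y%:R <= M * r -> z%:R <= M * r ->
    s / 2 * a <= Psi xi t y -> s / 2 * a <= Psi xi t z ->
    g * a < `|Psi xi t y - Psi xi t z|;
  ty_squares : forall n : nat, n%:R <= M * r ->
    \sum_(1 <= y < n.+1 | xi y%:Z != xi (- y%:Z)) (xi y%:Z ^+ 2 + xi (- y%:Z) ^+ 2) <= (ep * a) ^+ 2;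
  ty_sum : forall z : nat, z%:R <= M * r -> s * a <= xi z ->
    `| \sum_(1 <= y < z | xi y%:Z != xi (- y%:Z)) (xi y%:Z - xi (- y%:Z)) | <= ep * a;
  ty_isolated : forall z y : nat, z%:R <= M * r -> s * a <= xi z -> xi z = xi (- z%:Z) ->
    xi y%:Z != xi (- y%:Z) -> K%:Z < `|y%:Z - z%:Z| }.

Context d (Omega : measurableType d) (Q : probability Omega R).
Context (E D : nat -> Omega -> R) (X : R -> Omega -> int).
Hypothesis indED : mutually_independent Q
    (fun i : nat + nat => match i with inl k => E k | inr k => D k end).
Hypothesis lawE : forall k x, 0 <= x -> Q [set w | x < E k w] = (expR (- (2 * x)))%:E.
Hypothesis lawD1 : forall k, Q [set w | D k w = 1] = (1 / 2)%:E.
Hypothesis lawDN1 : forall k, Q [set w | D k w = -1] = (1 / 2)%:E.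
Hypothesis walkX : is_walk E D X.
Context (alpha C C1 M0 M s c g g2 ep eps : R) (K : nat) (t a r L : R) (xi : int -> R).
Hypothesis ad : admissible alpha C C1 M0 M s c g g2 ep eps K.
Hypothesis lt : late alpha C1 M0 M s c g g2 eps K t a r L.
Hypothesis ty : typical C M s c g ep K t a r xi.
Local Notation excl v := (xi v != xi (- v)).

Let r0 : 0 < r. Proof. exact: lt_le_trans (lt_r lt). Qed.
Let L0 : 0 < L. Proof. exact: lt_le_trans (lt_L lt). Qed.
Let M0M : M0 <= M. Proof. by have := ad_M ad; have := ad_M01 ad; lra. Qed.
Let M_gt0 : 0 < M. Proof. by apply: lt_le_trans M0M; exact: lt_le_trans (ad_M01 ad). Qed.

Let near_le v : (`|v|%N)%:R <= M * r -> xi v <= C1 * a.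
Proof.
exact: (envelope_near (lt_a lt) r0 (ad_s ad) (ad_sM0 ad) M0M (ad_C1 ad) (ad_C ad) (ty_envelope ty)).
Qed.

Let C1M : 1 <= C1 + M. Proof. by rewrite (le_trans (ad_C11 ad))// lerDl ltW. Qed.

Let log_C1 : ln (C1 * a) <= L.
Proof.
apply: le_trans (lt_hi lt).
have C10 : 0 < C1 by exact: lt_le_trans (ad_C11 ad).
rewrite ler_ln ?posrE ?mulr_gt0 ?(lt_a lt)// ?addr_gt0//.
by rewrite ler_wpM2r ?(ltW (lt_a lt))// lerDl ltW.
Qed.

Let al0 : 0 < alpha. Proof. exact: lt_le_trans (ad_alpha ad). Qed.

Lemma typical_max_exists : exists Z, is_max_Psi xi t Z.
Proof.
exact: (max_Psi_exists (lt_t lt) (lt_a lt) r0 L0 (lt_tE lt) (ad_s ad) (ad_sM0 ad) M0M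
  (ad_C1 ad) (ad_C ad) (ty_gt1 ty) (ty_envelope ty) log_C1 al0 (lt_lo lt) (ad_M01 ad)
  (ad_M0C ad) (ty_high ty)).
Qed.

Context (Z : nat).
Hypothesis Zmax : is_max_Psi xi t Z.

Let Zloc : [/\ c * r < Z%:R, Z%:R < M0 * r, s * a < Psi xi t Z, s * a < xi Z & xi Z <= C1 * a].
Proof.
exact: (max_Psi_loc (lt_t lt) (lt_a lt) r0 L0 (lt_tE lt) (ad_s ad) (ad_sM0 ad) M0M
  (ad_C1 ad) (ad_C ad) (ty_gt1 ty) (ty_envelope ty) log_C1 al0 (lt_lo lt) (ad_M01 ad)
  (ad_M0C ad) (ty_high ty) (ty_low ty)).
Qed.

Local Notation N := (radius r g2 Z).
Local Notation k := (g / 2 * a).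
Local Notation el := (excl_list (fun v => excl v) Z).

Let ZM : Z%:R <= M * r.
Proof. by have [_ /ltW h _ _ _] := Zloc; apply: (le_trans h); rewrite ler_wpM2r// ltW. Qed.

Let xi_ge0 v : 0 <= xi v.
Proof. by rewrite ltW// (lt_trans ltr01)//; exact: (ty_gt1 ty). Qed.

Let excl_squares (n : nat) : n%:R <= M * r ->
  \sum_(v <- excl_list (fun v => excl v) n.+1) (xi v ^+ 2 + xi (- v) ^+ 2) <= (ep * a) ^+ 2.
Proof.
by move=> nM; rewrite excl_list_sum; exact: (ty_squares ty nM).
Qed.

Let excl_small (v : int) : (`|v|%N)%:R <= M * r -> excl v -> xi v <= ep * a.
Proof.
move=> vM ev; have := excl_squares vM.
have vl : (`|v|%N)%:Z \in excl_list (fun v => excl v) `|v|.+1.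
  rewrite mem_excl_list; apply/and3P; split => //; last by rewrite ltz_nat.
  exact: excl_absz.
rewrite (bigD1_seq _ vl) ?excl_list_uniq//= => h.
have : xi v ^+ 2 <= (ep * a) ^+ 2.
  apply: le_trans h; apply: (@le_trans _ _ (xi (`|v|%N) ^+ 2 + xi (- (`|v|%N)%:Z) ^+ 2)).
    by case: (abszP v) => {1}->; rewrite ?lerDl ?lerDr ?sqr_ge0.
  by rewrite lerDl; apply: sumr_ge0 => w _; rewrite addr_ge0 ?sqr_ge0.
by rewrite ler_pXn2r// nnegrE ?mulr_ge0 ?(ltW (ad_ep ad)) ?(ltW (lt_a lt)).
Qed.

Let M0g2M : M0 + g2 <= M.
Proof. by have := ad_M ad; have := ad_M01 ad; have := ad_g21 ad; lra. Qed.

Let eps2 : 2 * ep <= s.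
Proof.
have := ad_eps_s ad; have := ad_s ad; have := ad_eps1 ad; nra.
Qed.

Let deep_xi : deep Z N k (fun v => xi v - xi Z).
Proof.
have [cZ ZM0 ZP Zs _] := Zloc.
exact: (deep_potential (lt_t lt) (lt_a lt) r0 L0 (lt_tE lt) (ad_s ad) (ad_c ad) (ad_g ad)
  (ad_g2 ad) (ad_gs ad) (ad_g2g ad) eps2 (ad_g2c ad) M0g2M (ty_gt1 ty) near_le Zmax cZ ZM0 ZP Zs
  excl_small (ty_gap ty) (lt_hi lt) (lt_sa lt) (lt_LM lt)).
Qed.

Let deep_xi_opp : deep Z N k (fun v => xi (- v) - xi Z).
Proof.
have [cZ ZM0 ZP Zs _] := Zloc.
exact: (deep_potential_opp (lt_t lt) (lt_a lt) r0 L0 (lt_tE lt) (ad_s ad) (ad_c ad) (ad_g ad)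
  (ad_g2 ad) (ad_gs ad) (ad_g2g ad) eps2 (ad_g2c ad) M0g2M (ty_gt1 ty) near_le Zmax cZ ZM0 ZP Zs
  excl_small (ty_gap ty) (lt_hi lt) (lt_sa lt) (lt_LM lt)).
Qed.

Let tail_xi (xi' : int -> R) : (forall v, exists w, xi' v = xi w /\ `|w|%N = `|v|%N) ->
  negligible_tail Z N t eps (fun v => xi' v - xi Z).
Proof.
have [cZ ZM0 ZP Zs ZC1] := Zloc.
have site_over := @site_overshoot _ _ _ _ _ _ _ _ _ _ _ _ g2 _ _ (lt_t lt) (lt_a lt) r0 L0 (lt_tE lt) (ad_s ad) (ad_c ad) (ad_g ad)
  (ad_g2 ad) (ad_gs ad) eps2 M0g2M (ty_gt1 ty) near_le Zmax cZ ZM0 ZP Zs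
  excl_small (ty_gap ty) (lt_hi lt) (lt_sa lt) (lt_LM lt) (lt_LM0 lt).
have ZC2 : xi Z <= (C1 + M) * a.
  by apply: (le_trans ZC1); rewrite ler_wpM2r ?(ltW (lt_a lt))// lerDl ltW.
have tZ : M0 * r <= t * xi Z.
  apply: (@le_trans _ _ (t * (s * a))); last by rewrite ler_wpM2l ?ltW ?(lt_t lt).
  rewrite mulrCA (lt_tE lt) [r * L]mulrC mulrA ler_wpM2r ?(ltW r0)//.
  by have := lt_LM lt; have := M0M; have := M_gt0; lra.
have e1 : eps <= 1 by have := ad_eps1 ad; lra.
(* For late [t] one has [ln a >= 3 L / (4 alpha)], so [L / (8 alpha)] uses up only a third of the
   available [ln a / 2]. *)
have k0 : 0 < (8 * alpha)^-1 by rewrite invr_gt0 mulr_gt0.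
exact: (tail_control (lt_t lt) (lt_a lt) (lt_r lt) (lt_L lt) (lt_tE lt) (lt_la lt) (ad_c ad)
  (ad_c1 ad) (ad_g2 ad) k0 (ad_eps ad) e1 (ad_C ad) (ad_M ad) (ad_M01 ad) (ad_MC ad)
  (ty_gt1 ty) (ty_envelope ty) cZ ZM0 C1M ZC2 site_over tZ (lt_num0 lt) (lt_num1 lt) (lt_num2 lt)).
Qed.

Let ga8 : 4 <= k. Proof. by have := lt_ga lt; lra. Qed.

Let Z_gt0 : (0 < Z)%N.
Proof.
have [cZ _ _ _ _] := Zloc; rewrite -(ltr_nat R); apply: lt_trans cZ.
by rewrite mulr_gt0// (ad_c ad).
Qed.

Let size_el : (size el)%:R <= (ep * a) ^+ 2.
Proof.
have := excl_squares ZM; apply: le_trans.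
apply: (@le_trans _ _ (\sum_(v <- el) (xi v ^+ 2 + xi (- v) ^+ 2))).
  rewrite -sum1_size natr_sum; apply: ler_sum => v _.
  have h u : 1 <= xi u ^+ 2 by have := ty_gt1 ty u; rewrite expr2; nra.
  by apply: (le_trans (h v)); rewrite lerDl sqr_ge0.
by apply: excl_list_sumS => v; rewrite addr_ge0 ?sqr_ge0.
Qed.

(** As [t >= k], the rate is at most [10 / k], and [k = g a / 2] gives
    [10 / k ^ 2 = 40 / (g a) ^ 2]. *)
Let growth_rate_le : (8 / k + 2 / t) / k <= 40 / (g * a) ^+ 2.
Proof.
have k0 : 0 < k by apply: lt_le_trans ga8.
have h : 2 / t <= 2 / k by rewrite ler_wpM2l// lef_pV2 ?posrE ?(lt_t lt)// (lt_gat lt).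
apply: (@le_trans _ _ ((8 / k + 2 / k) / k)); first by rewrite ler_wpM2r ?invr_ge0 ?(ltW k0)// lerD2l.
rewrite le_eqVlt; apply/orP; left; apply/eqP.
by field; rewrite !gt_eqF// ?(ad_g ad) ?(lt_a lt).
Qed.

Let growth_small : 8 / k + 2 / t < k.
Proof.
have k0 : 0 < k by apply: lt_le_trans ga8.
rewrite -[ltRHS]mul1r -ltr_pdivrMr//; apply: (le_lt_trans growth_rate_le).
have ga := lt_ga lt.
rewrite ltr_pdivrMr ?exprn_gt0; nra.
Qed.

Let ga20 : 0 < (g * a) ^+ 2.
Proof. by rewrite exprn_gt0// mulr_gt0 ?(ad_g ad) ?(lt_a lt). Qed.

Let ep_ga : 160 * (ep * a) ^+ 2 <= eps * (g * a) ^+ 2.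
Proof.
rewrite !exprMn [leLHS]mulrA [leRHS]mulrA ler_wpM2r ?sqr_ge0//; exact: (ad_epg ad).
Qed.

Let growth_el : (1 - (8 / k + 2 / t) / k)^-1 ^+ size el <= 1 + eps.
Proof.
have k0 : 0 < k by apply: lt_le_trans ga8.
have x0 : 0 <= (8 / k + 2 / t) / k.
  by rewrite divr_ge0 ?(ltW k0)// addr_ge0// divr_ge0 ?(ltW k0) ?(ltW (lt_t lt)).
have e0 := ad_eps ad; have e1 := ad_eps1 ad.
apply: geom_growth_le => //; rewrite ?(ltW e0)//.
- apply: (@le_trans _ _ ((ep * a) ^+ 2 * (40 / (g * a) ^+ 2))); first exact: (ler_pM (ler0n _ _) x0 size_el growth_rate_le).
  by rewrite mulrA ler_pdivrMr//; have := mulr_gt0 e0 ga20; move: ep_ga; lra.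
- by lra.
- by rewrite ltr_pdivrMr// mul1r.
Qed.

Let radius_M : N%:R + 1 <= 2 * M * r.
Proof.
have [_ ZM0 _ _ _] := Zloc; have := radius_le Z r0 (ad_g2 ad).
have := ler_wpM2r (ltW r0) M0g2M; have := lt_r lt; have := ad_M01 ad; have := M0M; nra.
Qed.

Let bad_small : bad_rate (fun v => excl v) Z N K k t <= eps.
Proof.
have k0 : 0 < k by apply: lt_le_trans ga8.
have ga0 := ga20.
rewrite /bad_rate [leRHS]splitr; apply: lerD.
  rewrite -natr1 mulrDl mul1r.
  have -> : 8 / k ^+ 2 = 32 / (g * a) ^+ 2.
    by field; rewrite !gt_eqF// ?(ad_g ad) ?(lt_a lt).
  apply: (@le_trans _ _ ((ep * a) ^+ 2 * (32 / (g * a) ^+ 2) + 32 / (g * a) ^+ 2)).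
    by rewrite lerD2r ler_wpM2r// divr_ge0// ltW.
  rewrite mulrA -mulrDl ler_pdivrMr//.
  by have := lt_ga2 lt; move: ep_ga; lra.
apply: le_trans (lt_far lt); rewrite ler_wpM2r//.
  have k2 : 0 <= 2 / k by rewrite divr_ge0// ltW.
  by apply: mulr_ge0; apply: mulr_ge0; rewrite ?exprn_ge0 ?(ltW (lt_t lt)) ?(ltW k0).
by rewrite -natr1.
Qed.

(** The factor [2 * 2 ^ N] is at most [exp (N + 1)] with [N] of order [r], while the exponent
    [k t / 4] equals [g / 8 * (r * L)] with [L] large. *)
Let tiny_small : tiny N k t <= eps.
Proof.
have e0 := ad_eps ad; have rr := lt_r lt; have num := lt_tiny lt.
rewrite /tiny -[leRHS](lnK e0) -natrX.
have two : 2 <= expR 1 :> R by have := @expR_ge1Dx R 1; lra.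
have N2 : (2 ^ N)%N%:R <= expR N%:R :> R.
  rewrite natrX -[X in expR X]mulr1 expRM_natl lerXn2r ?nnegrE ?expR_ge0//.
apply: (@le_trans _ _ (expR 1 * (expR N%:R * expR (- (k * t / 4))))).
  by apply: ler_pM => //; rewrite ?mulr_ge0 ?expR_ge0// ler_wpM2r ?expR_ge0.
rewrite -!expRD ler_expR.
have -> : k * t / 4 = g / 8 * (t * a) by field.
rewrite (lt_tE lt).
have [_ ZM0 _ _ _] := Zloc; have rle := radius_le Z r0 (ad_g2 ad).
have NM : N%:R <= M * r.
  by apply: (le_trans rle); have := ler_wpM2r (ltW r0) M0g2M; lra.
have h : r * (M + 1 - ln eps) <= r * (g / 8 * L) by rewrite ler_wpM2l// ltW.
have le0 : ln eps <= 0 by rewrite ln_le0//; have := ad_eps1 ad; lra.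
nra.
Qed.

(** Stated for either assignment of the potential and its reflection to [u] and [u'], since
    [ratio_bound] asks for the inequality in both directions. *)
Let weight_ratio (u u' : int -> R) : (forall v, u v = xi v /\ u' v = xi (- v) \/ u v = xi (- v) /\ u' v = xi v) ->
  `|\sum_(v <- el) (u' v - u v)| <= ep * a ->
  (1 - eps) * \prod_(v <- el) (- (u' v - xi Z))^-1 <= \prod_(v <- el) (- (u v - xi Z))^-1.
Proof.
move=> uu hsum; have [_ _ _ Zs _] := Zloc.
have s0 := ad_s ad; have a0 := lt_a lt; have sa0 : 0 < s * a by rewrite mulr_gt0.
have lam0 : 0 < xi Z by exact: lt_trans Zs.
have epsa : ep * a <= xi Z / 2.
  have := ler_wpM2r (ltW a0) eps2; lra.
have val v : v \in el -> 0 <= xi v <= xi Z / 2 /\ 0 <= xi (- v) <= xi Z / 2.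
  move=> vl; have := vl; rewrite mem_excl_list => /and3P[ev _ _].
  have vM : (`|v|%N)%:R <= M * r.
    by apply: le_trans ZM; rewrite ler_nat ltnW// (excl_list_lt vl).
  rewrite !xi_ge0/=; split.
    exact: le_trans (excl_small vM ev) epsa.
  have evN : excl (- v) by rewrite opprK eq_sym.
  by apply: le_trans (excl_small _ evN) epsa; rewrite abszN.
have b : ep * a <= ep / s * xi Z.
  have -> : ep * a = ep / s * (s * a) by field; rewrite gt_eqF.
  by rewrite ler_wpM2l ?divr_ge0 ?(ltW (ad_ep ad)) ?(ltW s0)// ltW.
have sq : \sum_(v <- el) u' v ^+ 2 <= (ep / s) ^+ 2 * xi Z ^+ 2.
  apply: (@le_trans _ _ ((ep * a) ^+ 2)); last first.
    rewrite -exprMn ler_pXn2r// nnegrE; first by rewrite mulr_ge0 ?(ltW (ad_ep ad)) ?(ltW a0).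
    by apply: le_trans b; rewrite mulr_ge0 ?(ltW (ad_ep ad)) ?(ltW a0).
  apply: le_trans (excl_squares ZM).
  apply: (@le_trans _ _ (\sum_(v <- el) (xi v ^+ 2 + xi (- v) ^+ 2))).
    apply: ler_sum => v _; case: (uu v) => [[_ ->]|[_ ->]]; rewrite ?lerDl ?lerDr ?sqr_ge0//.
  by apply: excl_list_sumS => v; rewrite addr_ge0 ?sqr_ge0.
have := @prod_inv_ratio _ el (xi Z) (ep / s) ((ep / s) ^+ 2) u u' lam0.
have hu v : v \in el -> 0 <= u v <= xi Z / 2.
  by move=> /val[? ?]; case: (uu v) => [[-> _]|[-> _]].
have hu' v : v \in el -> 0 <= u' v <= xi Z / 2.
  by move=> /val[? ?]; case: (uu v) => [[_ ->]|[_ ->]].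
move=> /(_ hu hu' (le_trans (ler_norm _) (le_trans hsum b)) sq).
have prodE f : \prod_(v <- el) (- (f v - xi Z))^-1 = \prod_(v <- el) (xi Z - f v)^-1.
  by apply: eq_bigr => v _; rewrite opprB.
rewrite !prodE; apply: le_trans; rewrite ler_wpM2r//.
  rewrite big_seq; apply: prodr_ge0 => v vl; rewrite invr_ge0.
  by have /andP[_ h] := hu' _ vl; rewrite subr_ge0 (le_trans h)// ler_pdivrMr// ler_peMr ?(ltW lam0)// ler1n.
have e0 := ad_eps ad; have e1 := ad_eps1 ad.
have x0 : 0 <= ep / s by rewrite divr_ge0 ?(ltW (ad_ep ad)) ?(ltW s0).
have x1 : ep / s <= eps / 2.
  by rewrite ler_pdivrMr// mulrAC ler_pdivlMr//; have := ad_eps_s ad; lra.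
move: (ep / s) x0 x1 => x x0 x1; nra.
Qed.

Lemma typical_ratio :
  `|fine (fk_solution Q X xi t Z) / fine (fk_solution Q X xi t (- Z%:Z)) - 1| <= 10 * eps.
Proof.
have [cZ ZM0 _ Zs _] := Zloc.
have t0 := lt_t lt.
rewrite (fk_solution_full indED lawE lawD1 lawDN1 walkX Z xi_ge0 (ltW t0)).
rewrite (fk_solution_full_opp indED lawE lawD1 lawDN1 walkX xi_ge0 (ltW t0) (esym Zmax.1)).
have e00 : ~~ excl (0 : int) by rewrite oppr0 eqxx.
have ZN : (Z <= N)%N by rewrite leq_addr.
have tc : negligible_tail Z N t eps (fun v => xi v - xi Z) by apply: tail_xi => v; exists v.
have tc' : negligible_tail Z N t eps (fun v => xi (- v) - xi Z).
  by apply: tail_xi => v; exists (- v); rewrite abszN.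
have eK v : excl v -> K%:Z < `|v - Z%:Z|.
  move=> ev; have := ty_isolated ty ZM (ltW Zs) Zmax.1 (excl_absz ev) => h.
  exact: lt_le_trans h (absz_dist_le _ _).
have [G0 f1 _ _] := full_sum_bounds Z_gt0 ZN ga8 t0 e00 (ad_eps ad) (ad_eps1 ad) eK tiny_small
  growth_small growth_el bad_small deep_xi tc.
have [G0' f2 _ _] := full_sum_bounds Z_gt0 ZN ga8 t0 e00 (ad_eps ad) (ad_eps1 ad) eK tiny_small
  growth_small growth_el bad_small deep_xi_opp tc'.
rewrite !fineM//= invfM mulrACA mulfV ?gt_eqF ?expR_gt0// mul1r.
have hs := ty_sum ty ZM (ltW Zs).
apply: (ratio_bound Z_gt0 ZN ga8 t0 e00 (ad_eps ad) (ad_eps1 ad) eK tiny_small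
  growth_small growth_el bad_small deep_xi deep_xi_opp _ tc tc').
- by move=> v; rewrite negbK => /eqP ->.
- apply: weight_ratio; first by move=> v; left.
  rewrite -normrN -sumrN; under eq_bigr do rewrite opprB.
  by rewrite excl_list_sum.
- apply: weight_ratio; first by move=> v; right.
  by rewrite excl_list_sum.
Qed.

End final_ratio.

(** * Probability estimates *)

Lemma ler_sum_ord_widen (R : realType) (f : nat -> R) (m n : nat) : (forall k, 0 <= f k) ->
  (m <= n)%N -> \sum_(k < m) f k <= \sum_(k < n) f k.
Proof.
move=> f0 /subnKC <-; rewrite big_split_ord/= lerDl.
exact: sumr_ge0.
Qed.

Section likely.
Context d (Omega : measurableType d) (R : realType) (P : probability Omega R).

(** Measurability is asked of the exceptional set only: [A] may quantify over uncountably many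
    conditions or come from chosen objects. *)
Definition likely (e : R) (A : Omega -> Prop) := exists bad : set Omega,
  [/\ measurable bad, (P bad <= e%:E)%E & forall w, ~ bad w -> A w].

Lemma likely_sub e (A B : Omega -> Prop) : (forall w, A w -> B w) -> likely e A -> likely e B.
Proof. by move=> AB [bad [mb pb H]]; exists bad; split => // w /H /AB. Qed.

Lemma likely_le e e' A : e <= e' -> likely e A -> likely e' A.
Proof.
by move=> ee [bad [mb pb H]]; exists bad; split => //; apply: (le_trans pb); rewrite lee_fin.
Qed.

Lemma likely_set e (A : set Omega) : measurable A -> (P A <= e%:E)%E -> likely e (fun w => ~ A w).
Proof. by move=> mA PA; exists A. Qed.

Lemma likelyI e1 e2 A B : likely e1 A -> likely e2 B -> likely (e1 + e2) (fun w => A w /\ B w).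
Proof.
move=> [b1 [m1 p1 H1]] [b2 [m2 p2 H2]]; exists (b1 `|` b2); split.
- exact: measurableU.
- by apply: (le_trans (measureU2 _ m1 m2)); rewrite EFinD leeD.
- by move=> w /not_orP[/H1 ? /H2 ?].
Qed.

Lemma likely_seq (I : eqType) (s : seq I) (e : I -> R) (A : I -> Omega -> Prop) :
  (forall i, i \in s -> likely (e i) (A i)) ->
  likely (\sum_(i <- s) e i) (fun w => forall i, i \in s -> A i w).
Proof.
elim: s => [|i s IH] H.
  by exists set0; split=> [||w _ i]; rewrite ?big_nil ?measure0 ?in_nil.
rewrite big_cons; apply: (@likely_sub _ (fun w => A i w /\ forall k, k \in s -> A k w)).
  by move=> w [Ai As] k; rewrite inE => /predU1P[->|/As].
apply: likelyI; first by apply: H; rewrite mem_head.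
by apply: IH => k ks; apply: H; rewrite inE ks orbT.
Qed.

Lemma likely_nat (e : nat -> R) (x : R) (A : nat -> Omega -> Prop) :
  (forall n, 0 <= e n) -> (forall n, \sum_(0 <= i < n) e i <= x) ->
  (forall n, likely (e n) (A n)) -> likely x (fun w => forall n, A n w).
Proof.
move=> e0 ex /choice[bad Hbad].
have mb n : measurable (bad n) by have [] := Hbad n.
exists (\bigcup_n bad n); split.
- exact: bigcup_measurable.
- apply: (@le_trans _ _ (\sum_(0 <= i <oo) (e i)%:E)%E).
    apply: (@le_trans _ _ (\sum_(0 <= i <oo) P (bad i))%E).
      by apply: measure_sigma_subadditive => //; exact: bigcup_measurable.
    by apply: lee_nneseries => // n _; have [] := Hbad n.
  apply: lime_le; first by apply: is_cvg_ereal_nneg_natsum_cond => n _ _; rewrite lee_fin.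
  by near=> n; rewrite sumEFin lee_fin.
- by move=> w nb n; have [_ _] := Hbad n; apply => bn; apply: nb; exists n.
Unshelve. all: by end_near. Qed.

Lemma likely_markov (f : Omega -> \bar R) (c e : R) : measurable_fun setT f ->
  (forall w, 0 <= f w)%E -> 0 < c -> (\int[P]_w f w <= (e * c)%:E)%E ->
  likely e (fun w => f w < c%:E)%E.
Proof.
move=> mf f0 c0 fe; exists [set w | (c%:E <= f w)%E]; split.
- by rewrite -[X in measurable X]setTI; exact: emeasurable_fun_c_infty.
- have h := @le_integral_abse _ _ _ P _ measurableT _ c mf c0.
  rewrite -(@lee_pmul2l _ c%:E)// ?lte_fin//.
  rewrite -EFinM mulrC; apply: le_trans fe; move: h; rewrite setTI.
  under [in X in (_ <= X -> _)%E]eq_integral do rewrite gee0_abs//.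
  apply: le_trans; rewrite le_eqVlt; apply/orP; left; apply/eqP.
  congr (_ * P _)%E; apply/seteqP; split=> w /=; by rewrite gee0_abs.
- by move=> w /= /negP; rewrite -ltNge.
Qed.

End likely.

Section pareto.
Context d (Omega : measurableType d) (R : realType) (P : probability Omega R).
Context (alpha : R) (I : eqType) (X : I -> Omega -> R).
Hypothesis indX : mutually_independent P X.

Lemma measurable_gt i (x : R) : measurable [set w | x < X i w].
Proof.
have := measurable_indX indX i (measurable_itv `]x, +oo[).
by congr measurable; apply/seteqP; split => w /=; rewrite in_itv/= andbT.
Qed.

Definition pareto i := forall x, 1 <= x -> P [set w | x < X i w] = (x `^ (- alpha))%:E.

Lemma pareto_gt1 i : pareto i -> P [set w | 1 < X i w] = 1%E.
Proof. by move=> /(_ 1 (lexx _)) ->; rewrite powR1. Qed.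

Lemma likely_gt1 i : pareto i -> likely P 0 (fun w => 1 < X i w).
Proof.
move=> pi; pose A := [set w | 1 < X i w]; have mA : measurable A by exact: measurable_gt.
exists (~` A); split; first exact: measurableC.
  by rewrite (probability_setC _ mA) (pareto_gt1 pi) subee.
by move=> w /contrapT.
Qed.

Lemma likely_le_tail i (x y : R) : pareto i -> 1 <= x -> x `^ (- alpha) <= y ->
  likely P y (fun w => X i w <= x).
Proof.
move=> pi x1 xy; have := @likely_set _ _ _ P y _ (measurable_gt i x).
rewrite pi// lee_fin => /(_ xy); apply: likely_sub => w /= /negP.
by rewrite -leNgt.
Qed.

End pareto.

(** Comparison with the integral of [(1 + x) ^ (- 3 / 2)]; its primitive supplies the subtracted
    term that makes the induction close. *)
Lemma sum_inv_sqrt3_le (R : realType) (r : R) (n : nat) : 0 < r ->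
  \sum_(0 <= i < n.+1) (r * ((1 + i%:R / r) * Num.sqrt (1 + i%:R / r)))^-1 <=
  r^-1 + 2 - 2 / Num.sqrt (1 + n%:R / r).
Proof.
move=> r0; elim: n => [|n IH].
  by rewrite big_nat1 mul0r addr0 sqrtr1 !mulr1 divr1 addrK.
rewrite big_nat_recr//=; apply: (le_trans (lerD IH (lexx _))).
set X := 1 + n%:R / r; have X0 : 0 < X by rewrite ltr_wpDr// divr_ge0// ltW.
have XS : 1 + n.+1%:R / r = X + r^-1 by rewrite -natr1 mulrDl mul1r addrA.
have X1 : 0 < X + r^-1 by rewrite addr_gt0// invr_gt0.
rewrite XS; set p := Num.sqrt X; set q := Num.sqrt (X + r^-1).
have p0 : 0 < p by rewrite sqrtr_gt0.
have q0 : 0 < q by rewrite sqrtr_gt0.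
have q2 : q ^+ 2 = X + r^-1 by rewrite sqr_sqrtr// ltW.
have p2 : p ^+ 2 = X by rewrite sqr_sqrtr// ltW.
have pq : p <= q by apply: ler_wsqrtr; rewrite lerDl invr_ge0 ltW.
rewrite -q2; suff : (r * (q ^+ 2 * q))^-1 <= 2 / p - 2 / q by lra.
have -> : (r * (q ^+ 2 * q))^-1 = (q ^+ 2 - p ^+ 2) / (q ^+ 2 * q).
  by rewrite q2 p2 [X + _]addrC addrK invfM.
rewrite ler_pdivrMr ?mulr_gt0 ?exprn_gt0//.
have -> : (2 / p - 2 / q) * (q ^+ 2 * q) = 2 * (q - p) * q ^+ 2 / p.
  by field; rewrite !gt_eqF.
rewrite ler_pdivlMr// subr_sqr -!mulrA ![2 * _]mulrCA ler_wpM2l ?subr_ge0//; nra.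
Qed.

Section field_events.
Context d (Omega : measurableType d) (R : realType) (P : probability Omega R).
Context (alpha : R) (X : int + nat -> Omega -> R).
Hypothesis al2 : 2 <= alpha.
Hypothesis indX : mutually_independent P X.
Hypothesis law : forall z, pareto P alpha X (inl z).
Context (a r : R).
Hypotheses (a1 : 1 <= a) (rE : r = a `^ alpha).
Local Notation xi0 z := (X (inl z)).
Local Notation likely := (likely P).

Let a0 : 0 < a. Proof. exact: lt_le_trans a1. Qed.
Let r0 : 0 < r. Proof. by rewrite rE powR_gt0. Qed.

Lemma r_ge1 : 1 <= r.
Proof. by rewrite rE -(powRr0 a) ler_powR// (le_trans _ al2). Qed.

Lemma tail_scaled (x : R) : 0 <= x -> (x * a) `^ (- alpha) = x `^ (- alpha) / r.
Proof. by move=> x0; rewrite powRM ?(ltW a0)// [a `^ _]powRN -rE. Qed.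

Lemma powRN_le_sqr (x : R) : 1 <= x -> x `^ (- alpha) <= (x ^+ 2)^-1.
Proof.
move=> x1; have x0 : 0 < x by exact: lt_le_trans x1.
rewrite powRN lef_pV2 ?posrE ?powR_gt0 ?exprn_gt0// -powR_mulrn ?(ltW x0)//.
by rewrite ler_powR.
Qed.

(** The exponent [3 / 4] is below 1, so that the penalty in [Psi] wins far away, and
    [3 / 4 * alpha >= 3 / 2], so that the failure probabilities are summable. Their sum is at most
    [3 / C ^ 2] on each half-line. *)
Lemma likely_envelope (C : R) : 1 <= C -> likely (6 / C ^+ 2) (fun w => forall z : int,
  1 < xi0 z w /\ xi0 z w <= C * a * (1 + (`|z|%N)%:R / r) `^ (3 / 4)).
Proof.
move=> C1; have C0 : 0 < C by exact: lt_le_trans C1.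
pose f (n : nat) := (1 + n%:R / r) `^ (3 / 4).
pose h (n : nat) := (r * ((1 + n%:R / r) * Num.sqrt (1 + n%:R / r)))^-1.
have nr n : 1 <= 1 + n%:R / r by rewrite lerDl divr_ge0// ltW.
have f1 n : 1 <= f n.
  by rewrite /f -[X in X <= _](powRr0 (1 + n%:R / r)) ler_powR.
have h0 n : 0 <= h n.
  by rewrite invr_ge0 !mulr_ge0 ?sqrtr_ge0 ?(ltW r0)// (le_trans _ (nr n)).
have one z : likely (h `|z|%N / C ^+ 2)
    (fun w => 1 < xi0 z w /\ xi0 z w <= C * a * f `|z|%N).
  rewrite -[X in likely X]add0r; apply: likelyI; first exact: likely_gt1 (law z).
  set n := `|z|%N.
  have Cf : 1 <= C * f n by rewrite -[X in X <= _]mulr1 ler_pM.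
  have C1a : 1 <= C * a * f n by rewrite mulrAC -[X in X <= _]mulr1 ler_pM.
  apply: (likely_le_tail indX (law z) C1a).
  have f0 : 0 <= f n by exact: le_trans (f1 n).
  rewrite mulrAC tail_scaled ?mulr_ge0 ?(ltW C0)//.
  rewrite powRM ?(ltW C0)// /h invfM [X in _ <= X]mulrC mulrA [leRHS]mulrAC.
  rewrite ler_wpM2r ?invr_ge0 ?(ltW r0)//; apply: ler_pM; rewrite ?powR_ge0 ?powRN_le_sqr//.
  rewrite powRN lef_pV2 ?posrE ?powR_gt0//; last 2 first.
  - exact: lt_le_trans (nr n).
  - by have Y0 := lt_le_trans ltr01 (nr n); rewrite mulr_gt0 ?sqrtr_gt0.
  set Y := 1 + n%:R / r; have Y0 : 0 < Y by exact: lt_le_trans (nr n).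
  have -> : Y * Num.sqrt Y = Y `^ (3 / 2).
    rewrite -powR12_sqrt ?(ltW Y0)// -[X in X * _](powRr1 (ltW Y0)) -powRD.
      by congr (_ `^ _); field.
    by apply/implyP => _; rewrite gt_eqF.
  rewrite /f -powRrM ler_powR ?nr//; have := al2; lra.
pose A n w := (1 < xi0 n%:Z w /\ xi0 n%:Z w <= C * a * f n) /\
  (1 < xi0 (- n%:Z) w /\ xi0 (- n%:Z) w <= C * a * f n).
have := @likely_nat _ _ _ P (fun n => h n / C ^+ 2 + h n / C ^+ 2) (6 / C ^+ 2) A _ _ _.
move=> H; apply: likely_sub (H _ _ _).
- by move=> w Aw z; case: (abszP z) => ->; have [] := Aw `|z|%N; rewrite ?abszN absz_nat.
- by move=> n; rewrite addr_ge0// divr_ge0// exprn_ge0// ltW.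
- move=> n; rewrite big_split/= -mulr_suml -mulrDl ler_wpM2r ?invr_ge0 ?exprn_ge0 ?(ltW C0)//.
  have hn : \sum_(0 <= i < n) h i <= 3.
    case: n => [|n]; first by rewrite big_geq.
    apply: (le_trans (sum_inv_sqrt3_le n r0)).
    have : r^-1 <= 1 by rewrite invf_le1// r_ge1.
    have : 0 <= 2 / Num.sqrt (1 + n%:R / r) by rewrite divr_ge0 ?sqrtr_ge0.
    lra.
  lra.
- move=> n; apply: likelyI; first by have := one n%:Z.
  by have := one (- n%:Z); rewrite abszN absz_nat.
Qed.

Lemma likely_low (c s : R) : 0 < s -> 0 < c -> 1 <= s * a -> 1 <= c * r ->
  likely (2 * c * s `^ (- alpha)) (fun w => forall y : nat, y%:R <= c * r -> xi0 y%:Z w <= s * a).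
Proof.
move=> s0 c0 sa1 cr1; pose n := Num.truncn (c * r).
have /truncn_itv/andP[n1 n2] : 0 <= c * r by exact: le_trans cr1.
have := @likely_seq _ _ _ P _ (iota 0 n.+1) (fun=> s `^ (- alpha) / r)
  (fun y w => xi0 y%:Z w <= s * a) _.
move=> H; apply: likely_le (likely_sub _ (H _)).
- rewrite big_const_seq count_predT size_iota iter_addr_0 -[leLHS]mulr_natl -[n.+1%:R]natr1.
  apply: (@le_trans _ _ ((2 * (c * r)) * (s `^ (- alpha) / r))).
    by rewrite ler_wpM2r ?divr_ge0 ?powR_ge0 ?(ltW r0)//; lra.
  by rewrite le_eqVlt; apply/orP; left; apply/eqP; field; rewrite gt_eqF.
- move=> w Hw y yc; apply: Hw; rewrite mem_iota/= add0n.
  by rewrite -(ltr_nat R); exact: le_lt_trans n2.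
- move=> y _; apply: (likely_le_tail indX (law _) sa1).
  by rewrite tail_scaled// ltW.
Qed.

(** At least [s r / 2] independent sites each succeed with probability [p = (2 s) ^ (- alpha) / r],
    and [(1 - p) ^ n <= exp (- n p) <= 1 / (n p)]. The bound is small for small [s] because
    [alpha > 1]. *)
Lemma likely_high (s : R) : 0 < s -> 1 <= 2 * s * a -> 2 <= s * r ->
  likely (2 * (2 * s) `^ alpha / s)
    (fun w => exists y : nat, y%:R <= s * r /\ 2 * s * a < xi0 y%:Z w).
Proof.
move=> s0 sa1 sr2; pose n := Num.truncn (s * r).
have /truncn_itv/andP[n1 n2] : 0 <= s * r by lra.
pose A (j : int + nat) : set R := ~` `]2 * s * a, +oo[.
have mA j : measurable (A j) by exact: measurableC.
pose J : seq (int + nat) := [seq inl i%:Z | i <- iota 0 n].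
have uJ : uniq J by rewrite map_inj_uniq ?iota_uniq// => i k [].
pose bad := \big[setI/setT]_(j <- J) (X j @^-1` A j).
pose p := (2 * s) `^ (- alpha) / r.
have p0 : 0 < p by rewrite divr_gt0 ?powR_gt0 ?mulr_gt0.
have PS z : P [set w | 2 * s * a < xi0 z w] = p%:E.
  by rewrite (law _ sa1) tail_scaled// mulr_ge0// ltW.
have p1 : p <= 1 by rewrite -lee_fin -(PS 0) probability_le1//; exact: measurable_gt indX _ _.
have PA j : j \in J -> P (X j @^-1` A j) = (1 - p)%:E.
  move=> /mapP[i _ ->]; pose S := [set w | 2 * s * a < xi0 i%:Z w].
  have -> : X (inl i%:Z) @^-1` A (inl i%:Z) = ~` S.
    by rewrite /A preimage_setC; congr (~` _); apply/seteqP; split => w /=; rewrite in_itv/= andbT.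
  by rewrite (probability_setC P (measurable_gt indX _ _)) PS EFinB.
have Pbad : (P bad = ((1 - p) ^+ n)%:E)%E.
  rewrite /bad (indX.2 J A uJ (fun j _ => mA j)) big_seq.
  rewrite (eq_bigr (fun=> (1 - p)%:E)) => [|j /PA//]; rewrite -big_seq /J big_map.
  by rewrite prodEFin big_const_seq count_predT size_iota iter_mulr_1.
exists bad; split.
- exact: (measurable_big_preimage indX).
- rewrite Pbad lee_fin.
  have nh : s * r / 2 <= n%:R by move: n2; rewrite -[n.+1%:R]natr1; lra.
  have sr0 : 0 < s * r / 2 by lra.
  have n0 : 0 < n%:R * p by rewrite mulr_gt0// (lt_le_trans sr0).
  apply: (@le_trans _ _ (n%:R * p)^-1).
    apply: (@le_trans _ _ (expR (- p) ^+ n)).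
      by rewrite lerXn2r ?nnegrE ?expR_ge0 ?expR_ge1Dx// subr_ge0.
    rewrite -expRM_natl mulrN expRN lef_pV2 ?posrE ?expR_gt0//.
    by apply: le_trans (expR_ge1Dx _); rewrite lerDr.
  have -> : 2 * (2 * s) `^ alpha / s = (s * r / 2 * p)^-1.
    by rewrite /p powRN; field; rewrite !gt_eqF ?powR_gt0 ?mulr_gt0.
  rewrite lef_pV2 ?posrE//; last by rewrite mulr_gt0.
  by rewrite ler_wpM2r ?(ltW p0).
- move=> w nbad; apply/not_existsP => H; apply: nbad; apply/mem_big_setI => j /mapP[i].
  rewrite mem_iota add0n => /andP[_ iin] ->; rewrite /A preimage_setC/= in_itv/= andbT => hi.
  by apply: (H i); split => //; apply: le_trans n1; rewrite ler_nat ltnW.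
Qed.

End field_events.

Lemma powRN_sub_le (R : realType) (alpha u h : R) : 0 <= alpha -> 0 < u -> 0 <= h ->
  u `^ (- alpha) - (u + h) `^ (- alpha) <= alpha * (h / u) * u `^ (- alpha).
Proof.
move=> al0 u0 h0; have hu : 0 <= h / u by rewrite divr_ge0// ltW.
have -> : u + h = u * (1 + h / u) by field; rewrite gt_eqF.
rewrite powRM ?(ltW u0)//; last by rewrite addr_ge0.
have p0 := powR_gt0 (- alpha) u0.
suff : 1 - alpha * (h / u) <= (1 + h / u) `^ (- alpha) by nra.
rewrite /powR gt_eqF; last by rewrite ltr_wpDr.
apply: le_trans (expR_ge1Dx _).
rewrite mulNr lerD2l lerN2 ler_wpM2l// le_ln1Dx// (lt_le_trans _ hu)//; lra.
Qed.

(** * Separation of the large values of the functional *)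

Section gap_event.
Context d (Omega : measurableType d) (R : realType) (P : probability Omega R).
Context (alpha : R) (X : int + nat -> Omega -> R).
Hypothesis al2 : 2 <= alpha.
Hypothesis indX : mutually_independent P X.
Hypothesis law : forall z, pareto P alpha X (inl z).
Context (a r t s g M C1 : R).
Hypotheses (a1 : 1 <= a) (rE : r = a `^ alpha) (t0 : 0 < t).
Hypotheses (s0 : 0 < s) (g0 : 0 < g) (sg : 20 * g <= s) (sa4 : 4 <= s * a).
Hypotheses (M0 : 0 < M) (Mr1 : 1 <= M * r) (tbig : 4 * (M * r) <= s * a * t) (C10 : 0 <= C1).
Local Notation xi0 z := (X (inl z)).
Local Notation likely := (likely P).

Let a0 : 0 < a. Proof. exact: lt_le_trans a1. Qed.
Let r0 : 0 < r. Proof. by rewrite rE powR_gt0. Qed.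
Let ga0 : 0 < g * a. Proof. exact: mulr_gt0. Qed.

Definition psi (y : nat) (x : R) := x - y%:R / t * ln x.

(* Windows of length [2 g a] at multiples of [g a]: two values of [psi] that are
   within [g a] of each other share one of boundedly many windows. *)
Definition level (j y : nat) : set R := [set x | [/\ 1 < x, s / 2 * a <= psi y x &
  j%:R * (g * a) <= psi y x <= j.+2%:R * (g * a)]].

(** The derivative [1 - y / (t x)] is at least [1 / 2]: by [tbig], [y / t] is at most [s a / 4],
    hence at most [x / 2]. *)
Lemma psi_expand (y : nat) (x x' : R) : y%:R <= M * r -> s / 2 * a <= x -> x <= x' ->
  (x' - x) / 2 <= psi y x' - psi y x.
Proof.
move=> yM sx xx'; have x0 : 0 < x by move: sx sa4; lra.
have x0' : 0 < x' by exact: lt_le_trans xx'.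
have yt0 : 0 <= y%:R / t by rewrite divr_ge0// ltW.
have yt : y%:R / t <= x / 2.
  rewrite ler_pdivrMr//; apply: (le_trans yM).
  have : s * a * t <= 2 * x * t by rewrite ler_wpM2r ?(ltW t0)//; move: sx; lra.
  by move: tbig; lra.
have h : ln x' - ln x <= (x' - x) / x.
  rewrite -ln_div ?posrE//; apply: le_trans (le_ln1Dx _); last first.
    by rewrite mulrBl mulfV ?gt_eqF// ltrBrDl subrr divr_gt0.
  by rewrite mulrBl mulfV ?gt_eqF// addrC subrK.
have : y%:R / t * (ln x' - ln x) <= x / 2 * ((x' - x) / x).
  by apply: ler_pM => //; rewrite subr_ge0 ler_ln.
have -> : x / 2 * ((x' - x) / x) = (x' - x) / 2 by field; rewrite gt_eqF.
rewrite /psi; lra.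
Qed.

Definition level_cost : R := 9 * alpha * (s / 4) `^ (- alpha - 1) * g / r.

Lemma level_cost_ge0 : 0 <= level_cost.
Proof.
rewrite /level_cost divr_ge0 ?(ltW r0)// !mulr_ge0 ?powR_ge0 ?(ltW g0)//.
exact: le_trans al2.
Qed.

(** A window has length [2 g a] and [psi] expands by at least [1 / 2], so all its points lie within
    [4 g a] of any one of them, [x1]. The interval is open on the left, whence the end [x1 - 5 g a]
    and the total length [9 g a]. An interval also spares a proof that [level] is measurable. *)
Lemma level_cover (j y : nat) : y%:R <= M * r -> exists S : set R,
  [/\ measurable S, level j y `<=` S & (P (xi0 y%:Z @^-1` S) <= level_cost%:E)%E].
Proof.
move=> yM; have [->|/set0P[x1 [x11 x1s /andP[x1j x1j']]]] := eqVneq (level j y) set0.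
  by exists set0; split => //; rewrite preimage_set0 measure0 lee_fin level_cost_ge0.
have psi_le x : 1 < x -> psi y x <= x.
  by move=> x1'; rewrite gerBl mulr_ge0 ?divr_ge0 ?(ltW t0)// ln_ge0// ltW.
pose u := x1 - 5 * (g * a); pose v := x1 + 4 * (g * a).
have gsa : 20 * g * a <= s * a by rewrite ler_wpM2r ?(ltW a0).
have x1s' := le_trans x1s (psi_le _ x11).
have us : s / 4 * a <= u by rewrite /u; move: x1s' gsa; lra.
have u1 : 1 <= u by move: us sa4; lra.
have uv : u <= v by rewrite /u /v; move: ga0; lra.
exists `]u, v]%classic; split => //.
  move=> x [x1' xs /andP[xj xj']] /=; rewrite in_itv/=.
  have xs' := le_trans xs (psi_le _ x1').
  rewrite -addn2 natrD mulrDl in x1j' xj'.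
  have [xx1|xx1] := leP x x1.
    by have := psi_expand yM xs' xx1; rewrite /u /v; move: ga0 x1j x1j' xj xj' => *; apply/andP; split; lra.
  by have := psi_expand yM x1s' (ltW xx1); rewrite /u /v; move: ga0 x1j x1j' xj xj' => *; apply/andP; split; lra.
pose Su := [set w | u < xi0 y%:Z w]; pose Sv := [set w | v < xi0 y%:Z w].
have mSv : measurable Sv by exact: (measurable_gt indX).
have mSu : measurable Su by exact: (measurable_gt indX).
have -> : xi0 y%:Z @^-1` `]u, v] = Su `\` Sv.
  apply/seteqP; split => w /=; rewrite in_itv/=.
    by move=> /andP[h1 h2]; split => //; apply/negP; rewrite -leNgt.
  by move=> [h1 /negP]; rewrite -leNgt => h2; apply/andP.
have SvSu : Sv `<=` Su by move=> w /=; exact: le_lt_trans.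
have PSu : P Su = (u `^ (- alpha))%:E by exact: law.
have PSv : P Sv = (v `^ (- alpha))%:E by exact: (law _ (le_trans u1 uv)).
have -> : P (Su `\` Sv) = ((u `^ (- alpha))%:E - (v `^ (- alpha))%:E)%E.
  rewrite -PSu -PSv -[X in (_ - P X)%E](setIidr SvSu); apply: measureD => //.
  by rewrite (le_lt_trans (probability_le1 _ _))// ltry.
rewrite -EFinB lee_fin.
have u0 : 0 < u by exact: lt_le_trans u1.
have al0 : 0 <= alpha by exact: le_trans al2.
have -> : v = u + 9 * (g * a) by rewrite /u /v; ring.
apply: (le_trans (powRN_sub_le al0 u0 _)); first by rewrite mulr_ge0// ltW.
have -> : alpha * (9 * (g * a) / u) * u `^ (- alpha) = alpha * (9 * (g * a)) * u `^ (- alpha - 1).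
  rewrite powRD; last by apply/implyP => _; rewrite gt_eqF.
  by rewrite powR_inv1 ?(ltW u0)//; ring.
apply: (@le_trans _ _ (alpha * (9 * (g * a)) * (s / 4 * a) `^ (- alpha - 1))).
  rewrite ler_wpM2l ?mulr_ge0 ?(ltW g0) ?(ltW a0)//.
  have -> : - alpha - 1 = - (alpha + 1) by ring.
  rewrite !powRN lef_pV2 ?posrE ?powR_gt0 ?mulr_gt0 ?divr_gt0//.
  have sa0 : 0 <= s / 4 * a by rewrite mulr_ge0 ?divr_ge0 ?(ltW s0) ?(ltW a0).
  by apply: ge0_ler_powR => //; rewrite ?nnegrE ?(ltW u0)// addr_ge0.
rewrite le_eqVlt; apply/orP; left; apply/eqP.
rewrite powRM ?divr_ge0 ?(ltW s0) ?(ltW a0)//.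
have -> : a `^ (- alpha - 1) = (r * a)^-1.
  rewrite powRD; last by apply/implyP => _; rewrite gt_eqF.
  by rewrite powR_inv1 ?(ltW a0)// powRN -rE -invfM.
by rewrite /level_cost; field; rewrite !gt_eqF.
Qed.

(** There are about [C1 / g] windows and [r ^ 2] pairs of sites, and a pair shares a given window
    with probability of order [(g / r) ^ 2]. The total is of order [g], independently of [r]. *)
Lemma likely_gap : likely ((C1 + g) * g * (18 * M * alpha * (s / 4) `^ (- alpha - 1)) ^+ 2)
  (fun w => (forall z, 1 < xi0 z w) ->
   (forall y : nat, y%:R <= M * r -> xi0 y%:Z w <= C1 * a) ->
   forall y z : nat, y != z -> y%:R <= M * r -> z%:R <= M * r ->
   s / 2 * a <= psi y (xi0 y%:Z w) -> s / 2 * a <= psi z (xi0 z%:Z w) ->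
   g * a < `|psi y (xi0 y%:Z w) - psi z (xi0 z%:Z w)|).
Proof.
pose n := (Num.truncn (M * r)).+1.
have Mr0 : 0 <= M * r by exact: le_trans Mr1.
have /truncn_itv/andP[n1 n2] := Mr0.
pose J := (Num.truncn (C1 / g)).+1.
have /truncn_itv/andP[J1 J2] : 0 <= C1 / g by rewrite divr_ge0// ltW.
pose bad j y z w := y != z -> ~ (level j y (xi0 y%:Z w) /\ level j z (xi0 z%:Z w)).
have in_n (y : nat) : y \in iota 0 n -> y%:R <= M * r.
  rewrite mem_iota/= add0n /n ltnS => yn; apply: le_trans n1; by rewrite ler_nat.
have step j y z : y \in iota 0 n -> z \in iota 0 n -> likely (level_cost ^+ 2) (bad j y z).
  move=> yn zn; have [yz|yz] := eqVneq y z.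
    exists set0; split => //; first by rewrite measure0 lee_fin sqr_ge0.
    by move=> w _; rewrite /bad yz eqxx.
  have [S [mS lS PS]] := level_cover j (in_n _ yn).
  have [S' [mS' lS' PS']] := level_cover j (in_n _ zn).
  pose A (i : int + nat) := if i == inl y%:Z then S else S'.
  have uJ : uniq [:: inl y%:Z; inl z%:Z : int + nat].
    by rewrite /= inE andbT; apply/eqP => -[] /eqP; rewrite (negbTE yz).
  have mA i : i \in [:: inl y%:Z; inl z%:Z : int + nat] -> measurable (A i).
    by rewrite /A; case: ifP.
  have Az : A (inl z%:Z) = S' by rewrite /A; case: eqP => // -[] /eqP; rewrite eq_sym (negbTE yz).
  have Ay : A (inl y%:Z) = S by rewrite /A eqxx.
  have := indX.2 _ A uJ mA; rewrite !big_cons !big_nil setIT mule1 Ay Az => PE.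
  exists (xi0 y%:Z @^-1` S `&` xi0 z%:Z @^-1` S'); split.
  - by apply: measurableI; exact: (measurable_indX indX).
  - by rewrite [X in (X <= _)%E]PE expr2 EFinM; apply: lee_pmul.
  - by move=> w nw _ [/lS ? /lS' ?]; apply: nw.
have cost : \sum_(j <- iota 0 J) \sum_(y <- iota 0 n) \sum_(z <- iota 0 n) level_cost ^+ 2 <=
  (C1 + g) * g * (18 * M * alpha * (s / 4) `^ (- alpha - 1)) ^+ 2.
  rewrite !big_const_seq !count_predT !size_iota !iter_addr_0.
  set lc := level_cost ^+ 2.
  have -> : lc *+ n *+ n *+ J = J%:R * n%:R ^+ 2 * lc by rewrite -3!mulr_natl; ring.
  have nM : n%:R <= 2 * (M * r) by rewrite /n -[X in X <= _]natr1; move: n1 Mr1; lra.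
  have JC : J%:R * g <= C1 + g.
    by rewrite /J -natr1 mulrDl mul1r lerD2r -ler_pdivlMr.
  have -> : (C1 + g) * g * (18 * M * alpha * (s / 4) `^ (- alpha - 1)) ^+ 2 =
     ((C1 + g) / g * (2 * (M * r)) ^+ 2) * level_cost ^+ 2.
    by rewrite /level_cost; field; rewrite !gt_eqF.
  rewrite ler_wpM2r ?sqr_ge0//; apply: ler_pM; rewrite ?sqr_ge0 ?ler_pdivlMr//.
  by rewrite lerXn2r ?nnegrE ?mulr_ge0 ?(ltW M0) ?(ltW r0).
apply: likely_le cost _.
apply: likely_sub (@likely_seq _ _ _ P _ (iota 0 J) _ (fun j w => forall y, y \in iota 0 n ->
   forall z, z \in iota 0 n -> bad j y z w) _); last first.
  move=> j _; apply: (@likely_seq _ _ _ P _ (iota 0 n) _ (fun y w => forall z, z \in iota 0 n -> bad j y z w)).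
  move=> y yn; apply: (@likely_seq _ _ _ P _ (iota 0 n) _ (fun z w => bad j y z w)).
  by move=> z zn; exact: step.
move=> w Hw gt1 le1 y z yz yM zM ys zs; rewrite ltNge; apply/negP => close.
wlog le_yz : y z yz yM zM ys zs close / psi y (xi0 y%:Z w) <= psi z (xi0 z%:Z w).
  move=> W; have [h|/ltW h] := leP (psi y (xi0 y%:Z w)) (psi z (xi0 z%:Z w)); first exact: (W y z).
  by apply: (W z y) => //; rewrite 1?eq_sym 1?distrC.
have to_n (x : nat) : x%:R <= M * r -> x \in iota 0 n.
  by move=> xM; rewrite mem_iota/= add0n -(ltr_nat R); exact: le_lt_trans n2.
pose j := Num.truncn (psi y (xi0 y%:Z w) / (g * a)).
have p0 : 0 <= psi y (xi0 y%:Z w).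
  by apply: le_trans ys; rewrite mulr_ge0 ?divr_ge0 ?(ltW s0) ?(ltW a0).
have /truncn_itv/andP[j1 j2] : 0 <= psi y (xi0 y%:Z w) / (g * a) by rewrite divr_ge0// ltW.
have psi_le : psi y (xi0 y%:Z w) <= C1 * a.
  apply: le_trans (le1 _ yM).
  by rewrite gerBl mulr_ge0 ?divr_ge0 ?(ltW t0)// ln_ge0// ltW.
have jJ : j \in iota 0 J.
  rewrite mem_iota/= add0n -(ltr_nat R); apply: le_lt_trans J2; apply: (le_trans j1).
  by rewrite ler_pdivrMr// mulrA divfK ?gt_eqF.
apply: (Hw j jJ y (to_n _ yM) z (to_n _ zM) yz).
rewrite distrC ger0_norm ?subr_ge0// in close.
rewrite ler_pdivlMr// in j1; rewrite ltr_pdivrMr// in j2.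
have j2E : j.+2%:R * (g * a) = j.+1%:R * (g * a) + g * a by rewrite -[j.+2%:R]natr1 mulrDl mul1r.
by split; split => //; rewrite ?gt1//; apply/andP; split; rewrite ?j2E; lra.
Qed.

End gap_event.

(** * Exclusive sites *)

Section exchange_sums.
Context (R : realType) (a : R).

(* Truncation at [a] makes second moments finite; on typical environments it is
   inactive at the sites where the coin breaks the symmetry. *)
Definition trunc (x : R) : R := Num.max 1 (Num.min x a).

Definition off : set R := ~` [set 1].

Lemma measurable_off : measurable off.
Proof. by apply: measurableC; exact: measurable_set1. Qed.

Lemma trunc_ge1 x : 1 <= trunc x. Proof. by rewrite /trunc le_max lexx. Qed.

Lemma trunc_le x : 1 <= a -> trunc x <= a.
Proof. by move=> a1; rewrite /trunc ge_max a1 ge_min lexx orbT. Qed.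

Lemma trunc_id x : 1 < x -> trunc x < a -> trunc x = x.
Proof.
rewrite /trunc => x1; have [xa|ax] := leP x a; first by rewrite max_r// ltW.
by rewrite gt_max ltxx andbF.
Qed.

Lemma measurable_trunc : measurable_fun setT trunc.
Proof. by apply: measurable_maxr => //; exact: measurable_minr. Qed.

(** Dyadic layers: once [x] exceeds [2 ^ j], the square of its truncation at [2 ^ (j + 1)] is at
    most [4 ^ (j + 1)]. This reduces second moments to finitely many tail probabilities. *)
Lemma trunc_sqr_le (x : R) (J : nat) : a <= 2 ^+ J ->
  trunc x ^+ 2 <= 1 + \sum_(j < J) 4 ^+ j.+1 * \1_(`]2 ^+ j, +oo[) x.
Proof.
move=> aJ; have t0 u : 0 <= Num.max 1 u :> R by rewrite le_max ler01.
apply: (@le_trans _ _ (Num.max 1 (Num.min x (2 ^+ J)) ^+ 2)).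
  apply: lerXn2r; rewrite ?nnegrE ?t0//.
  have h : Num.min x a <= Num.min x (2 ^+ J) by rewrite le_min ge_min lexx/= ge_min aJ orbT.
  by rewrite /trunc ge_max !le_max lexx/= h orbT.
elim: J {aJ} => [|J IH]; first by rewrite big_ord0 addr0 expr0 max_l ?expr1n// ge_min lexx orbT.
rewrite big_ord_recr/=; have [xJ|Jx] := leP x (2 ^+ J).
  rewrite (min_l (le_trans xJ _)); last by rewrite ler_eXn2l ?ltr1n.
  rewrite (min_l xJ) in IH; apply: (le_trans IH); rewrite addrA lerDl.
  by rewrite mulr_ge0 ?exprn_ge0// indicE.
have -> : \1_(`]2 ^+ J, +oo[) x = 1 :> R by rewrite indicE mem_set//= in_itv/= Jx.
apply: (@le_trans _ _ (4 ^+ J.+1)); last first.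
  rewrite mulr1 addrA lerDr addr_ge0// sumr_ge0//.
have -> : 4 = 2 ^+ 2 :> R by ring.
rewrite exprAC; apply: lerXn2r; rewrite ?nnegrE ?t0 ?exprn_ge0//.
by rewrite ge_max exprn_ege1 ?ler1n// ge_min lexx orbT.
Qed.

(* [k] stands for the pair of sites [k + 1] and [- (k + 1)], which is governed
   by the coin of index [k]. *)
Section coordinates.
Context (T : Type) (X : int + nat -> T -> R).
Local Notation site y := (X (inl y)).

Definition exch (k : nat) (y : int) (w : T) : R := \1_off (X (inr k) w) * trunc (site y w).
Definition right_site (k : nat) := exch k (Posz k.+1).
Definition left_site (k : nat) := exch k (- k.+1%:Z).
Definition exch_sum (n : nat) (w : T) : R := \sum_(k < n) (right_site k w - left_site k w).

Lemma exch_ge0 k y w : 0 <= exch k y w.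
Proof.
by rewrite /exch mulr_ge0//; exact: le_trans ler01 (trunc_ge1 _).
Qed.

Lemma exch_le k y w : 1 <= a -> exch k y w <= a.
Proof.
move=> a1; rewrite -[leRHS]mul1r; apply: ler_pM; rewrite ?trunc_le//.
exact: le_trans ler01 (trunc_ge1 _).
Qed.

Lemma exch_sum0 w : exch_sum 0 w = 0.
Proof. by rewrite /exch_sum big_ord0. Qed.

Lemma exch_sumS n w : exch_sum n.+1 w = exch_sum n w + (right_site n w - left_site n w).
Proof. by rewrite /exch_sum big_ord_recr. Qed.

Lemma exch_sum_le n w : 1 <= a -> exch_sum n w <= n%:R * a.
Proof.
move=> a1; have -> : n%:R * a = \sum_(k < n) a by rewrite mulr_natl sumr_const card_ord.
by apply: ler_sum => k _; have := exch_le k (Posz k.+1) w a1; have := exch_ge0 k (- k.+1%:Z) w;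
  rewrite /right_site /left_site; lra.
Qed.

Lemma exch_sum_ge n w : 1 <= a -> 0 <= exch_sum n w + n%:R * a.
Proof.
move=> a1; rewrite -lerBlDr sub0r -mulNr.
have -> : - n%:R * a = \sum_(k < n) - a by rewrite sumr_const card_ord -mulr_natl; ring.
by apply: ler_sum => k _; have := exch_ge0 k k.+1 w; have := exch_le k (- k.+1%:Z) w a1;
  rewrite /right_site /left_site; lra.
Qed.

End coordinates.

Lemma measurable_exch d (T : measurableType d) (X : int + nat -> T -> R) k y :
  measurable_fun setT (X (inr k)) -> measurable_fun setT (X (inl y)) ->
  measurable_fun setT (exch X k y).
Proof.
move=> mk my; apply: measurable_funM; apply: measurableT_comp => //.
  by apply: measurable_indic; exact: measurable_off.
exact: measurable_trunc.
Qed.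

Lemma measurable_exch_sum d (T : measurableType d) (X : int + nat -> T -> R) n :
  (forall k, (k < n)%N -> measurable_fun setT (X (inr k))) ->
  (forall k, (k < n)%N -> measurable_fun setT (X (inl (Posz k.+1)))) ->
  (forall k, (k < n)%N -> measurable_fun setT (X (inl (- k.+1%:Z)))) ->
  measurable_fun setT (exch_sum X n).
Proof.
elim: n => [|n IH] m1 m2 m3.
  rewrite (_ : exch_sum X 0 = cst 0)//; last by apply/funext => w; rewrite /exch_sum big_ord0.
rewrite (_ : exch_sum X n.+1 = (exch_sum X n \+ (right_site X n \- left_site X n))); last first.
  by apply/funext => w; rewrite /exch_sum big_ord_recr.
apply: measurable_funD; last by apply: measurable_funB; apply: measurable_exch; auto.
by apply: IH => k kn; [apply: m1|apply: m2|apply: m3]; exact: ltnW.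
Qed.

End exchange_sums.

Section exchange_moments.
Context d (Omega : measurableType d) (R : realType) (P : probability Omega R).
Context (alpha : R) (X : int + nat -> Omega -> R) (q : nat -> R) (a : R) (J : nat).
Hypothesis indX : mutually_independent P X.
Hypothesis law : forall z, pareto P alpha X (inl z).
Hypothesis coin : forall k, P (X (inr k) @^-1` @off R) = (q k)%:E.
Hypothesis aJ : a <= 2 ^+ J.
Local Notation exch := (exch a X).

(** Upper bound for the second moment of a truncated Pareto variable, layer by layer. As [J] grows
    it stays bounded if [alpha > 2] and is linear in [J] if [alpha = 2]. *)
Definition dyadic_moment : R := 1 + \sum_(j < J) 4 ^+ j.+1 * (2 ^+ j) `^ (- alpha).

Let mX i : measurable_fun setT (X i). Proof. exact: indX.1. Qed.

(** The event on [X i] will be that a candidate site is high. The three coordinates are distinct, so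
    the probability of each dyadic layer is a product. *)
Lemma exch_moment (i : int + nat) (S : set R) (k : nat) (y : int) (pS : R) :
  measurable S -> i != inr k -> i != inl y -> P (X i @^-1` S) = pS%:E ->
  (\int[P]_w (\1_S (X i w) * exch k y w ^+ 2)%:E <= (pS * (q k * dyadic_moment))%:E)%E.
Proof.
move=> mS ik iy PS.
pose G (j : nat) := (X i @^-1` S) `&` (X (inr k) @^-1` @off R) `&`
  (X (inl y) @^-1` (if j is j.+1 then `]2 ^+ j, +oo[ else setT)).
pose c (j : nat) : R := if j is j.+1 then 4 ^+ j.+1 else 1.
have mG j : measurable (G j).
  apply: measurableI; [apply: measurableI|].
  - exact: (measurable_indX indX).
  - by apply: (measurable_indX indX); exact: measurable_off.
  - by apply: (measurable_indX indX); case: j => [|j]; [exact: measurableT|exact: measurable_itv].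
have c0 j : 0 <= c j by case: j => [|j]; rewrite /= ?exprn_ge0.
have PG j : P (G j) = (pS * q k * (if j is j.+1 then (2 ^+ j) `^ (- alpha) else 1))%:E.
  pose A (l : int + nat) : set R := if l == i then S else if l == inr k then @off R
    else if j is j.+1 then `]2 ^+ j, +oo[%classic else setT.
  have uJ : uniq [:: i; inr k; inl y] by rewrite /= !inE negb_or ik iy.
  have mA l : l \in [:: i; inr k; inl y] -> measurable (A l).
    rewrite /A => _; case: ifP => // _; case: ifP => _; first exact: measurable_off.
    by case: (j) => [|?]; [exact: measurableT|exact: measurable_itv].
  have := indX.2 _ A uJ mA; rewrite !big_cons !big_nil setIT mule1.
  rewrite /A !eqxx [inr k == i]eq_sym (negbTE ik) [inl y == i]eq_sym (negbTE iy)/=.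
  rewrite setIA -/(G j) => ->; rewrite PS coin !EFinM muleA; congr (_ * _)%E.
  case: (j) => [|m]; first by rewrite preimage_setT probability_setT.
  rewrite -(law y (exprn_ege1 m _)) ?ler1n//; congr (P _).
  by apply/seteqP; split => w /=; rewrite in_itv/= andbT.
have IG j : (\int[P]_w (\1_(G j) w)%:E)%E =
    (pS * q k * (if j is j.+1 then (2 ^+ j) `^ (- alpha) else 1))%:E.
  by rewrite integral_indic// setIT; exact: PG.
apply: (@le_trans _ _ (\int[P]_w (\sum_(j < J.+1) (c j)%:E * (\1_(G j) w)%:E))%E).
  apply: ge0_le_integral => //.
  - by move=> w _; rewrite lee_fin mulr_ge0 ?sqr_ge0// indicE.
  - apply/measurable_EFinP/measurable_funM.
      by apply: measurableT_comp => //; exact: measurable_indic.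
    by apply: measurable_funX; exact: measurable_exch.
  - apply: emeasurable_sum => j; apply: measurable_funeM.
    by apply/measurable_EFinP; exact: measurable_indic.
  move=> w _; under eq_bigr do rewrite -EFinM; rewrite sumEFin lee_fin.
  have GE j : \1_(G j) w = \1_S (X i w) * \1_(@off R) (X (inr k) w) *
      (if j is j.+1 then \1_(`]2 ^+ j, +oo[) (X (inl y) w) else 1) :> R.
    rewrite /G indicI /= indicI /=; congr (_ * _ * _).
    by case: (j) => [|m] //; rewrite preimage_setT indicT.
  rewrite big_ord_recl GE/= mul1r mulr1.
  have -> : exch k y w = \1_(@off R) (X (inr k) w) * trunc a (X (inl y) w) by [].
  set u := \1_S _; set v := \1_(@off R) _.
  have u0 : 0 <= u by rewrite /u indicE.
  have vv : v ^+ 2 = v by rewrite /v indicE; case: (_ \in _); rewrite ?expr1n ?expr0n.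
  rewrite exprMn vv mulrA.
  have -> : \sum_(j < J) c (bump 0 j) * \1_(G (bump 0 j)) w =
      u * v * \sum_(j < J) 4 ^+ j.+1 * \1_(`]2 ^+ j, +oo[) (X (inl y) w).
    by rewrite mulr_sumr; apply: eq_bigr => j _; rewrite GE/= mulrCA.
  rewrite -[X in _ <= X + _]mulr1 -mulrDr ler_wpM2l ?trunc_sqr_le//.
  by rewrite mulr_ge0// /v indicE.
rewrite ge0_integral_sum//; last 2 first.
- move=> j; apply: measurable_funeM.
  by apply/measurable_EFinP; exact: measurable_indic.
- by move=> j w _; rewrite -EFinM lee_fin mulr_ge0// indicE.
under eq_bigr => j _.
  rewrite ge0_integralZl//; last 2 first.
  - by apply/measurable_EFinP; exact: measurable_indic.
  - by rewrite lee_fin.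
  rewrite IG -EFinM.
  over.
rewrite sumEFin lee_fin big_ord_recl/= /dyadic_moment.
rewrite mul1r mulr1 mulrA mulrDr mulr1 mulr_sumr lerD2l; apply: ler_sum => j _.
by rewrite mulrCA.
Qed.

End exchange_moments.

Section real_integrals.
Context d (Omega : measurableType d) (R : realType) (P : probability Omega R).
Implicit Types f g : Omega -> R.

Lemma integralD_EFin f g : measurable_fun setT f -> measurable_fun setT g ->
  (forall w, 0 <= f w) -> (forall w, 0 <= g w) ->
  (\int[P]_w (f w + g w)%:E = \int[P]_w (f w)%:E + \int[P]_w (g w)%:E)%E.
Proof.
move=> mf mg f0 g0; under eq_integral do rewrite EFinD.
by rewrite ge0_integralD//; try (by apply/measurable_EFinP); move=> w _; rewrite lee_fin.
Qed.

Lemma integralZ_EFin f (c : R) : measurable_fun setT f -> (forall w, 0 <= f w) -> 0 <= c ->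
  (\int[P]_w (c * f w)%:E = c%:E * \int[P]_w (f w)%:E)%E.
Proof.
move=> mf f0 c0; under eq_integral do rewrite EFinM.
by rewrite ge0_integralZl//; [exact/measurable_EFinP|move=> w _; rewrite lee_fin].
Qed.

Lemma integral_le_EFin f g : measurable_fun setT f -> measurable_fun setT g ->
  (forall w, 0 <= f w) -> (forall w, f w <= g w) ->
  (\int[P]_w (f w)%:E <= \int[P]_w (g w)%:E)%E.
Proof.
move=> mf mg f0 fg; apply: ge0_le_integral => //; try (by apply/measurable_EFinP).
- by move=> w _; rewrite lee_fin.
- by move=> w _; rewrite lee_fin.
Qed.

Lemma integral_fin_num f (c : R) : measurable_fun setT f -> (forall w, 0 <= f w) ->
  (forall w, f w <= c) -> (\int[P]_w (f w)%:E)%E \is a fin_num.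
Proof.
move=> mf f0 fc; rewrite ge0_fin_numE; last first.
  by apply: integral_ge0 => w _; rewrite lee_fin.
apply: (@le_lt_trans _ _ (\int[P]_w c%:E)%E); first exact: integral_le_EFin.
by rewrite integral_cst// [X in (_ * X)%E]probability_setT mule1 ltry.
Qed.

End real_integrals.

Section swap.
Context d (Omega : measurableType d) (R : realType) (P : probability Omega R).
Context (alpha : R) (X : int + nat -> Omega -> R) (q : nat -> R) (a : R) (J : nat).
Hypothesis indX : mutually_independent P X.
Hypothesis law : forall z, pareto P alpha X (inl z).
Hypothesis coin : forall k, P (X (inr k) @^-1` @off R) = (q k)%:E.
Hypotheses (a1 : 1 <= a) (aJ : a <= 2 ^+ J).

Let mX i : measurable_fun setT (X i). Proof. exact: indX.1. Qed.

Let mtr y : measurable_fun setT (fun w => trunc a (X (inl y) w)).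
Proof. by apply: measurableT_comp => //; exact: measurable_trunc. Qed.

(** Equal tails give equal means through the layer-cake formula; the level [r] is below 1, between 1
    and [a], or at least [a]. *)
Lemma trunc_mean (y z : int) :
  (\int[P]_w (trunc a (X (inl y) w))%:E = \int[P]_w (trunc a (X (inl z) w))%:E)%E.
Proof.
pose T y : {RV P >-> R} := mfun_Sub (mem_set (mtr y)).
have TE x w : T x w = trunc a (X (inl x) w) by [].
have ET x : ('E_P[T x] = \int[P]_w (trunc a (X (inl x) w))%:E)%E by rewrite expectation_def.
rewrite -!ET !ge0_expectation_ccdf; try by move=> w; rewrite TE (le_trans ler01)// trunc_ge1.
apply: eq_integral => r _; rewrite /ccdf /distribution /= /pushforward.
have [r1|r1] := ltP r 1.
  suff E x : (fun w => trunc a (X (inl x) w)) @^-1` `]r, +oo[ = setT by rewrite !E.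
  apply/seteqP; split => // w _ /=; rewrite in_itv/= andbT.
  exact: lt_le_trans (trunc_ge1 _ _).
have [ra|ar] := ltP r a; last first.
  suff E x : (fun w => trunc a (X (inl x) w)) @^-1` `]r, +oo[ = set0 by rewrite !E.
  apply/seteqP; split => // w /=; rewrite in_itv/= andbT.
  by rewrite ltNge (le_trans (trunc_le _ a1)).
suff E x : (fun w => trunc a (X (inl x) w)) @^-1` `]r, +oo[ = [set w | r < X (inl x) w].
  by rewrite !E; have [-> ->] := (law y r1, law z r1).
apply/seteqP; split => w /=; rewrite in_itv/= andbT /trunc lt_max lt_min ra andbT.
  by rewrite ltNge r1.
by move=> ->; rewrite orbT.
Qed.

Lemma integral_mul_trunc (y : int) (F : space_but X (inl y) -> R) : measurable_fun setT F ->
  (forall w, 0 <= F w) ->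
  (\int[P]_w (F w * trunc a (X (inl y) w))%:E =
   \int[P]_w (F w)%:E * \int[P]_w (trunc a (X (inl y) w))%:E)%E.
Proof.
move=> mF F0; have tr0 x : 0 <= trunc a x by rewrite (le_trans ler01)// trunc_ge1.
pose f (z : R * space_but X (inl y)) : \bar R := (F z.2 * trunc a z.1)%:E.
have mf : measurable_fun setT f.
  apply/measurable_EFinP/measurable_funM; apply: measurableT_comp => //.
  exact: measurable_trunc.
have mF' : measurable_fun setT (F : Omega -> R).
  apply: (@measurableT_comp _ _ _ _ _ _ F _ (idfun : Omega -> space_but X (inl y))) => //.
  exact: (measurable_fun_to_but indX).
transitivity (\int[P]_w f (X (inl y) w, w))%E; first by [].
rewrite (indep_integral indX mf); last by move=> z; rewrite lee_fin mulr_ge0.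
rewrite /f /=.
have IF0 : (0 <= \int[P]_w (F w)%:E)%E by apply: integral_ge0 => w _; rewrite lee_fin.
transitivity (\int[P]_w' ((\int[P]_w (F w)%:E) * (trunc a (X (inl y) w'))%:E))%E.
  apply: eq_integral => w' _; under eq_integral do rewrite mulrC.
  by rewrite integralZ_EFin// muleC.
rewrite ge0_integralZl//; first exact/measurable_EFinP.
by move=> w _; rewrite lee_fin.
Qed.

(** As [F] is determined without either site, each truncated value integrates out separately, to the
    same mean. *)
Lemma integral_swap (y z : int) (F : Omega -> R) :
  measurable_fun setT (F : space_but X (inl y) -> R) ->
  measurable_fun setT (F : space_but X (inl z) -> R) -> (forall w, 0 <= F w) ->
  (\int[P]_w (F w * trunc a (X (inl y) w))%:E = \int[P]_w (F w * trunc a (X (inl z) w))%:E)%E.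
Proof. by move=> my mz F0; rewrite !integral_mul_trunc// (trunc_mean y z). Qed.

Local Notation exch := (exch a X).
Local Notation exch_sum := (exch_sum a X).
Local Notation V := (dyadic_moment alpha J).
Hypothesis al0 : 0 <= alpha.

(* The cross term of the square vanishes because the two new sites can be
   swapped; [T >= 0] keeps all integrands nonnegative. *)
Lemma exch_sum_moment (z : int) (S : set R) (n : nat) (pS : R) : measurable S ->
  P (X (inl z) @^-1` S) = pS%:E ->
  (forall k, (k < n)%N -> z != Posz k.+1) -> (forall k, (k < n)%N -> z != - k.+1%:Z) ->
  (\int[P]_w (\1_S (X (inl z) w) * exch_sum n w ^+ 2)%:E <=
   (pS * (2 * V * \sum_(k < n) q k))%:E)%E.
Proof.
move=> mS PS; elim: n => [|n IH] zr zl.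
  rewrite big_ord0 !mulr0 integral0_eq// => w _.
  by rewrite exch_sum0 expr0n mulr0.
have zr' k : (k < n)%N -> z != Posz k.+1 by move=> kn; apply: zr; exact: ltnW.
have zl' k : (k < n)%N -> z != - k.+1%:Z by move=> kn; apply: zl; exact: ltnW.
have {}IH := IH zr' zl'.
pose I w : R := \1_S (X (inl z) w).
pose C := n%:R * a; pose T w := exch_sum n w + C.
pose u := exch n (Posz n.+1); pose v := exch n (- n.+1%:Z).
have C0 : 0 <= C by rewrite mulr_ge0// (le_trans ler01).
have I0 w : 0 <= I w by rewrite /I indicE.
have I1 w : I w <= 1 by rewrite /I indicE lern1 leq_b1.
have T0 w : 0 <= T w by exact: exch_sum_ge.
have TC w : T w <= 2 * C by have := exch_sum_le X n w a1; rewrite /T -/C; lra.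
have u0 w : 0 <= u w by exact: exch_ge0.
have v0 w : 0 <= v w by exact: exch_ge0.
have ua w : u w <= a by exact: exch_le.
have mI : measurable_fun setT I by apply: measurableT_comp => //; exact: measurable_indic.
have mS' : measurable_fun setT (exch_sum n) by apply: measurable_exch_sum.
have mT : measurable_fun setT T by apply: measurable_funD.
have mu : measurable_fun setT u by exact: measurable_exch.
have mv : measurable_fun setT v by exact: measurable_exch.
have mbut y : z != y -> (y = Posz n.+1 \/ y = - n.+1%:Z) ->
  measurable_fun setT ((fun w => I w * \1_(@off R) (X (inr n) w)) : space_but X (inl y) -> R) /\
  measurable_fun setT ((fun w => I w * T w * \1_(@off R) (X (inr n) w)) : space_but X (inl y) -> R).
  move=> zy yn; have mb i : i != inl y -> measurable_fun setT (X i : space_but X (inl y) -> R).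
    exact: measurable_fun_but.
  have mI' : measurable_fun setT (I : space_but X (inl y) -> R).
    apply: measurableT_comp; first exact: measurable_indic.
    by apply: mb; apply: contra zy => /eqP[->].
  have mo : measurable_fun setT ((fun w => \1_(@off R) (X (inr n) w)) : space_but X (inl y) -> R).
    apply: measurableT_comp; first by apply: measurable_indic; exact: measurable_off.
    exact: mb.
  split; first exact: measurable_funM.
  apply: measurable_funM => //; apply: measurable_funM => //; apply: measurable_funD => //.
  apply: (@measurable_exch_sum _ _ _ (space_but X (inl y)) X n) => k kn; apply: mb => //;
    apply/eqP => -[] ky; move: kn; case: yn => yE; rewrite yE in ky; lia.
have [zn znN] := (zr n (ltnSn n), zl n (ltnSn n)).
have [m1 m2] := mbut _ zn (or_introl erefl).
have [m1' m2'] := mbut _ znN (or_intror erefl).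
have o0 w : 0 <= \1_(@off R) (X (inr n) w) :> R by rewrite indicE.
have UE : (\int[P]_w (I w * T w * u w)%:E = \int[P]_w (I w * T w * v w)%:E)%E.
  have := integral_swap m2 m2' (fun w => mulr_ge0 (mulr_ge0 (I0 w) (T0 w)) (o0 w)).
  by under eq_integral do rewrite -mulrA; under [X in _ = X -> _]eq_integral do rewrite -mulrA.
have VE : (\int[P]_w (I w * u w)%:E = \int[P]_w (I w * v w)%:E)%E.
  have := integral_swap m1 m1' (fun w => mulr_ge0 (I0 w) (o0 w)).
  by under eq_integral do rewrite -mulrA; under [X in _ = X -> _]eq_integral do rewrite -mulrA.
have mIu : measurable_fun setT (fun w => I w * u w) by exact: measurable_funM.
have mIv : measurable_fun setT (fun w => I w * v w) by exact: measurable_funM.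
have mITu : measurable_fun setT (fun w => I w * T w * u w).
  by apply: measurable_funM => //; exact: measurable_funM.
have mITv : measurable_fun setT (fun w => I w * T w * v w).
  by apply: measurable_funM => //; exact: measurable_funM.
have mIuu : measurable_fun setT (fun w => I w * u w ^+ 2).
  by apply: measurable_funM => //; exact: measurable_funX.
have mIvv : measurable_fun setT (fun w => I w * v w ^+ 2).
  by apply: measurable_funM => //; exact: measurable_funX.
have mISS : measurable_fun setT (fun w => I w * exch_sum n w ^+ 2).
  by apply: measurable_funM => //; exact: measurable_funX.
have mISS' : measurable_fun setT (fun w => I w * exch_sum n.+1 w ^+ 2).
  apply: measurable_funM => //; apply: measurable_funX.
  by apply: measurable_exch_sum.
have Iu0 w : 0 <= I w * u w by rewrite mulr_ge0.
have Iv0 w : 0 <= I w * v w by rewrite mulr_ge0.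
have ITu0 w : 0 <= I w * T w * u w by apply: mulr_ge0 => //; exact: mulr_ge0.
have ITv0 w : 0 <= I w * T w * v w by apply: mulr_ge0 => //; exact: mulr_ge0.
have sq0 (f : Omega -> R) w : 0 <= I w * f w ^+ 2 by rewrite mulr_ge0 ?sqr_ge0.
have C20 : 0 <= 2 * C by rewrite mulr_ge0.
(* The square is expanded with [exch_sum n = T - C]; negative terms are moved to the left and
   [- 2 u v] is dropped. After integration the mixed terms on both sides coincide by [UE] and [VE],
   and they cancel because they are finite. *)
have key w : I w * exch_sum n.+1 w ^+ 2 + (2 * (I w * T w * v w) + 2 * C * (I w * u w)) <=
  I w * exch_sum n w ^+ 2 + (I w * u w ^+ 2 + I w * v w ^+ 2) +
    (2 * (I w * T w * u w) + 2 * C * (I w * v w)).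
  have -> : exch_sum n.+1 w = exch_sum n w + (u w - v w) by exact: exch_sumS.
  rewrite /T -subr_ge0.
  set s := exch_sum n w; rewrite (_ : _ - _ = 2 * (I w * (u w * v w))); last by ring.
  by do 2!(apply: mulr_ge0 => //); exact: mulr_ge0.
have fU : (\int[P]_w (I w * T w * u w)%:E)%E \is a fin_num.
  apply: (@integral_fin_num _ _ _ _ _ (2 * C * a)) => // w.
  apply: ler_pM => //; first exact: mulr_ge0.
  by rewrite -[leRHS]mul1r; apply: ler_pM.
have fV : (\int[P]_w (I w * u w)%:E)%E \is a fin_num.
  apply: (@integral_fin_num _ _ _ _ _ a) => // w.
  by rewrite -[leRHS]mul1r; apply: ler_pM.
have m2u : measurable_fun setT (fun w => 2 * (I w * T w * u w)) by exact: measurable_funM.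
have m2v : measurable_fun setT (fun w => 2 * (I w * T w * v w)) by exact: measurable_funM.
have mCu : measurable_fun setT (fun w => 2 * C * (I w * u w)) by exact: measurable_funM.
have mCv : measurable_fun setT (fun w => 2 * C * (I w * v w)) by exact: measurable_funM.
have W0 w : 0 <= 2 * (I w * T w * v w) + 2 * C * (I w * u w) by rewrite addr_ge0// mulr_ge0.
have W0' w : 0 <= 2 * (I w * T w * u w) + 2 * C * (I w * v w) by rewrite addr_ge0// mulr_ge0.
have mW : measurable_fun setT (fun w => 2 * (I w * T w * v w) + 2 * C * (I w * u w)).
  exact: measurable_funD.
have mW' : measurable_fun setT (fun w => 2 * (I w * T w * u w) + 2 * C * (I w * v w)).
  exact: measurable_funD.
have msq : measurable_fun setT (fun w => I w * u w ^+ 2 + I w * v w ^+ 2) by exact: measurable_funD.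
have msq' : measurable_fun setT (fun w => I w * exch_sum n w ^+ 2 + (I w * u w ^+ 2 + I w * v w ^+ 2)).
  exact: measurable_funD.
have sq0' w : 0 <= I w * u w ^+ 2 + I w * v w ^+ 2 by rewrite addr_ge0.
have sq0'' w : 0 <= I w * exch_sum n w ^+ 2 + (I w * u w ^+ 2 + I w * v w ^+ 2) by rewrite addr_ge0.
have WE (f g : Omega -> R) : measurable_fun setT f -> measurable_fun setT g ->
    (forall w, 0 <= f w) -> (forall w, 0 <= g w) ->
    (\int[P]_w (2 * f w + 2 * C * g w)%:E =
     2%:E * \int[P]_w (f w)%:E + (2 * C)%:E * \int[P]_w (g w)%:E)%E.
  move=> mf mg f0 g0; rewrite integralD_EFin; try exact: measurable_funM; try by move=> w; exact: mulr_ge0.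
  by rewrite !integralZ_EFin.
have := integral_le_EFin P (measurable_funD mISS' mW) (measurable_funD msq' mW')
  (fun w => addr_ge0 (sq0 _ w) (W0 w)) key.
rewrite integralD_EFin// WE// [in X in (_ <= X -> _)%E]integralD_EFin//.
rewrite WE// UE VE.
rewrite UE VE in fU fV.
rewrite leeD2rE; last by rewrite fin_numD !fin_numM.
move/le_trans; apply.
rewrite integralD_EFin// integralD_EFin// big_ord_recr/= mulrDr mulrDr EFinD.
apply: leeD => //.
have -> : pS * (2 * V * q n) = pS * (q n * V) + pS * (q n * V) by ring.
by rewrite EFinD; apply: leeD; apply: exch_moment.
Qed.

End swap.

Lemma pred_site (z k : nat) : (k < z.-1)%N -> z%:Z != Posz k.+1 /\ z%:Z != - k.+1%:Z.
Proof. by move=> kz; split; apply/eqP; lia. Qed.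

Lemma close_site (k z K : nat) : `|k.+1%:Z - z%:Z| <= K%:Z ->
  (z + K - k.+1 < (2 * K).+1)%N /\ (k.+1 + (z + K - k.+1) - K)%N = z.
Proof. by move=> h; split; lia. Qed.

Section exchange_events.
Context d (Omega : measurableType d) (R : realType) (P : probability Omega R).
Context (alpha : R) (X : int + nat -> Omega -> R) (q : nat -> R) (a r : R) (J : nat).
Hypothesis al0 : 0 <= alpha.
Hypothesis indX : mutually_independent P X.
Hypothesis law : forall z, pareto P alpha X (inl z).
Hypothesis coin : forall k, P (X (inr k) @^-1` @off R) = (q k)%:E.
Hypotheses (a1 : 1 <= a) (aJ : a <= 2 ^+ J) (rE : r = a `^ alpha).
Local Notation V := (dyadic_moment alpha J).
Local Notation right_site := (right_site a X).
Local Notation left_site := (left_site a X).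
Local Notation exch_sum := (exch_sum a X).
Local Notation likely := (likely P).

Let mX i : measurable_fun setT (X i). Proof. exact: indX.1. Qed.

Lemma coin_prob_ge0 k : 0 <= q k.
Proof. by rewrite -lee_fin -coin measure_ge0. Qed.

Lemma likely_squares (n : nat) (c : R) : 0 < c ->
  likely (2 * V * (\sum_(k < n) q k) / c)
    (fun w => \sum_(k < n) (right_site k w ^+ 2 + left_site k w ^+ 2) < c).
Proof.
move=> c0; pose f k w := right_site k w ^+ 2 + left_site k w ^+ 2.
have f0 k w : 0 <= f k w by rewrite addr_ge0 ?sqr_ge0.
have mr k : measurable_fun setT (fun w => right_site k w ^+ 2).
  by apply: measurable_funX; exact: measurable_exch.
have ml k : measurable_fun setT (fun w => left_site k w ^+ 2).
  by apply: measurable_funX; exact: measurable_exch.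
have mf k : measurable_fun setT (f k) by exact: measurable_funD.
have moment k y : (\int[P]_w (exch a X k y w ^+ 2)%:E <= (q k * V)%:E)%E.
  (* A sure event on another coin stands in for the conditioning in [exch_moment]. *)
  have PT : P (X (inr k.+1) @^-1` setT) = 1%:E by rewrite preimage_setT probability_setT.
  have ne : (inr k.+1 : int + nat) != inr k.
    by apply/negP => /eqP[] /esym/n_Sn.
  have := @exch_moment _ _ _ P alpha X q a J indX law coin aJ (inr k.+1) setT k y 1 measurableT ne erefl PT.
  by rewrite mul1r; under eq_integral do rewrite indicT mul1r.
have := @likely_markov _ _ _ P (fun w => (\sum_(k < n) f k w)%:E) c (2 * V * (\sum_(k < n) q k) / c).
move=> H; apply: likely_sub (H _ _ c0 _).
- by move=> w; rewrite lte_fin.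
- by apply/measurable_EFinP; exact: measurable_sum.
- by move=> w; rewrite lee_fin sumr_ge0.
rewrite divfK ?gt_eqF//; under eq_integral do rewrite -sumEFin.
rewrite ge0_integral_sum//; try (by move=> *; rewrite lee_fin); try (by move=> k; apply/measurable_EFinP).
rewrite mulr_sumr -sumEFin; apply: lee_sum => k _.
rewrite integralD_EFin; try by move=> w; rewrite sqr_ge0.
- by rewrite -[2]/(1 + 1) !mulrDl !mul1r EFinD; apply: leeD; rewrite [V * _]mulrC; exact: moment.
- exact: mr.
- exact: ml.
Qed.

Let Pbig (s : R) (z : int) : 1 <= s / 2 * a -> 0 < s ->
  P (X (inl z) @^-1` `]s / 2 * a, +oo[) = ((s / 2) `^ (- alpha) / r)%:E.
Proof.
move=> sa s0; rewrite -(tail_scaled a1 rE) ?divr_ge0 ?(ltW s0)//.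
rewrite -(law z sa); congr (P _).
by apply/seteqP; split => w /=; rewrite in_itv/= andbT.
Qed.

Let half_lt (s : R) : 0 < s -> s / 2 * a < s * a.
Proof.
move=> s0; rewrite ltr_pM2r; last exact: lt_le_trans a1.
by rewrite ltr_pdivrMr// ltr_pMr// ltr1n.
Qed.

Let V1 : 1 <= V.
Proof.
rewrite /dyadic_moment lerDl; apply: sumr_ge0 => j _.
by rewrite mulr_ge0 ?exprn_ge0 ?powR_ge0.
Qed.

(** The sum up to [z - 1] does not involve the site [z], so restricting to a high value at [z]
    multiplies the second moment by a probability of order [1 / r]. This pays for the union over [n]
    sites, with [n] of order [r]. The level [s / 2] places the closed condition [s a <= xi0 z]
    inside an open ray. *)
Lemma likely_sums (n : nat) (s c : R) : 1 <= s / 2 * a -> 0 < s -> 0 < c ->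
  likely (n%:R * ((s / 2) `^ (- alpha) / r * (2 * V * \sum_(k < n) q k)) / c)
    (fun w => forall z, (z < n)%N -> s * a <= X (inl z%:Z) w -> exch_sum z.-1 w ^+ 2 < c).
Proof.
move=> sa s0 c0.
have r0 : 0 < r by rewrite rE powR_gt0// (lt_le_trans ltr01).
set b := _ * (2 * V * _).
have one z : (z < n)%N -> likely (b / c)
    (fun w => s * a <= X (inl z%:Z) w -> exch_sum z.-1 w ^+ 2 < c).
  move=> zn; pose S : set R := `]s / 2 * a, +oo[%classic.
  pose f w := \1_S (X (inl z%:Z) w) * exch_sum z.-1 w ^+ 2.
  have := @likely_markov _ _ _ P (fun w => (f w)%:E) c (b / c).
  move=> H; apply: likely_sub (H _ _ c0 _).
  - move=> w; rewrite lte_fin /f => h sz; move: h; rewrite indicE mem_set ?mul1r//.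
    rewrite /S /= in_itv/= andbT; apply: lt_le_trans sz.
    exact: half_lt.
  - apply/measurable_EFinP; apply: measurable_funM.
      by apply: measurableT_comp => //; apply: measurable_indic; exact: measurable_itv.
    by apply: measurable_funX; exact: measurable_exch_sum.
  - by move=> w; rewrite lee_fin mulr_ge0 ?sqr_ge0// indicE.
  rewrite divfK ?gt_eqF//.
  have := @exch_sum_moment _ _ _ P alpha X q a J indX law coin a1 aJ al0 z S z.-1 _
    (measurable_itv _) (Pbig z sa s0).
  move=> M; apply: (le_trans (M _ _)).
  - by move=> k /pred_site[].
  - by move=> k /pred_site[].
  rewrite lee_fin /b ler_wpM2l ?divr_ge0 ?powR_ge0 ?(ltW r0)//.
  rewrite ler_wpM2l ?mulr_ge0 ?(le_trans ler01 V1)//; apply: (ler_sum_ord_widen coin_prob_ge0).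
  by rewrite (leq_trans (leq_pred _))// ltnW.
have := @likely_seq _ _ _ P _ (iota 0 n) (fun=> b / c)
  (fun z w => s * a <= X (inl z%:Z) w -> exch_sum z.-1 w ^+ 2 < c).
move=> H; apply: likely_le (likely_sub _ (H _)).
- by rewrite big_const_seq count_predT size_iota iter_addr_0 -[leLHS]mulr_natl mulrA.
- by move=> w Hw z zn; apply: Hw; rewrite mem_iota.
- by move=> z; rewrite mem_iota => /andP[_ zn]; exact: one.
Qed.

(** For each coin [k] the sites within [K] of [k + 1] are numbered by the offset [j], as
    [k + 1 + j - K] with truncated subtraction. A coin and a site are independent, so each pair
    costs a factor [1 / r]. *)
Lemma likely_isolated (n K : nat) (s : R) : 1 <= s / 2 * a -> 0 < s ->
  likely ((2 * K).+1%:R * ((s / 2) `^ (- alpha) / r * \sum_(k < n) q k))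
    (fun w => forall k z : nat, (k < n)%N -> s * a <= X (inl z%:Z) w ->
      X (inr k) w != 1 -> (`|k.+1%:Z - z%:Z| > K%:Z)).
Proof.
move=> sa s0.
have r0 : 0 < r by rewrite rE powR_gt0// (lt_le_trans ltr01).
pose S : set R := `]s / 2 * a, +oo[%classic; set b := _ / r.
pose bad (k j : nat) w := ~ (S (X (inl (k.+1 + j - K)%N%:Z) w) /\ @off R (X (inr k) w)).
have one k j : likely (b * q k) (bad k j).
  set z := (k.+1 + j - K)%N%:Z.
  pose A (l : int + nat) : set R := if l is inl _ then S else @off R.
  have mA l : l \in [:: inl z; inr k] -> measurable (A l).
    by case: l => [m|m] _; [exact: measurable_itv|exact: measurable_off].
  have := indX.2 [:: inl z; inr k] A erefl mA.
  rewrite !big_cons !big_nil setIT mule1/= => PE.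
  exists ((X (inl z) @^-1` S) `&` (X (inr k) @^-1` @off R)); split.
  - apply: measurableI; apply: (measurable_indX indX); first exact: measurable_itv.
    exact: measurable_off.
  - by rewrite [X in (X <= _)%E]PE Pbig// coin EFinM.
  - by move=> w nw; exact: nw.
have := @likely_seq _ _ _ P _ (iota 0 n) (fun k => \sum_(j <- iota 0 (2 * K).+1) b * q k)
  (fun k w => forall j, j \in iota 0 (2 * K).+1 -> bad k j w).
move=> H; apply: likely_le (likely_sub _ (H _)).
- under eq_bigr do rewrite big_const_seq count_predT size_iota iter_addr_0 -mulr_natl.
  rewrite -mulr_sumr -mulr_sumr -(big_mkord xpredT q) /index_iota subn0.
  by [].
- move=> w Hw k z kn sz xk; rewrite ltNge; apply/negP => close.
  have [jin jE] := close_site close.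
  apply: (Hw k _ (z + K - k.+1)%N); [by rewrite mem_iota|by rewrite mem_iota|].
  rewrite jE; split; last by move=> /= xk1; move: xk; rewrite xk1 eqxx.
  rewrite /S /= in_itv/= andbT; apply: lt_le_trans sz.
  exact: half_lt.
- move=> k _; apply: (@likely_seq _ _ _ P _ _ (fun=> b * q k) (fun j w => bad k j w)) => j _.
  exact: one.
Qed.

End exchange_events.

(** * Asymptotics in t *)

Lemma log_log_dominated (R : realType) (A : R) :
  \forall t \near +oo%R, [/\ 0 < t, A <= ln (ln t) & A * ln (ln t) <= ln t].
Proof.
pose B := Num.max 1 A; have B1 : 1 <= B by rewrite le_max lexx.
have AB : A <= B by rewrite le_max lexx orbT.
near=> t.
have tB : expR (expR (2 * B)) <= t by near: t; exact: nbhs_pinfty_ge.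
have t0 : 0 < t by exact: lt_le_trans (expR_gt0 _) tB.
have LB : expR (2 * B) <= ln t by rewrite -ler_expR lnK.
have L0 : 0 < ln t by exact: lt_le_trans (expR_gt0 _) LB.
have lB : 2 * B <= ln (ln t) by rewrite -ler_expR lnK.
split => //; first by lra.
set l := ln (ln t) in lB *.
have -> : ln t = expR l by rewrite lnK.
have l0 : 0 <= l by lra.
apply: le_trans (expR_ge1Dxn 1 l0); rewrite (_ : 2`!%:R = 2)//.
have -> : l ^+ 2 / 2 = l / 2 * l by rewrite expr2; ring.
have : A * l <= l / 2 * l by rewrite ler_wpM2r//; lra.
lra.
Unshelve. all: by end_near. Qed.

Section scales.
Context (R : realType) (alpha : R).
Hypothesis al2 : 2 <= alpha.

(* The scale of the maximum, [(t / ln t)^(1 / (alpha - 1))]. *)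
Definition peak (t : R) : R := expR ((ln t - ln (ln t)) / (alpha - 1)).
(** The distance scale: a site exceeds [peak t] with probability [1 / range t], and by [range_eq]
    the penalty in [Psi] at this distance is of order [peak t]. *)
Definition range (t : R) : R := peak t `^ alpha.

Let al1 : 0 < alpha - 1. Proof. by move: al2; lra. Qed.
Let al0 : 0 < alpha. Proof. by move: al2; lra. Qed.

Lemma ln_peak t : ln (peak t) = (ln t - ln (ln t)) / (alpha - 1).
Proof. by rewrite expRK. Qed.

Lemma range_eq t : 0 < t -> 0 < ln t -> t * peak t = range t * ln t.
Proof.
move=> t0 L0; rewrite /range /powR gt_eqF ?expR_gt0// ln_peak.
rewrite -{3}(lnK L0) -expRD /peak -{1}(lnK t0) -expRD; congr expR.
by field; rewrite gt_eqF.
Qed.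

Lemma ln_range t : ln (range t) = alpha * ln (peak t).
Proof. by rewrite ln_powR. Qed.

(** In logarithms: [r * t * a] equals [a ^ (2 alpha)] times [ln t], and [2 K >= 2 alpha + 4]
    negative powers of [a] outweigh it, together with the constants, since [ln t <= a]. *)
Lemma far_small (M g eps t : R) (K : nat) : 0 < M -> 0 < g -> 0 < eps -> 0 < t -> 1 <= ln t ->
  alpha + 2 <= K%:R -> 0 <= ln (peak t) -> ln (ln t) <= ln (peak t) ->
  ln (2 * M) + ln (g / 2) + ln 2 + (2 * K)%:R * ln (4 / g) - ln (eps / 2) <= ln (ln t) ->
  2 * M * range t * (t * (g / 2 * peak t) * (2 * (2 / (g / 2 * peak t)) ^+ (2 * K))) <= eps / 2.
Proof.
move=> M0 g0 eps0 t0 L1 hK la0 lla num.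
have L0 : 0 < ln t by exact: lt_le_trans L1.
have a0 : 0 < peak t by exact: expR_gt0.
have r0 : 0 < range t by rewrite powR_gt0.
have k0 : 0 < g / 2 by rewrite divr_gt0.
have e0 : 0 < eps / 2 by rewrite divr_gt0.
have -> : 2 / (g / 2 * peak t) = 4 / g / peak t by field; rewrite !gt_eqF.
have b0 : 0 < 4 / g / peak t by rewrite !divr_gt0.
have tE : ln t = alpha * ln (peak t) + ln (ln t) - ln (peak t).
  have := congr1 (@ln R) (range_eq t0 L0).
  by rewrite !lnM ?posrE// ln_range; lra.
have M20 : 0 < 2 * M by rewrite mulr_gt0.
have bK : 0 < (4 / g / peak t) ^+ (2 * K) by exact: exprn_gt0.
rewrite -ler_ln ?posrE//; last by rewrite !mulr_gt0.
have l1 : ln (2 * (4 / g / peak t) ^+ (2 * K)) = ln 2 + (2 * K)%:R * (ln (4 / g) - ln (peak t)).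
  rewrite lnM ?posrE// lnXn// -[_ *+ (2 * K)]mulr_natl; congr (_ + _ * _).
  by rewrite [LHS]ln_div ?posrE ?divr_gt0.
have l2 : ln (t * (g / 2 * peak t)) = ln t + (ln (g / 2) + ln (peak t)).
  by rewrite lnM ?posrE ?mulr_gt0// [in LHS]lnM ?posrE.
have l3 : ln (2 * M * range t) = ln (2 * M) + alpha * ln (peak t).
  by rewrite lnM ?posrE// ln_range.
rewrite lnM ?posrE ?mulr_gt0// [X in _ + X]lnM ?posrE ?mulr_gt0// l1 l2 l3 mulrBr.
have h : (2 * alpha + 4) * ln (peak t) <= (2 * K)%:R * ln (peak t).
  by rewrite ler_wpM2r// natrM; lra.
lra.
Qed.

Record scale_facts (t : R) : Prop := ScaleFacts {
  sc_t : 0 < t; sc_L : 1 <= ln t; sc_l : 1 <= ln (ln t);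
  sc_la_lo : 3 * ln t <= 4 * alpha * ln (peak t);
  sc_la_hi : ln (peak t) <= ln t - ln (ln t);
  sc_l_la : ln (ln t) <= ln (peak t); sc_l_L : ln (ln t) <= ln t;
  sc_a : 1 <= peak t; sc_r : peak t ^+ 2 <= range t }.

Lemma scale_facts_near : \forall t \near +oo%R, scale_facts t.
Proof.
near=> t.
have [t0 l1 _] : [/\ 0 < t, 1 <= ln (ln t) & 1 * ln (ln t) <= ln t].
  by near: t; exact: log_log_dominated.
have [_ _ lL] : [/\ 0 < t, 2 * alpha <= ln (ln t) & 2 * alpha * ln (ln t) <= ln t].
  by near: t; exact: log_log_dominated.
set l := ln (ln t) in l1 lL *; set L := ln t in l1 lL *.
have lL4 : 4 * l <= L by apply: le_trans lL; rewrite ler_wpM2r//; move: al2 l1; lra.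
have laE : (alpha - 1) * ln (peak t) = L - l by rewrite ln_peak mulrC divfK ?gt_eqF.
have la0 : 0 <= ln (peak t) by rewrite ln_peak divr_ge0 ?(ltW al1)// -/L -/l subr_ge0; lra.
have lo : 3 * L <= 4 * alpha * ln (peak t) by nra.
have a1 : 1 <= peak t by rewrite -ler_ln ?posrE ?expR_gt0// ln1.
have a2 : 0 <= (alpha - 2) * ln (peak t) by rewrite mulr_ge0// subr_ge0.
have lL' : l <= L by lra.
split => //.
- by rewrite -/L; lra.
- by rewrite -/L -/l; lra.
- rewrite -/l -(@ler_pM2l _ (2 * alpha)) ?mulr_gt0//.
  have : 0 <= 2 * alpha * ln (peak t) by rewrite !mulr_ge0// ltW.
  by lra.
- by rewrite /range -powR_mulrn ?(le_trans ler01)// ler_powR.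
Unshelve. all: by end_near. Qed.

Lemma peak_cvg (B : R) : \forall t \near +oo%R, B <= peak t.
Proof.
near=> t.
have [_ _ _ _ _ lla _ _ _] : scale_facts t by near: t; exact: scale_facts_near.
have [_ lB _] : [/\ 0 < t, B <= ln (ln t) & B * ln (ln t) <= ln t].
  by near: t; exact: log_log_dominated.
apply: (le_trans lB); apply: (le_trans lla).
by have := expR_ge1Dx (ln (peak t)); rewrite lnK ?posrE ?expR_gt0//; lra.
Unshelve. all: by end_near. Qed.

Lemma range_cvg (B : R) : \forall t \near +oo%R, B <= range t.
Proof.
near=> t.
have [_ _ _ _ _ _ _ a1 r2] : scale_facts t by near: t; exact: scale_facts_near.
have aB : B <= peak t by near: t; exact: peak_cvg.
by apply: (le_trans aB); apply: le_trans r2; rewrite expr2 ler_peMl// (le_trans ler01).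
Unshelve. all: by end_near. Qed.

(** Constants are eventually below [ln (ln t)], constant multiples of [ln (ln t)] are below [ln t],
    and [ln (peak t)] is comparable to [ln t]; every condition reduces to these comparisons. *)
Lemma late_near C C1 M0 M s c g g2 ep eps K :
  admissible alpha C C1 M0 M s c g g2 ep eps K ->
  \forall t \near +oo%R, late alpha C1 M0 M s c g g2 eps K t (peak t) (range t) (ln t).
Proof.
move=> ad.
have M01 := ad_M01 ad; have M2 := ad_M ad; have C11 := ad_C11 ad.
have s0 := ad_s ad; have c0 := ad_c ad; have g0 := ad_g ad; have g20 := ad_g2 ad.
have eps0 := ad_eps ad; have eps1 := ad_eps1 ad.
have M_gt0 : 0 < M by lra.
have C20 : 0 < C1 + M by lra.
pose D0 := M * (4 - ln c + ln (C1 + M)) - ln eps.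
pose D1 := 4 - ln c + ln (C1 + M) - ln eps.
pose C0 := ln (2 * M) + ln (g / 2) + ln 2 + (2 * K)%:R * ln (4 / g) - ln (eps / 2).
have near_le B : \forall x \near +oo%R, B <= ln (ln x).
  by apply: filterS (log_log_dominated B) => x [].
have near_mul B : \forall x \near +oo%R, B * ln (ln x) <= ln x.
  by apply: filterS (log_log_dominated B) => x [].
near=> t.
have [t0 L1 l1 lo hi lla lL a1 r2] : scale_facts t by near: t; exact: scale_facts_near.
have e1 : ln (C1 + M) <= ln (ln t) by near: t; exact: near_le.
have e2 : - (4 * alpha * ln s) <= ln (ln t) by near: t; exact: near_le.
have e3 : ln (2 / s) <= ln (ln t) by near: t; exact: near_le.
have e4 : 2 * M / s <= ln (ln t) by near: t; exact: near_le.
have e5 : 2 * M0 * ln ((C1 + M) / s) / g <= ln (ln t) by near: t; exact: near_le.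
have e6 : D0 <= ln (ln t) by near: t; exact: near_le.
have e7 : (M + 1) * (4 * alpha / (3 * g2)) * ln (ln t) <= ln t by near: t; exact: near_mul.
have e8 : (M + 1) * (2 / g) * ln (ln t) <= ln t by near: t; exact: near_mul.
have e9 : D1 <= ln (ln t) by near: t; exact: near_le.
have e10 : 8 * alpha * ln (ln t) <= ln t by near: t; exact: near_mul.
have e11 : (M + 1 - ln eps) * (8 / g) <= ln (ln t) by near: t; exact: near_le.
have e12 : ln (8 / g) <= ln (ln t) by near: t; exact: near_le.
have e13 : ln (128 / (eps * g)) <= ln (ln t) by near: t; exact: near_le.
have e14 : ln (g / 2) <= ln (ln t) by near: t; exact: near_le.
have e15 : C0 <= ln (ln t) by near: t; exact: near_le.
have a0 : 0 < peak t by exact: expR_gt0.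
have L0 : 0 < ln t by exact: lt_le_trans L1.
have r1 : 1 <= range t by apply: le_trans r2; rewrite exprn_ege1.
have al0' := al0.
have exp_le (x : R) : 0 < x -> ln x <= ln (ln t) -> x <= peak t.
  by move=> x0 xl; rewrite -ler_ln ?posrE// (le_trans xl).
split => //.
- exact: range_eq.
- exact: ln_ge0.
- by rewrite lnM ?posrE//; lra.
- rewrite lnM ?posrE// ler_pdivrMr ?mulr_gt0//.
  have : - (4 * alpha * ln s) <= ln t by lra.
  lra.
- by have := exp_le _ (divr_gt0 (ltr0n _ 2) s0) e3; rewrite ler_pdivrMr// mulrC.
- by have := le_trans e4 lL; rewrite ler_pdivrMr// [_ * s]mulrC.
- by have := le_trans e5 lL; rewrite ler_pdivrMr// [_ * g]mulrC.
- have h : (M + 1) * ln (ln t) <= g2 * ln (peak t).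
    have -> : g2 * ln (peak t) = (3 * g2 / (4 * alpha)) * (4 * alpha * ln (peak t) / 3).
      by field; rewrite gt_eqF.
    apply: (@le_trans _ _ (3 * g2 / (4 * alpha) * ln t)).
      have -> : (M + 1) * ln (ln t) = 3 * g2 / (4 * alpha) * ((M + 1) * (4 * alpha / (3 * g2)) * ln (ln t)).
        by field; rewrite !gt_eqF.
      by rewrite ler_wpM2l// divr_ge0 ?mulr_ge0 ?(ltW g20) ?(ltW al0').
    rewrite ler_wpM2l ?divr_ge0 ?mulr_ge0 ?(ltW g20) ?(ltW al0')//.
    by rewrite ler_pdivlMr//; lra.
  by move: e6; rewrite /D0; lra.
- have h : (M + 1) * ln (ln t) <= g / 2 * ln t.
    have -> : (M + 1) * ln (ln t) = g / 2 * ((M + 1) * (2 / g) * ln (ln t)).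
      by field; rewrite gt_eqF.
    by rewrite ler_wpM2l// divr_ge0// ltW.
  by move: e6; rewrite /D0; lra.
- have h1 : ln (peak t) / 2 = (4 * alpha * ln (peak t)) / (8 * alpha).
    by field; rewrite gt_eqF.
  have h2 : ln (peak t) / 2 >= 3 * ln t / (8 * alpha).
    by rewrite h1 ler_wpM2r// invr_ge0 mulr_ge0// ltW.
  have h3 : ln (ln t) <= ln t / (8 * alpha) by rewrite ler_pdivlMr ?mulr_gt0// mulrC.
  have -> : (8 * alpha)^-1 * ln t = ln t / (8 * alpha) by rewrite mulrC.
  by move: e9; rewrite /D1; lra.
- have -> : M + 1 - ln eps = g / 8 * ((M + 1 - ln eps) * (8 / g)) by field; rewrite gt_eqF.
  by rewrite ler_wpM2l ?divr_ge0 ?(ltW g0)// (le_trans e11).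
- by have := exp_le _ (divr_gt0 (ltr0n _ 8) g0) e12; rewrite ler_pdivrMr// mulrC.
- have ga8 : 8 <= g * peak t.
    by have := exp_le _ (divr_gt0 (ltr0n _ 8) g0) e12; rewrite ler_pdivrMr// mulrC.
  have : 128 / (eps * g) <= peak t by apply: exp_le; rewrite ?divr_gt0 ?mulr_gt0.
  rewrite ler_pdivrMr ?mulr_gt0// => h.
  apply: (le_trans h); have -> : peak t * (eps * g) = eps * (g * peak t) by ring.
  by rewrite ler_wpM2l ?(ltW eps0)//; nra.
- rewrite -ler_ln ?posrE ?mulr_gt0 ?divr_gt0// lnM ?posrE ?divr_gt0//; lra.
- exact: (far_small M_gt0 g0 eps0 t0 L1 (ad_K ad) (ln_ge0 a1) lla e15).
Unshelve. all: by end_near. Qed.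

End scales.

(** * Coin density against the truncated second moment *)

Section exchange_density.
Context (R : realType) (alpha : R) (p : nat -> R).
Hypothesis al2 : 2 <= alpha.
Hypothesis p01 : forall n, 0 <= p n <= 1.
Hypothesis eta_small : (fun n => eta_fun p n / kappa_fun alpha n) @ \oo --> (0 : R).
Local Notation peak := (peak alpha).
Local Notation range := (range alpha).

Let q k := 1 - p k.+1.

Lemma eta_sum n : eta_fun p n = \sum_(k < n) q k.
Proof. by rewrite /eta_fun big_add1 big_mkord. Qed.

Let q0 k : 0 <= q k. Proof. by rewrite subr_ge0; have /andP[] := p01 k.+1. Qed.

Definition dyadic_level (t : R) : nat := (Num.truncn (ln (peak t) / ln 2)).+1.

Lemma peak_le_dyadic t : 1 <= peak t -> peak t <= 2 ^+ dyadic_level t.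
Proof.
move=> a1; have l2 : 0 < ln 2 :> R by rewrite ln_gt0// ltr1n.
have /truncn_itv/andP[_ h] : 0 <= ln (peak t) / ln 2.
  by rewrite divr_ge0 ?(ltW l2)// ln_ge0.
rewrite -ler_ln ?posrE ?exprn_gt0//; last exact: expR_gt0.
by rewrite lnXn// -[leRHS]mulr_natl -ler_pdivrMr// ltW.
Qed.

Lemma dyadic_momentE (J : nat) : dyadic_moment alpha J = 1 + 4 * \sum_(j < J) (4 * 2 `^ (- alpha)) ^+ j.
Proof.
rewrite /dyadic_moment mulr_sumr; congr (1 + _); apply: eq_bigr => j _.
have -> : (2 ^+ j) `^ (- alpha) = (2 `^ (- alpha)) ^+ j :> R.
  rewrite -(powR_mulrn j (ler0n R 2)) -(powR_mulrn j (powR_ge0 2 (- alpha))).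
  by rewrite -!powRrM mulrC.
by rewrite exprS exprMn mulrA.
Qed.

Let ratio_lt1 : 2 < alpha -> 4 * 2 `^ (- alpha) < 1 :> R.
Proof.
move=> al; rewrite powRN mulrC ltr_pdivrMl ?powR_gt0// mulr1.
have -> : 4 = 2 `^ 2 :> R by rewrite -[X in _ `^ X]/(2%:R) powR_mulrn//; ring.
by rewrite /powR !gt_eqF// ltr_expR ltr_pM2r// ln_gt0// ltr1n.
Qed.

Lemma dyadic_moment_bounded : 2 < alpha ->
  exists2 V, 0 < V & forall J, dyadic_moment alpha J <= V.
Proof.
move=> al; have h := ratio_lt1 al; set x := 4 * _ in h *.
have x0 : 0 <= x by rewrite mulr_ge0 ?powR_ge0.
have d0 : 0 < 1 - x by rewrite subr_gt0.
exists (1 + 4 / (1 - x)); first by rewrite addr_gt0// divr_gt0.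
move=> J; rewrite dyadic_momentE lerD2l ler_wpM2l//.
rewrite -[leRHS]mul1r ler_pdivlMr// mulrC.
have : (1 - x) * \sum_(j < J) x ^+ j = 1 - x ^+ J.
  by elim: J => [|J IH]; [rewrite big_ord0 expr0; ring|rewrite big_ord_recr/= mulrDr IH exprS; ring].
by move=> ->; rewrite gerBl exprn_ge0.
Qed.

(** For [alpha = 2] every layer contributes 4. Since [ln 2 >= 1 / 2] there are at most [2 ln a + 1]
    layers, and [1 + 4 (2 ln a + 1) <= 13 ln a] once [ln a >= 1]. *)
Lemma dyadic_moment_log (t : R) : alpha = 2 -> 1 <= ln (peak t) ->
  dyadic_moment alpha (dyadic_level t) <= 13 * ln (peak t).
Proof.
move=> al la1; rewrite /dyadic_moment.
have -> : \sum_(j < dyadic_level t) 4 ^+ j.+1 * (2 ^+ j) `^ (- alpha) =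
    4 * (dyadic_level t)%:R :> R.
  rewrite mulr_natr -[RHS]iter_addr_0 -big_const_ord; apply: eq_bigr => j _.
  rewrite al powRN -[X in _ `^ X]/(2%:R) powR_mulrn ?exprn_ge0// exprS -mulrA.
  by rewrite -exprM mulnC exprM (_ : 2 ^+ 2 = 4 :> R); [rewrite mulfV ?mulr1// expf_neq0|ring].
have l2 : 1 / 2 <= ln 2 :> R.
  rewrite -[leRHS]opprK -lnV ?posrE// lerNr.
  have := @le_ln1Dx R (- (1 / 2)); rewrite (_ : 1 + - (1 / 2) = 2^-1); last by field.
  by apply; lra.
have l20 : 0 < ln 2 :> R by lra.
have la0 : 0 <= ln (peak t) by lra.
have /truncn_itv/andP[h _] : 0 <= ln (peak t) / ln 2 by rewrite divr_ge0// ltW.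
have h2 : ln (peak t) / ln 2 <= 2 * ln (peak t).
  by rewrite ler_pdivrMr//; have := ler_wpM2l la0 l2; lra.
by rewrite /dyadic_level -natr1; lra.
Qed.

(** At distance [M r] the function [kappa] is of order [a ^ 2] if [alpha > 2], where the moment is
    bounded, and at most of order [a ^ 2 / ln a] if [alpha = 2], where the moment grows like [ln a].
    In both cases the product with [o(kappa)] is [o(a ^ 2)]. *)
Lemma coin_moment_small (M delta : R) : 1 <= M -> 0 < delta ->
  \forall t \near +oo%R, forall n : nat, n%:R <= M * range t ->
    dyadic_moment alpha (dyadic_level t) * (\sum_(k < n) q k) <= delta * peak t ^+ 2.
Proof.
move=> M1 d0; have al0 : 0 < alpha by move: al2; lra.
pose N t := Num.truncn (M * range t).
have density e : 0 < e -> \forall t \near +oo%R,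
    \sum_(k < N t) q k <= e * kappa_fun alpha (N t) /\ (2 <= N t)%N.
  move=> e0.
  have [n0 _ Hn0] : \forall n \near \oo, `|eta_fun p n / kappa_fun alpha n| < e.
    have /cvgrPdist_lt/(_ e e0) := eta_small; apply: filterS => n.
    by rewrite sub0r normrN.
  near=> t.
  have big : (n0 + 2)%N%:R <= range t by near: t; exact: range_cvg.
  have Nn : (n0 + 2 <= N t)%N.
    rewrite truncn_ge_nat; last by rewrite mulr_ge0 ?powR_ge0// (le_trans ler01).
    by apply: (le_trans big); rewrite ler_peMl ?powR_ge0.
  have N2 : (2 <= N t)%N by rewrite (leq_trans _ Nn)// leq_addl.
  split => //; have := Hn0 (N t) (leq_trans (leq_addr _ _) Nn).
  have k0 : 0 < kappa_fun alpha (N t).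
    rewrite /kappa_fun; case: ifP => _; first by rewrite powR_gt0// ltr0n (leq_trans _ N2).
    by rewrite divr_gt0 ?ln_gt0 ?ltr0n ?ltr1n// (leq_trans _ N2).
  rewrite -eta_sum normrM normfV (gtr0_norm k0) ltr_pdivrMr// => /ltW; apply: le_trans.
  exact: ler_norm.
have reduce t n : 1 <= peak t -> n%:R <= M * range t ->
    \sum_(k < n) q k <= \sum_(k < N t) q k.
  move=> a1 nM; apply: (ler_sum_ord_widen q0); rewrite truncn_ge_nat//.
  by rewrite mulr_ge0 ?powR_ge0// (le_trans ler01).
have V0 J : 0 <= dyadic_moment alpha J.
  by rewrite dyadic_momentE addr_ge0// mulr_ge0// sumr_ge0// => j _; rewrite exprn_ge0// mulr_ge0// powR_ge0.
have [al|al] := ltP 2 alpha.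
  have [V VP VJ] := dyadic_moment_bounded al.
  have e0 : 0 < delta / (V * M `^ (2 / alpha)).
    by rewrite divr_gt0// mulr_gt0// powR_gt0// (lt_le_trans ltr01).
  near=> t; move=> n nM.
  have [t0 _ _ _ _ _ _ a1 r2] : scale_facts alpha t by near: t; exact: scale_facts_near.
  have [small _] : \sum_(k < N t) q k <= delta / (V * M `^ (2 / alpha)) * kappa_fun alpha (N t) /\ (2 <= N t)%N.
    by near: t; exact: density.
  have a0 : 0 < peak t by exact: expR_gt0.
  have M0 : 0 <= M by exact: le_trans ler01 M1.
  have kE : kappa_fun alpha (N t) <= M `^ (2 / alpha) * peak t ^+ 2.
    rewrite /kappa_fun al; apply: (@le_trans _ _ ((M * range t) `^ (2 / alpha))).
      apply: ge0_ler_powR; rewrite ?nnegrE ?divr_ge0 ?(ltW al0)//.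
        by rewrite mulr_ge0 ?powR_ge0.
      by have /truncn_itv/andP[] : 0 <= M * range t by rewrite mulr_ge0 ?powR_ge0.
    rewrite powRM ?powR_ge0// ler_wpM2l ?powR_ge0// /range -powRrM.
    have -> : alpha * (2 / alpha) = 2%:R by field; rewrite gt_eqF.
    by rewrite powR_mulrn// ltW.
  apply: (@le_trans _ _ (V * (delta / (V * M `^ (2 / alpha)) * (M `^ (2 / alpha) * peak t ^+ 2)))).
    apply: ler_pM => //; first exact: sumr_ge0.
    apply: (le_trans (reduce _ _ a1 nM)); apply: (le_trans small).
    by rewrite ler_wpM2l// ltW.
  rewrite le_eqVlt; apply/orP; left; apply/eqP; field.
  by rewrite !gt_eqF// powR_gt0// (lt_le_trans ltr01).
have alE : alpha = 2 by apply/eqP; rewrite eq_le al al2.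
have e0 : 0 < delta / (13 * M) by rewrite divr_gt0// mulr_gt0// (lt_le_trans ltr01).
near=> t; move=> n nM.
have [t0 _ l1 _ _ lla _ a1 r2] : scale_facts alpha t by near: t; exact: scale_facts_near.
have [small N2] : \sum_(k < N t) q k <= delta / (13 * M) * kappa_fun alpha (N t) /\ (2 <= N t)%N.
  by near: t; exact: density.
have a0 : 0 < peak t by exact: expR_gt0.
have la1 : 1 <= ln (peak t) by exact: le_trans lla.
have a2 : 2 <= peak t by have := expR_ge1Dx (ln (peak t)); rewrite lnK ?posrE//; lra.
have M0 : 0 < M by exact: lt_le_trans ltr01 M1.
have rE : range t = peak t ^+ 2 by rewrite /range -[RHS]powR_mulrn ?(ltW a0)//; congr (_ `^ _).
have /truncn_itv/andP[N1 Nlt] : 0 <= M * range t by rewrite mulr_ge0 ?powR_ge0 ?(ltW M0).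
have aN : peak t <= (N t)%:R.
  have : M * range t < (N t)%:R + 1 by rewrite natr1.
  have : peak t ^+ 2 <= M * range t by rewrite rE ler_peMl// exprn_ge0// ltW.
  have : 0 <= (peak t - 2) * peak t by rewrite mulr_ge0 ?subr_ge0 ?(ltW a0).
  by rewrite expr2; lra.
have N0 : 0 < (N t)%:R :> R by exact: lt_le_trans aN.
have lN : ln (peak t) <= ln (N t)%:R by rewrite ler_ln ?posrE.
have la0 : 0 < ln (peak t) by exact: lt_le_trans la1.
have lN0 : 0 < ln (N t)%:R :> R by exact: lt_le_trans lN.
have kE : kappa_fun alpha (N t) <= M * peak t ^+ 2 / ln (peak t).
  rewrite /kappa_fun ltNge al/= -rE; apply: ler_pM; rewrite ?invr_ge0 ?(ltW lN0) ?(ltW N0)//.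
  by rewrite lef_pV2 ?posrE.
apply: (@le_trans _ _ (13 * ln (peak t) * (delta / (13 * M) * (M * peak t ^+ 2 / ln (peak t))))).
  apply: ler_pM => //; [exact: sumr_ge0|exact: dyadic_moment_log|].
  apply: (le_trans (reduce _ _ a1 nM)); apply: (le_trans small).
  by rewrite ler_wpM2l// ltW.
rewrite le_eqVlt; apply/orP; left; apply/eqP; field.
by rewrite !gt_eqF.
Unshelve. all: by end_near. Qed.

End exchange_density.

(** * Convergence in probability *)

Lemma far_index (k z m K : nat) : (m + K <= k)%N -> (z < m)%N -> K%:Z < `|k.+1%:Z - z%:Z|.
Proof. by lia. Qed.

Section typical_environment.
Context (R : realType) (Omega : Type) (xi0 : int -> Omega -> R) (B : nat -> Omega -> R).

Definition field_and_coins (i : int + nat) : Omega -> R :=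
  match i with inl z => xi0 z | inr k => B k end.
Local Notation X := field_and_coins.

Context (w : Omega).
Local Notation xi := (potential xi0 B w).

Lemma potential_left k : xi (- k.+1%:Z) = if B k w == 1 then xi0 k.+1%:Z w else xi0 (- k.+1%:Z) w.
Proof. by []. Qed.

Context (C C1 M s c g ep : R) (K : nat) (t a r : R).
Hypotheses (a1 : 1 <= a) (r1 : 1 <= r).
Hypotheses (C0 : 0 < C) (C1E : C * (1 + M) `^ (3 / 4) <= C1).
Hypotheses (s0 : 0 < s) (sM : s <= M) (ep0 : 0 < ep) (ep1 : ep < 1) (eps : ep <= 2 * s).
Local Notation n := (Num.truncn (M * r)).+1.
Hypothesis envelope : forall z : int, 1 < xi0 z w /\ xi0 z w <= C * a * (1 + (`|z|%N)%:R / r) `^ (3 / 4).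
Hypothesis high : exists y : nat, y%:R <= s * r /\ 2 * s * a < xi0 y%:Z w.
Hypothesis low : forall y : nat, y%:R <= c * r -> xi0 y%:Z w <= s * a.
Hypothesis gap : (forall z, 1 < xi0 z w) ->
   (forall y : nat, y%:R <= M * r -> xi0 y%:Z w <= C1 * a) ->
   forall y z : nat, y != z -> y%:R <= M * r -> z%:R <= M * r ->
   s / 2 * a <= psi t y (xi0 y%:Z w) -> s / 2 * a <= psi t z (xi0 z%:Z w) ->
   g * a < `|psi t y (xi0 y%:Z w) - psi t z (xi0 z%:Z w)|.
Hypothesis squares :
  \sum_(k < n) (right_site a X k w ^+ 2 + left_site a X k w ^+ 2) < (ep * a) ^+ 2.
Hypothesis sums : forall z, (z < n)%N -> s * a <= xi0 z%:Z w ->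
  exch_sum a X z.-1 w ^+ 2 < (ep * a) ^+ 2.
Hypothesis isolated : forall k z : nat, (k < n + K)%N -> s * a <= xi0 z%:Z w ->
  B k w != 1 -> `|k.+1%:Z - z%:Z| > K%:Z.

Let a0 : 0 < a. Proof. exact: lt_le_trans a1. Qed.
Let r0 : 0 < r. Proof. exact: lt_le_trans r1. Qed.
Let M0 : 0 < M. Proof. exact: lt_le_trans sM. Qed.

Let below_n (y : nat) : y%:R <= M * r -> (y < n)%N.
Proof.
have /truncn_itv/andP[_ h] : 0 <= M * r by rewrite mulr_ge0// ltW.
by move=> yM; rewrite -(ltr_nat R); exact: le_lt_trans h.
Qed.

Let off1 k : B k w != 1 -> \1_(@off R) (B k w) = 1 :> R.
Proof. by move=> Bk; rewrite indicE mem_set// => /eqP; rewrite (negbTE Bk). Qed.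

Let off0 k : B k w == 1 -> \1_(@off R) (B k w) = 0 :> R.
Proof. by move=> /eqP ->; rewrite indicE memNset//= => h; apply: h. Qed.

Let trunc_small k : (k < n)%N -> B k w != 1 ->
  trunc a (xi0 k.+1%:Z w) < ep * a /\ trunc a (xi0 (- k.+1%:Z) w) < ep * a.
Proof.
move=> kn Bk; have tr0 x : 0 <= trunc a x by rewrite (le_trans ler01)// trunc_ge1.
have h : right_site a X k w ^+ 2 + left_site a X k w ^+ 2 < (ep * a) ^+ 2.
  apply: le_lt_trans squares; rewrite (bigD1 (Ordinal kn))//= lerDl.
  by apply: sumr_ge0 => i _; rewrite addr_ge0 ?sqr_ge0.
have epa0 : 0 <= ep * a by rewrite mulr_ge0// ltW.
have sq x : x ^+ 2 < (ep * a) ^+ 2 -> 0 <= x -> x < ep * a.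
  by move=> + x0; rewrite ltr_pXn2r.
rewrite /right_site /left_site /exch /= off1// !mul1r in h.
split; apply: sq => //; apply: le_lt_trans h; by rewrite ?lerDl ?lerDr sqr_ge0.
Qed.

Let epa : ep * a < a. Proof. by rewrite gtr_pMl. Qed.

Let off_id k : (k < n)%N -> B k w != 1 ->
  right_site a X k w = xi0 k.+1%:Z w /\ left_site a X k w = xi0 (- k.+1%:Z) w.
Proof.
move=> kn Bk; have [h1 h2] := trunc_small kn Bk.
rewrite /right_site /left_site /exch /= off1// !mul1r.
by split; apply: trunc_id; rewrite ?(lt_trans _ epa)//; have [] := envelope k.+1; have [] := envelope (- k.+1%:Z).
Qed.

(** The bound on squares and [ep < 1] make the truncation inactive wherever the coin differs from 1,
    so the sums over exclusive sites become sums over such coins. A coin that happens to leave two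
    equal values adds nothing to [exch_sum]. *)
Lemma typical_potential : typical C M s c g ep K t a r xi.
Proof.
have gt1 v : 1 < xi v.
  by case: v => [m|k] /=; [|case: ifP => _]; exact: (envelope _).1.
have env v : xi v <= C * a * (1 + (`|v|%N)%:R / r) `^ (3 / 4).
  case: v => [m|k] /=; first by have [] := envelope m.
  by case: ifP => _; [have [_] := envelope k.+1|have [_] := envelope (Negz k)].
split => //.
- have [y [ys yhigh]] := high; exists y; split => //.
  case: y ys yhigh => [|k] ys yhigh; first by rewrite oppr0.
  have kn : (k < n)%N.
    by apply: ltn_trans (below_n (le_trans ys _)); rewrite ?ltnS ?ler_wpM2r// ltW.
  (* If the coin differed from 1, the truncated value would be below [ep a], contradicting a value
     above [2 s a >= ep a]. So the high site lies in the symmetric set. *)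
  rewrite potential_left; case: ifPn => // Bk.
  have [h _] := trunc_small kn Bk.
  suff : ep * a <= trunc a (xi0 k.+1%:Z w) by rewrite leNgt h.
  rewrite /trunc le_max le_min (ltW epa) andbT.
  by rewrite (le_trans _ (ltW yhigh)) ?orbT// ler_wpM2r// ltW.
- apply: gap => [z|y yM]; first by have [] := envelope z.
  have := @envelope_near R (fun z => xi0 z w) a r C C1 M M s a0 r0 s0 sM (lexx M) C1E C0.
  by move=> /(_ (fun z => (envelope z).2) y%:Z yM).
- move=> m mM; have mn := below_n mM.
  rewrite big_add1 big_mkord.
  apply: le_trans (ltW squares); rewrite big_mkcond.
  apply: (@le_trans _ _ (\sum_(k < m) (right_site a X k w ^+ 2 + left_site a X k w ^+ 2))).
    apply: ler_sum => k _; have kn := ltn_trans (ltn_ord k) mn.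
    rewrite potential_left; have [Bk|Bk] := boolP (B k w == 1).
      by rewrite eqxx addr_ge0 ?sqr_ge0.
    have [-> ->] := off_id kn Bk.
    by case: ifP => _ //; rewrite addr_ge0 ?sqr_ge0.
  apply: (@ler_sum_ord_widen _ (fun k => right_site a X k w ^+ 2 + left_site a X k w ^+ 2)).
    by move=> k; rewrite addr_ge0 ?sqr_ge0.
  exact: ltnW.
- move=> z zM zs; have zn := below_n zM.
  have h := sums zn zs.
  have -> : \sum_(1 <= y < z | xi y != xi (- y%:Z)) (xi y - xi (- y%:Z)) = exch_sum a X z.-1 w.
    rewrite big_add1 big_mkord big_mkcond; apply: eq_bigr => k _.
    have kn : (k < n)%N.
      by apply: leq_trans (ltnW zn); exact: leq_trans (ltn_ord k) (leq_pred z).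
    rewrite potential_left; have [Bk|Bk] := boolP (B k w == 1).
      by rewrite eqxx /right_site /left_site /exch /= off0// !mul0r subrr.
    have [-> ->] := off_id kn Bk.
    by case: ifPn => //; rewrite negbK => /eqP /= ->; rewrite subrr.
  rewrite -(@ler_pXn2r _ 2)// ?nnegrE ?mulr_ge0 ?(ltW ep0) ?(ltW a0)//.
  by rewrite real_normK ?num_real// ltW.
- move=> z y zM zs zD; case: y => [|k]; first by rewrite oppr0 eqxx.
  rewrite potential_left; have [Bk|Bk] := boolP (B k w == 1); first by rewrite eqxx.
  (* Coins from index [n + K] on belong to sites further than [K] from any [z] below [n]. *)
  move=> _; have [kn|kn] := ltnP k (n + K); first exact: isolated.
  exact: far_index kn (below_n zM).
Qed.

End typical_environment.

Lemma admissible_exists (R : realType) (alpha eps eta : R) : 2 <= alpha -> 0 < eps ->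
  eps <= 1 / 10 -> 0 < eta -> exists C C1 M0 M s c g g2 ep K,
  [/\ admissible alpha C C1 M0 M s c g g2 ep eps K, 1 <= C /\ 6 / C ^+ 2 <= eta,
    2 * (2 * s) `^ alpha / s <= eta, 2 * c * s `^ (- alpha) <= eta &
    [/\ (C1 + g) * g * (18 * M * alpha * (s / 4) `^ (- alpha - 1)) ^+ 2 <= eta,
      20 * g <= s, ep < 1 & ep <= 2 * s]].
Proof.
move=> al2 e0 e1 h0.
pose C := Num.max 1 (6 / eta).
have C1 : 1 <= C by rewrite le_max lexx.
have Ceta : 6 / eta <= C by rewrite le_max lexx orbT.
have C0 : 0 < C by lra.
(* As [2 s <= 1] and [alpha >= 2], the probability bound for the missing high site is at most
   [2 (2 s) ^ 2 / s = 8 s]. *)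
pose s := Num.min (1 / 2) (eta / 8).
have s0 : 0 < s by rewrite lt_min !divr_gt0.
have s2 : s <= 1 / 2 by rewrite ge_min lexx.
have s8 : s <= eta / 8 by rewrite ge_min lexx orbT.
pose M0 := Num.max 1 ((2 / (2 * alpha * C)^-1) ^+ 4).
pose M := Num.max (2 * M0) ((2 / ((8 * alpha)^-1 / C)) ^+ 4).
have M01 : 1 <= M0 by rewrite le_max lexx.
have M2 : 2 * M0 <= M by rewrite le_max lexx.
have M1 : 0 < M by lra.
pose c := Num.min 1 (eta * s `^ alpha / 2).
have c0 : 0 < c by rewrite lt_min ltr01 divr_gt0// mulr_gt0// powR_gt0.
pose D := Num.max 1 (C * (1 + M) `^ (3 / 4)).
have D1 : 1 <= D by rewrite le_max lexx.
pose U := 18 * M * alpha * (s / 4) `^ (- alpha - 1).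
have U0 : 0 < U.
  by rewrite !mulr_gt0 ?powR_gt0 ?divr_gt0// (lt_le_trans _ al2).
pose W := (D + 1) * U ^+ 2.
have W0 : 0 < W by rewrite mulr_gt0 ?exprn_gt0//; lra.
(* With [D] and [U] fixed, the bound for the gap event is at most [g * W], so it is made small by
   [g] alone. *)
pose g := Num.min (s / 20) (eta / W).
have g0 : 0 < g by rewrite lt_min !divr_gt0.
have gs : g <= s / 20 by rewrite ge_min lexx.
have gW : g <= eta / W by rewrite ge_min lexx orbT.
pose g2 := Num.min g c.
have g20 : 0 < g2 by rewrite lt_min g0.
have g2c : g2 <= c by rewrite ge_min lexx orbT.
have g2g : g2 <= g by rewrite ge_min lexx.
(* Any divisor whose square exceeds 160 would do for [160 ep ^ 2 <= eps g ^ 2], a factor [eps] being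
   to spare. *)
pose ep := eps * g / 13.
have ep0 : 0 < ep by rewrite divr_gt0// mulr_gt0.
have epg : ep <= g / 130 by rewrite /ep; nra.
exists C, D, M0, M, s, c, g, g2, ep, (Num.truncn (alpha + 2)).+1; split.
- split => //.
  + by rewrite le_max lexx orbT.
  + by lra.
  + by rewrite ge_min lexx.
  + by rewrite le_max lexx orbT.
  + by rewrite le_max lexx orbT.
  + by lra.
  + by lra.
  + by lra.
  + have -> : 160 * ep ^+ 2 = eps * g ^+ 2 * (160 * eps / 169) by rewrite /ep; field.
    rewrite -[leRHS]mulr1 ler_wpM2l ?mulr_ge0 ?sqr_ge0 ?(ltW e0)//; lra.
  + rewrite /ep; have : eps * g <= eps * (s / 20) by rewrite ler_wpM2l// ltW.
    have : 0 < eps * s by rewrite mulr_gt0.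
    lra.
  + by have /truncn_itv/andP[_ /ltW] : 0 <= alpha + 2 by lra.
- split => //; rewrite ler_pdivrMr ?exprn_gt0//.
  have h : 6 <= C * eta by rewrite -ler_pdivrMr.
  have : C * eta <= C ^+ 2 * eta by rewrite ler_wpM2r ?(ltW h0)// expr2; nra.
  lra.
- rewrite ler_pdivrMr//.
  have : (2 * s) `^ alpha <= (2 * s) ^+ 2.
    rewrite -powR_mulrn; last by rewrite mulr_ge0// ltW.
    by rewrite /powR gt_eqF ?mulr_gt0// ler_expR ler_wnM2r// ln_le0//; lra.
  nra.
- have sa0 : 0 < s `^ alpha by rewrite powR_gt0.
  rewrite powRN ler_pdivrMr//.
  have : c <= eta * s `^ alpha / 2 by rewrite ge_min lexx orbT.
  lra.
- split; try lra.
  have h : g * W <= eta by rewrite -ler_pdivlMr.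
  have : (D + g) * g * U ^+ 2 <= (D + 1) * g * U ^+ 2.
    by rewrite ler_wpM2r ?sqr_ge0// ler_wpM2r ?(ltW g0)//; lra.
  rewrite -/U => h2; apply: (le_trans h2); move: h; rewrite /W; lra.
Qed.

Lemma typical_numerics (R : realType) (s a r M t L : R) (n K : nat) : 0 < s -> 1 <= a ->
  a ^+ 2 <= r -> 1 <= M -> 4 <= s * a -> t * a = r * L -> 4 * M <= s * L ->
  K%:R + 1 <= r -> n%:R <= M * r + 1 ->
  [/\ 1 <= s / 2 * a, 1 <= 2 * s * a, 1 <= s * a, 2 <= s * r &
   [/\ 1 <= M * r, 4 * (M * r) <= s * a * t, n%:R <= 2 * M * r & (n + K)%N%:R <= 2 * M * r]].
Proof.
move=> s0 a1 r2 M1 sa4 tE sL rK nM.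
have r1 : 1 <= r by apply: le_trans rK; rewrite lerDr.
have ar : a <= r by apply: le_trans r2; rewrite expr2 ler_peMl// (le_trans ler01).
have sr : s * a <= s * r by rewrite ler_wpM2l// ltW.
have Mr : r <= M * r by rewrite ler_peMl// (le_trans ler01).
split; try lra; split; try lra.
have -> : s * a * t = s * L * r by rewrite -mulrA [a * t]mulrC tE; ring.
by rewrite mulrA ler_wpM2r// (le_trans ler01).
Qed.

Section random_environment.
Context (R : realType) (alpha : R) (p : nat -> R).
Context d (Omega : measurableType d) (P : probability Omega R).
Context (xi0 : int -> Omega -> R) (B : nat -> Omega -> R).
Hypothesis al2 : 2 <= alpha.
Hypothesis p01 : forall n, 0 <= p n <= 1.
Local Notation X := (field_and_coins xi0 B).
Hypothesis indX : mutually_independent P X.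
Hypothesis law : forall z x, 1 <= x -> P [set w | x < xi0 z w] = (x `^ (- alpha))%:E.
Hypothesis coin1 : forall k, P [set w | B k w = 1] = (p k.+1)%:E.
Hypothesis eta_small : (fun n => eta_fun p n / kappa_fun alpha n) @ \oo --> (0 : R).

Let coin k : P (X (inr k) @^-1` @off R) = (1 - p k.+1)%:E.
Proof.
pose S := X (inr k) @^-1` [set 1].
have mS : measurable S by apply: (measurable_indX indX); exact: measurable_set1.
have -> : X (inr k) @^-1` @off R = ~` S by [].
rewrite (probability_setC P mS); have -> : S = [set w | B k w = 1] by [].
by rewrite coin1 EFinB.
Qed.

Lemma likely_typical (C C1 M0 M s c g g2 ep eps eta : R) (K : nat) :
  admissible alpha C C1 M0 M s c g g2 ep eps K -> 1 <= C /\ 6 / C ^+ 2 <= eta ->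
  2 * (2 * s) `^ alpha / s <= eta -> 2 * c * s `^ (- alpha) <= eta ->
  [/\ (C1 + g) * g * (18 * M * alpha * (s / 4) `^ (- alpha - 1)) ^+ 2 <= eta,
      20 * g <= s, ep < 1 & ep <= 2 * s] -> 0 < eta ->
  \forall t \near +oo%R, likely P (7 * eta)
    (fun w => typical C M s c g ep K t (peak alpha t) (range alpha t) (potential xi0 B w)).
Proof.
move=> ad [C_1 Ceta] seta ceta [geta gs ep1 eps2] eta0.
have s0 := ad_s ad; have c0 := ad_c ad; have g0 := ad_g ad; have ep0 := ad_ep ad.
have M01 := ad_M01 ad; have M2 := ad_M ad; have C0 := ad_C ad; have C11 := ad_C11 ad.
have M_gt0 : 0 < M by lra.
have M0M : M0 <= M by lra.
have M1 : 1 <= 2 * M by lra.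
have al0 : 0 <= alpha by exact: le_trans al2.
pose T := (s / 2) `^ (- alpha).
have T0 : 0 < T by rewrite powR_gt0// divr_gt0.
(* These are the smallness levels of the moment-weighted coin density that bring the events on
   squares, sums and isolation below [eta] each. *)
pose d1 := eta * ep ^+ 2 / 2.
pose d2 := eta * ep ^+ 2 / (4 * M * T).
pose d3 := eta / ((2 * K).+1%:R * T).
have d10 : 0 < d1 by rewrite divr_gt0// mulr_gt0// exprn_gt0.
have d20 : 0 < d2 by rewrite divr_gt0 ?mulr_gt0// exprn_gt0.
have d30 : 0 < d3 by rewrite divr_gt0// mulr_gt0.
have lawX z : pareto P alpha X (inl z) by move=> x; exact: law.
near=> t.
have [t0 L1 l1 _ _ _ _ a1 r2] : scale_facts alpha t by near: t; exact: scale_facts_near.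
have lt : late alpha C1 M0 M s c g g2 eps K t (peak alpha t) (range alpha t) (ln t).
  by near: t; exact: (late_near al2 ad).
have a4 : 4 / s <= peak alpha t by near: t; exact: peak_cvg.
have rc : 1 / c <= range alpha t by near: t; exact: range_cvg.
have rK : K%:R + 1 <= range alpha t by near: t; exact: range_cvg.
have [_ L4 _] : [/\ 0 < t, 4 * M / s <= ln (ln t) & 4 * M / s * ln (ln t) <= ln t].
  by near: t; exact: log_log_dominated.
have m1 : forall n : nat, n%:R <= 2 * M * range alpha t ->
    dyadic_moment alpha (dyadic_level alpha t) * (\sum_(k < n) (1 - p k.+1)) <= d1 * peak alpha t ^+ 2.
  by near: t; exact: coin_moment_small.
have m2 : forall n : nat, n%:R <= 2 * M * range alpha t ->
    dyadic_moment alpha (dyadic_level alpha t) * (\sum_(k < n) (1 - p k.+1)) <= d2 * peak alpha t ^+ 2.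
  by near: t; exact: coin_moment_small.
have m3 : forall n : nat, n%:R <= 2 * M * range alpha t ->
    dyadic_moment alpha (dyadic_level alpha t) * (\sum_(k < n) (1 - p k.+1)) <= d3 * peak alpha t ^+ 2.
  by near: t; exact: coin_moment_small.
have aJ := peak_le_dyadic a1.
have lL : ln (ln t) <= ln t by have [_ _ _ _ _ _ ? _ _] : scale_facts alpha t by near: t; exact: scale_facts_near.
set J := dyadic_level alpha t in m1 m2 m3 aJ.
set a := peak alpha t in a1 r2 lt a4 m1 m2 m3 aJ *.
have rE : range alpha t = a `^ alpha by [].
set r := range alpha t in r2 lt rc rK m1 m2 m3 rE *.
have a0 : 0 < a by exact: lt_le_trans a1.
have r1 : 1 <= r by exact: lt_r lt.
have r0 : 0 < r by exact: lt_le_trans r1.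
have sa4 : 4 <= s * a by move: a4; rewrite ler_pdivrMr// mulrC.
have cr1 : 1 <= c * r by move: rc; rewrite ler_pdivrMr// mulrC.
have sL4 : 4 * M <= s * ln t by have := le_trans L4 lL; rewrite ler_pdivrMr// [_ * s]mulrC.
pose n := (Num.truncn (M * r)).+1.
have nMr : n%:R <= M * r + 1.
  rewrite /n -[X in X <= _]natr1 lerD2r.
  by have /truncn_itv/andP[] : 0 <= M * r by rewrite mulr_ge0 ?(ltW r0) ?(ltW M_gt0).
have M_1 : 1 <= M by exact: le_trans M01 M0M.
have [sa2 sa2' sa1 sr2 [Mr1 tbig nM nKM]] :=
  typical_numerics s0 a1 r2 M_1 sa4 (lt_tE lt) sL4 rK nMr.
have epa0 : 0 < (ep * a) ^+ 2 by rewrite exprn_gt0// mulr_gt0.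
have Q0 m : 0 <= \sum_(k < m) (1 - p k.+1).
  by apply: sumr_ge0 => k _; rewrite subr_ge0; have /andP[] := p01 k.+1.
have V1 : 1 <= dyadic_moment alpha J.
  rewrite lerDl; apply: sumr_ge0 => j _.
  by rewrite mulr_ge0 ?exprn_ge0 ?powR_ge0.
have E1 := likely_le Ceta (likely_envelope al2 indX lawX a1 rE C_1).
have E2 := likely_le seta (likely_high indX lawX a1 rE s0 sa2' sr2).
have E3 := likely_le ceta (likely_low indX lawX a1 rE s0 c0 sa1 cr1).
have E4 := likely_le geta (likely_gap al2 indX lawX a1 rE t0 s0 g0 gs sa4 M_gt0 Mr1 tbig (le_trans ler01 C11)).
have b5 : 2 * dyadic_moment alpha J * (\sum_(k < n) (1 - p k.+1)) / (ep * a) ^+ 2 <= eta.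
  rewrite ler_pdivrMr// -mulrA.
  have -> : eta * (ep * a) ^+ 2 = 2 * (d1 * a ^+ 2) by rewrite /d1; field.
  by rewrite ler_wpM2l// m1.
have E5 := likely_le b5 (likely_squares indX lawX coin aJ n epa0).
have b6 : n%:R * (T / r * (2 * dyadic_moment alpha J * \sum_(k < n) (1 - p k.+1))) / (ep * a) ^+ 2 <= eta.
  rewrite ler_pdivrMr//.
  have -> : eta * (ep * a) ^+ 2 = 2 * M * r * (T / r * (2 * (d2 * a ^+ 2))).
    by rewrite /d2; field; rewrite !gt_eqF.
  apply: ler_pM => //.
    by rewrite !mulr_ge0 ?invr_ge0 ?(ltW T0) ?(ltW r0) ?(le_trans ler01 V1).
  by rewrite ler_wpM2l ?divr_ge0 ?(ltW T0) ?(ltW r0)// -mulrA ler_wpM2l// m2.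
have E6 := likely_le b6 (likely_sums al0 indX lawX coin a1 aJ rE n sa2 s0 epa0).
have b7 : (2 * K).+1%:R * (T / r * \sum_(k < n + K) (1 - p k.+1)) <= eta.
  have h : \sum_(k < n + K) (1 - p k.+1) <= d3 * r.
    apply: (@le_trans _ _ (d3 * a ^+ 2)); last by rewrite ler_wpM2l// ltW.
    by apply: le_trans (m3 _ nKM); rewrite ler_peMl.
  have -> : eta = (2 * K).+1%:R * (T / r * (d3 * r)).
    by rewrite /d3; field; rewrite !gt_eqF.
  by rewrite ler_wpM2l// ler_wpM2l// divr_ge0// ltW.
have E7 := likely_le b7 (likely_isolated indX lawX coin a1 rE (n + K) K sa2 s0).
have sM : s <= M by exact: le_trans (ad_sM0 ad) M0M.
have := likelyI E1 (likelyI E2 (likelyI E3 (likelyI E4 (likelyI E5 (likelyI E6 E7))))).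
move=> H; apply: likely_le (likely_sub _ H).
  by rewrite le_eqVlt; apply/orP; left; apply/eqP; ring.
move=> w [e1 [e2 [e3 [e4 [e5 [e6 e7]]]]]].
exact: (typical_potential a1 r1 C0 (ad_C1 ad) s0 sM ep0 ep1 eps2 e1 e2 e3 e4 e5 e6 e7).
Unshelve. all: by end_near. Qed.

End random_environment.

Theorem theorem1p2 (R : realType) (alpha : R) (p : nat -> R)
  (d : measure_display) (Omega : measurableType d) (P : probability Omega R)
  (xi0 : int -> Omega -> R) (B : nat -> Omega -> R)
  (d' : measure_display) (Omega' : measurableType d') (Q : probability Omega' R)
  (E D : nat -> Omega' -> R) (X : R -> Omega' -> int)
  (Z : R -> Omega -> nat) :
  2 <= alpha ->
  (* p : N -> [0,1], eventually nondecreasing, p(n) -> 1 *)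
  (forall n, 0 <= p n <= 1) ->
  (exists N, forall m n, (N <= m <= n)%N -> p m <= p n) ->
  p @ \oo --> (1 : R) ->
  (* the potential: xi_0 i.i.d. Pareto(alpha), independent coins B *)
  mutually_independent P
    (fun i : int + nat => match i with inl z => xi0 z | inr k => B k end) ->
  (forall z x, 1 <= x -> P [set w | x < xi0 z w] = (x `^ (- alpha))%:E) ->
  (forall k, P [set w | B k w = 1] = (p k.+1)%:E) ->
  (forall k, P [set w | B k w = 0] = (1 - p k.+1)%:E) ->
  (* the continuous-time simple random walk with generator Delta started at 0 *)
  mutually_independent Q
    (fun i : nat + nat => match i with inl k => E k | inr k => D k end) ->
  (forall k x, 0 <= x -> Q [set w | x < E k w] = (expR (- (2 * x)))%:E) ->
  (forall k, Q [set w | D k w = 1] = (1 / 2)%:E) ->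
  (forall k, Q [set w | D k w = -1] = (1 / 2)%:E) ->
  is_walk E D X ->
  (* Z t is a maximiser of Psi_t over D whenever one exists *)
  (forall t w, (exists z, is_max_Psi (potential xi0 B w) t z) ->
     is_max_Psi (potential xi0 B w) t (Z t w)) ->
  (* eta = o(kappa) *)
  (fun n => eta_fun p n / kappa_fun alpha n) @ \oo --> (0 : R) ->
  (* u(t, Z_t) / u(t, -Z_t) -> 1 in probability as t -> oo *)
  forall eps delta : R, 0 < eps -> 0 < delta ->
  \forall t \near +oo%R, exists A : set Omega,
    [/\ measurable A, (P A < delta%:E)%E &
        [set w | eps < `| fine (fk_solution Q X (potential xi0 B w) t (Posz (Z t w)))
                          / fine (fk_solution Q X (potential xi0 B w) t (- Posz (Z t w)))
                          - 1 |] `<=` A].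
Proof.
move=> al2 p01 _ _ indX law coin1 _ indED lawE lawD1 lawDN1 walkX Zmax eta_small e delta e0 delta0.
(* The ratio is controlled up to [10 * eps], and seven exceptional events of probability [delta / 8]
   leave a strict inequality with [delta]. *)
pose eps := Num.min (e / 10) (1 / 10).
have eps0 : 0 < eps by rewrite lt_min !divr_gt0.
have eps1 : eps <= 1 / 10 by rewrite ge_min lexx orbT.
have epse : 10 * eps <= e by rewrite -ler_pdivlMl// mulrC ge_min lexx.
have eta0 : 0 < delta / 8 by rewrite divr_gt0.
have [C [C1 [M0 [M [s [c [g [g2 [ep [K [ad bC bs bc bg]]]]]]]]]]] :=
  admissible_exists al2 eps0 eps1 eta0.
have indX' : mutually_independent P (field_and_coins xi0 B) by [].
near=> t.
have [A [mA PA HA]] : likely P (7 * (delta / 8)) (fun w => typical C M s c g ep K t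
    (peak alpha t) (range alpha t) (potential xi0 B w)).
  by near: t; exact: (likely_typical al2 p01 indX' law coin1 eta_small ad bC bs bc bg eta0).
have lt : late alpha C1 M0 M s c g g2 eps K t (peak alpha t) (range alpha t) (ln t).
  by near: t; exact: (late_near al2 ad).
exists A; split => //.
  by apply: (le_lt_trans PA); rewrite lte_fin; lra.
move=> w /= big; apply: contrapT => nA; have ty := HA w nA.
have Zm := Zmax t w (typical_max_exists ad lt ty).
have := typical_ratio indED lawE lawD1 lawDN1 walkX ad lt ty Zm.
by move=> /le_trans/(_ epse); rewrite leNgt big.
Unshelve. all: by end_near. Qed.
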